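(* Let $\Gamma$ be a set and let $\mathscr{A}$ be an adequate family of subsets of $\Gamma$. Then the following are equivalent. (1) $K_{\mathscr{A}}$ is a Gruenhage compact space; (2) $h_{\mathscr{A}}$ admits an equivalent norm with strictly convex dual norm; (3) there exists a strictly increasing, $\tau_p$-lower semicontinuous map $\rho:K_{\mathscr{A}}\to[0,1]$; (4) $K_{\mathscr{A}}$ is a descriptive compact space.
   Context: A family $\mathscr{A}$ of subsets of $\Gamma$ is adequate (on $\Gamma$) if: (i) $\{\gamma\}\in\mathscr{A}$ for all $\gamma\in\Gamma$; (ii) $B\in\mathscr{A}$ whenever $A\in\mathscr{A}$ and $B\subseteq A$; (iii) if $A\subseteq\Gamma$ and every finite subset of $A$ is in $\mathscr{A}$, then $A\in\mathscr{A}$. $K_{\mathscr{A}}=\{\chi_A:A\in\mathscr{A}\}\subseteq\{0,1\}^\Gamma$, where $\chi_A$ is the indicator function of $A$, with the pointwise (product) topology $\tau_p$; it is compact. For an adequate family $\mathscr{A}$, $\ell_{\mathscr{A}}$ is the space of all $x\in\ell_\infty(\Gamma)$ (real-valued) with $\|x\|_{\mathscr{A}}<\infty$, where $\|x\|_{\mathscr{A}}=\sup_{A\in\mathscr{A}}\sum_{\gamma\in A}|x_\gamma|$. The space $h_{\mathscr{A}}$ is the $\|\cdot\|_{\mathscr{A}}$-closed linear span in $\ell_{\mathscr{A}}$ of the standard unit vectors $(e_\gamma)_{\gamma\in\Gamma}$. A norm $\|\cdot\|$ is strictly convex if $x=y$ whenever $\|x\|=\|y\|=\frac12\|x+y\|$.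 A map $\rho$ on $K_{\mathscr{A}}$ is strictly increasing if $\rho(\chi_B)<\rho(\chi_A)$ whenever $A,B\in\mathscr{A}$ and $B\subsetneq A$. Let $(Z,\tau)$ be a regular topological space. $Z$ is a Gruenhage space if there exist families $(\mathscr{U}_n)_{n\in\mathbb{N}}$ of open sets such that, given distinct $x,y\in Z$, there exist $n\in\mathbb{N}$ and $U\in\mathscr{U}_n$ such that $U\cap\{x,y\}$ is a singleton, and either $x$ lies in only finitely many $U'\in\mathscr{U}_n$ or $y$ lies in only finitely many $U'\in\mathscr{U}_n$. A family $\mathscr{N}$ of subsets of $Z$ is a network for $Z$ if, given $x\in U\in\tau$, there is $N\in\mathscr{N}$ with $x\in N\subseteq U$. A family $\mathscr{F}$ of subsets of $Z$ is isolated if $E\cap\overline{\bigcup(\mathscr{F}\setminus\{E\})}=\varnothing$ for every $E\in\mathscr{F}$. A network is $\sigma$-isolated if it can be written as $\bigcup_{n=1}^\infty\mathscr{N}_n$ with each $\mathscr{N}_n$ isolated. $Z$ is descriptive if it is compact and admits a $\sigma$-isolated network. *)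

(* Defs.v *)
From HB Require Import structures.
From mathcomp Require Import all_boot all_order all_algebra.
From mathcomp Require Import all_classical all_reals all_analysis.

Set Implicit Arguments.
Unset Strict Implicit.
Unset Printing Implicit Defensive.

Import Order.TTheory GRing.Theory Num.Theory.
Import numFieldNormedType.Exports.

Local Open Scope classical_set_scope.
Local Open Scope ring_scope.

Section topology.
Variable Z : topologicalType.

Definition Gruenhage_space := regular_space Z /\
  exists U : nat -> set (set Z),
    (forall n V, U n V -> open V) /\
    forall x y : Z, x <> y -> exists n V,
      [/\ U n V,
          exists z, V `&` [set x; y] = [set z] &
          finite_set [set W | U n W /\ W x] \/
          finite_set [set W | U n W /\ W y]].

Definition network (N : set (set Z)) :=
  forall (x : Z) (U : set Z), open U -> U x ->
    exists E, [/\ N E, E x & E `<=` U].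

Definition isolated_family (F : set (set Z)) :=
  forall E, F E -> E `&` closure (\bigcup_(G in F `\ E) G) = set0.

Definition sigma_isolated (N : set (set Z)) :=
  exists F : nat -> set (set Z),
    (forall n, isolated_family (F n)) /\ N = \bigcup_n F n.

Definition descriptive_space :=
  [/\ regular_space Z, compact [set: Z] &
      exists N : set (set Z), network N /\ sigma_isolated N].

End topology.

Section norms.
Variable R : realType.

(* [D] is the linear subspace on which [N] is regarded as a norm. *)
Definition strictly_convex (V : lmodType R) (D : set V) (N : V -> R) :=
  forall x y, D x -> D y -> N x = N y -> N y = 2^-1 * N (x + y) -> x = y.

Definition is_norm (V : lmodType R) (N : V -> R) :=
  [/\ forall x y, N (x + y) <= N x + N y,
      forall (a : R) x, N (a *: x) = `|a| * N x &
      forall x, N x = 0 -> x = 0].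

Definition equivalent_norm (V : normedModType R) (N : V -> R) :=
  is_norm N /\ exists c C : R,
    [/\ 0 < c, 0 < C & forall x, c * `|x| <= N x <= C * `|x|].

Definition dual (V : lmodType R) (N : V -> R) : set (V -> R) :=
  [set f | scalar f /\ exists M : R, forall x, `|f x| <= M * N x].

Definition dual_norm (V : lmodType R) (N : V -> R) (f : V -> R) : R :=
  sup [set `|f x| | x in [set x | N x <= 1]].

Definition linear_span (V : lmodType R) (S : set V) : set V :=
  [set v | exists n (c : 'I_n -> R) (s : 'I_n -> V),
     (forall i, S (s i)) /\ v = \sum_(i < n) c i *: s i].

Lemma linear_span_submod (V : lmodType R) (S : set V) (a : R) (v w : V) :
  linear_span S v -> linear_span S w -> linear_span S (a *: v + w).
Proof.
move=> [n [c [s [Ss ->]]]] [m [d [t [St ->]]]].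
exists (n + m)%N,
  (fun i => match fintype.split i with inl j => a * c j | inr j => d j end),
  (fun i => match fintype.split i with inl j => s j | inr j => t j end).
split=> [i|]; first by case: splitP.
rewrite big_split_ord/= scaler_sumr; congr (_ + _); apply: eq_bigr => i _.
  by rewrite (unsplitK (inl i)) scalerA.
by rewrite (unsplitK (inr i)).
Qed.

Lemma closure_normP (V : normedModType R) (S : set V) (x : V) :
  closure S x <-> forall e : R, 0 < e -> exists2 y, S y & `|x - y| < e.
Proof.
split=> [Sx e e0|H B /nbhs_ballP[e /= e0 eB]].
  have [y [Sy xy]] := Sx _ (nbhsx_ballx x e e0).
  by exists y => //; move: xy; rewrite -ball_normE.
have [y Sy xy] := H e e0; exists y; split=> //.
by apply: eB; rewrite -ball_normE.
Qed.

Lemma closure_span_submod_closed (V : normedModType R) (S : set V) :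
  submod_closed [in closure (linear_span S)].
Proof.
split.
  rewrite inE; apply: subset_closure.
  by exists 0%N, (fun=> 0), (fun=> 0); split=> [[]//|]; rewrite big_ord0.
move=> a v w; rewrite !inE => /closure_normP Sv /closure_normP Sw.
apply/closure_normP => e e0.
have a0 : 0 < `|a| + 1 by rewrite ltr_wpDl.
have e2 : 0 < e / 2 by rewrite divr_gt0.
have [v' Sv' vv'] := Sv _ (divr_gt0 e2 a0).
have [w' Sw' ww'] := Sw _ e2.
exists (a *: v' + w'); first exact: linear_span_submod.
rewrite opprD addrACA -scalerBr (le_lt_trans (ler_normD _ _))//.
rewrite [ltRHS](splitr e) ler_ltD// normrZ.
rewrite (@le_trans _ _ ((`|a| + 1) * `|v - v'|))// ?ler_wpM2r ?lerDl//.
by rewrite mulrC -ler_pdivlMr// ltW.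
Qed.

End norms.

Section adequate.
Variable Gamma : choiceType.

Definition adequate (A : set (set Gamma)) :=
  [/\ forall g, A [set g],
      forall B C, A B -> C `<=` B -> A C &
      forall B, (forall F, finite_set F -> F `<=` B -> A F) -> A B].

Definition chi (B : set Gamma) : prod_topology (fun _ : Gamma => bool) :=
  fun g => g \in B.

Definition K (A : set (set Gamma)) : set (prod_topology (fun _ : Gamma => bool)) :=
  [set chi B | B in A].

Lemma chi_in_K (A : set (set Gamma)) (B : set Gamma) : A B -> chi B \in K A.
Proof. by move=> AB; rewrite inE; exists B. Qed.

Definition chiK (A : set (set Gamma)) (B : set Gamma) (AB : A B) : K A :=
  exist _ (chi B) (chi_in_K AB).

Definition strictly_increasing (R : realType) (A : set (set Gamma))
    (rho : K A -> R) :=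
  forall (B C : set Gamma) (AB : A B) (AC : A C),
    B `<` C -> rho (chiK AB) < rho (chiK AC).

End adequate.

Section ell.
Variables (R : realType) (Gamma : choiceType).
Implicit Types (A : set (set Gamma)) (x : Gamma -> R).

Definition sumnorm A x : \bar R :=
  ereal_sup [set (\esum_(g in B) `|x g|%:E)%E | B in A].

Definition ell_pred A : {pred Gamma -> R} :=
  [pred x | `[< (exists M : R, forall g, `|x g| <= M) /\
                (sumnorm A x < +oo)%E >]].

Lemma sumnorm_ge0 A x : A !=set0 -> (0 <= sumnorm A x)%E.
Proof.
move=> [B AB]; apply: le_trans (ereal_sup_ubound _); last by exists B.
by apply: esum_ge0 => g _; rewrite lee_fin.
Qed.

Lemma sumnorm_set0 x : sumnorm set0 x = -oo%E.
Proof. by rewrite /sumnorm image_set0 ereal_sup0. Qed.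

Lemma sumnorm0_lty A : (sumnorm A 0%R < +oo)%E.
Proof.
apply: (@le_lt_trans _ _ 0%E) => //; apply: ge_ereal_sup => _ [B AB <-].
by rewrite esum1// => g _; rewrite normr0.
Qed.

Lemma sumnormD A x y : A !=set0 ->
  (sumnorm A (x + y)%R <= sumnorm A x + sumnorm A y)%E.
Proof.
move=> A0; apply: ge_ereal_sup => _ [B AB <-].
apply: (@le_trans _ _
  (\esum_(g in B) `|x g|%:E + \esum_(g in B) `|y g|%:E)%E).
  rewrite -esumD; last 2 first.
  - by move=> g _; rewrite lee_fin.
  - by move=> g _; rewrite lee_fin.
  by apply: le_esum => g _; rewrite -EFinD lee_fin ler_normD.
by apply: leeD; apply: ereal_sup_ubound; exists B.
Qed.

Lemma sumnormZ_le A (a : R) x :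
  (forall B, A B -> \esum_(g in B) `|(a *: x)%R g|%:E <=
     `|a|%:E * \esum_(g in B) `|x g|%:E)%E.
Proof.
move=> B AB.
have ge0 g : (0 <= `|x g|%:E)%E by rewrite lee_fin.
apply: ge_ereal_sup => _ [F [finF FB] <-].
have -> : (\sum_(i \in F) `|(a *: x) i|%:E =
           `|a|%:E * \sum_(i \in F) `|x i|%:E)%E.
  rewrite ge0_mule_fsumr//; apply: eq_fsbigr => g _.
  by rewrite -EFinM -normrM.
apply: lee_wpmul2l; first by rewrite lee_fin.
by apply: ereal_sup_ubound; exists F.
Qed.

Lemma ell_submod_closed A : submod_closed (ell_pred A).
Proof.
split; first by apply/asboolP; split;
  [exists 0 => g; rewrite normr0|exact: sumnorm0_lty].
move=> a x y /asboolP[[M xM] xA] /asboolP[[N yN] yA]; apply/asboolP; split.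
  exists (`|a| * M + N) => g; apply: le_trans (ler_normD _ _) _.
  by apply: lerD => //; rewrite normrM ler_wpM2l.
have [->|A0] := eqVneq A set0; first by rewrite sumnorm_set0.
move/set0P : A0 => A0.
apply: (le_lt_trans (sumnormD _ _ A0)); apply: lte_add_pinfty => //.
apply: (@le_lt_trans _ _ (`|a|%:E * sumnorm A x)%E).
  apply: ge_ereal_sup => _ [B AB <-]; apply: le_trans (sumnormZ_le _ _ AB) _.
  apply: lee_wpmul2l; first by rewrite lee_fin.
  by apply: ereal_sup_ubound; exists B.
apply: lte_mul_pinfty => //.
Qed.

HB.instance Definition _ A :=
  GRing.isSubmodClosed.Build _ _ (ell_pred A) (@ell_submod_closed A).

(* The proof of adequacy is a parameter of the type because it is what makes
   the seminorm [sumnorm A] a norm. *)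
Definition ell A (hA : adequate A) := {x : Gamma -> R | x \in ell_pred A}.

Section ell_normed.
Variables (A : set (set Gamma)) (hA : adequate A).

HB.instance Definition _ := SubChoice.on (ell hA).
HB.instance Definition _ := [SubChoice_isSubLmodule of ell hA by <:].

(* If [Gamma] and [A] are both empty, then [sumnorm A] is constantly [-oo],
   the supremum of the empty set, and [fine] turns it into [0]. *)
Definition ell_norm (x : ell hA) : R := fine (sumnorm A (val x)).

Lemma sumnorm_ell (x : ell hA) : A !=set0 ->
  sumnorm A (val x) = (ell_norm x)%:E.
Proof.
move=> A0; rewrite fineK// ge0_fin_numE ?sumnorm_ge0//.
by have /asboolP[] := valP x.
Qed.

Lemma ell_norm_set0 (x : ell hA) : A = set0 -> ell_norm x = 0.
Proof.
move=> A0; have : sumnorm A (val x) = -oo%E by rewrite -(sumnorm_set0 (val x)) -A0.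
by rewrite /ell_norm => ->.
Qed.

Lemma ell_normD (x y : ell hA) : ell_norm (x + y) <= ell_norm x + ell_norm y.
Proof.
have [A0|/set0P A0] := eqVneq A set0; first by rewrite !ell_norm_set0// addr0.
by rewrite -lee_fin EFinD -!sumnorm_ell//; exact: sumnormD.
Qed.

Lemma ell_normZ_le (a : R) (x : ell hA) : ell_norm (a *: x) <= `|a| * ell_norm x.
Proof.
have [A0|/set0P A0] := eqVneq A set0; first by rewrite !ell_norm_set0// mulr0.
rewrite -lee_fin EFinM -!sumnorm_ell//.
apply: ge_ereal_sup => _ [B AB <-]; apply: le_trans (sumnormZ_le _ _ AB) _.
apply: lee_wpmul2l; first by rewrite lee_fin.
by apply: ereal_sup_ubound; exists B.
Qed.

Lemma ell_norm0_eq0 (x : ell hA) : ell_norm x = 0 -> x = 0.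
Proof.
move=> x0; apply/val_inj/funext => g /=.
have Ag : A [set g] by case: hA.
have A0 : A !=set0 by exists [set g].
have : (\esum_(h in [set g]) `|val x h|%:E <= 0)%E.
  rewrite -[leRHS]/(0%:E) -x0 -sumnorm_ell//.
  by apply: ereal_sup_ubound; exists [set g].
by rewrite esum_set1 ?lee_fin// normr_le0 => /eqP.
Qed.

Lemma ell_norm_ge0 (x : ell hA) : 0 <= ell_norm x.
Proof.
have [A0|/set0P A0] := eqVneq A set0; first by rewrite ell_norm_set0.
by apply: fine_ge0; exact: sumnorm_ge0.
Qed.

Lemma ell_normZ (a : R) (x : ell hA) : ell_norm (a *: x) = `|a| * ell_norm x.
Proof.
apply/eqP; rewrite eq_le ell_normZ_le/=.
have [->|a0] := eqVneq a 0; first by rewrite normr0 mul0r ell_norm_ge0.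
rewrite -ler_pdivlMl ?normr_gt0// -normfV.
rewrite -[in leLHS](scale1r x) -(mulVf a0) -scalerA.
exact: ell_normZ_le.
Qed.

HB.instance Definition _ := Lmodule_isNormed.Build R (ell hA)
  ell_normD ell_normZ ell_norm0_eq0.

Lemma unit_vector_in_ell (g : Gamma) : (fun h => (h == g)%:R) \in ell_pred A.
Proof.
apply/asboolP; split.
  by exists 1 => h; case: eqP => _; rewrite ?normr1 ?normr0.
apply: (@le_lt_trans _ _ 1%E); last exact: ltry.
apply: ge_ereal_sup => _ [B AB <-].
apply: (@le_trans _ _ (\esum_(h in [set g]) `|(h == g)%:R|%:E)%E).
  rewrite (esum_mkcond B) (esum_mkcond [set g]); apply: le_esum => h _.
  have [->|hg] := eqVneq h g.
    by rewrite [g \in [set g]]mem_set//; case: ifP => // _; rewrite lee_fin.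
  by rewrite normr0; case: ifP; case: ifP.
by rewrite esum_set1 ?lee_fin// eqxx normr1.
Qed.

Definition unit_vector (g : Gamma) : ell hA :=
  exist (fun x => x \in ell_pred A) _ (unit_vector_in_ell g).

Definition h_pred : {pred ell hA} :=
  [in closure (linear_span (range unit_vector))].

Lemma h_submod_closed : submod_closed h_pred.
Proof. exact: closure_span_submod_closed. Qed.

HB.instance Definition _ :=
  GRing.isSubmodClosed.Build _ _ h_pred h_submod_closed.

Definition h_space := {x : ell hA | x \in h_pred}.

HB.instance Definition _ := SubChoice.on h_space.
HB.instance Definition _ := [SubChoice_isSubLmodule of h_space by <:].

Definition h_norm (x : h_space) : R := `|val x|.

Lemma h_normD (x y : h_space) : h_norm (x + y) <= h_norm x + h_norm y.
Proof. exact: ler_normD. Qed.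

Lemma h_normZ (a : R) (x : h_space) : h_norm (a *: x) = `|a| * h_norm x.
Proof. exact: normrZ. Qed.

Lemma h_norm0_eq0 (x : h_space) : h_norm x = 0 -> x = 0.
Proof. by move=> /normr0_eq0 x0; exact: val_inj. Qed.

HB.instance Definition _ := Lmodule_isNormed.Build R h_space
  h_normD h_normZ h_norm0_eq0.

End ell_normed.
End ell.

(* Main.v *)
(* (4) => (1): if [N] is an isolated family and [U_E] is the complement of the
   closure of the union of the members of [N] other than [E], then [U_E] misses
   these members; the open sets [U_E] and [U_E \ cl E] separate points.

   (3) => (4): for [q < rho B], the set [D q B] of all [a] in [B] with
   [rho (B \ a) <= q] is finite and depends upper semicontinuously on [B].
   Hence, for rational [q], [p] and a given cardinality, the classes of the [B]
   with [q < rho B <= p] on which [D q B] is constant form an isolated family.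

   (2) => (3): [rho B] is the supremum, over the finite subsets [s] of [B], of
   the average over all signs of the squared dual norm of [sum_(g in s) +-e_g].
   Strict convexity makes every single average strict, and a limit of
   sign vectors along which nothing is gained would contradict it.

   (1) => (2): the Gruenhage families yield countably many sunflowers, stable
   under intersections of petals, whose petals with the kernel removed separate
   points and therefore determine every finitely additive content on the clopen
   sets.  The new norm is the supremum of a class of pairs of positive
   functionals on the bounded functions on [K A].  As in Day's norm, the class
   is given by a weighted l2-constraint on the contents of the kernels and on
   the largest sums of contents of [k] petals; equality in the convexity
   inequality for the dual norm makes all these numbers coincide. *)

(* The obstacle in (2) => (3) is that a supremum of strict inequalities is only weak; hence a
   hypothetical equality is followed through the whole tree of signs to a limit vector, where a
   single strict inequality refutes it.

   In (1) => (2), finitely additive contents on clopen sets, with their outer contents, play the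
   part of Radon measures. The supremum [p] of the admissible class is sublinear. Hahn-Banach gives
   each functional of the dual ball a representative below [p], and an AM-GM test shows that this
   representative is itself admissible; so the dual ball is the class restricted to the range of
   [T]. Representatives are not unique: two of them are compared only on indicators of clopen sets,
   which settles unit vectors and, by density, all of [h_space]. Pairs occur because contents must
   be positive while functionals are not; on [T x] a pair acts as the difference of its parts.
   Points of [K A] norm the space up to a factor 2, since coordinates can be split by sign. *)
Require Import Defs.
From HB Require Import structures.
From mathcomp Require Import all_boot all_order all_algebra.
From mathcomp Require Import lra.
From mathcomp Require Import all_classical all_reals all_analysis.

Set Implicit Arguments.
Unset Strict Implicit.
Unset Printing Implicit Defensive.

Import Order.TTheory GRing.Theory Num.Theory.
Import numFieldNormedType.Exports.

Local Open Scope classical_set_scope.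
Local Open Scope ring_scope.

(** * Clopen sets and descriptive spaces *)

Section compact_zero_dimensional.
Variable Z : topologicalType.

Lemma compact_subcover (I : choiceType) (C : set Z) (f : I -> set Z) :
  compact [set: Z] -> closed C -> (forall i, open (f i)) ->
  C `<=` \bigcup_i f i -> exists s : seq I, forall x, C x -> exists2 i, i \in s & f i x.
Proof.
move=> Zcpt Ccl fop Cf.
have /compact_near_coveringP ncC : compact C.
  by apply: subclosed_compact Ccl Zcpt _.
(* Final segments of the finite lists under inclusion: a near-covering along this filter amounts to
   a finite subcover. *)
pose F : set_system (seq I) := filter_from setT (fun s : seq I => [set t : seq I | {subset s <= t}]).
have FF : Filter F.
  apply: filter_from_filter; first by exists [::].
  move=> s t _ _; exists (s ++ t) => // u /= stu; split=> i is_; apply: stu;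
    by rewrite mem_cat is_ ?orbT.
have [|s _ sP] := ncC _ F (fun s x => exists2 i, i \in s & f i x) FF.
  move=> x /Cf[i _ fix_]; exists (f i, [set t | i \in t]).
    split=> /=; first by apply: open_nbhs_nbhs; split.
    by exists [:: i] => // t; apply; rewrite mem_head.
  by move=> [y t] /= [fiy it]; exists i.
by exists s => x Cx; apply: (sP s).
Qed.

Definition clopen_base := forall (x : Z) (U : set Z), open U -> U x ->
  exists C, [/\ clopen C, C x & C `<=` U].

Lemma clopen_base_regular : clopen_base -> regular_space Z.
Proof.
move=> clb x U Ux; rewrite nbhsE in Ux; case: Ux => V [Vop Vx] VU.
have [C [[Cop Ccl] Cx CV]] := clb _ _ Vop Vx.
have xC : nbhs x C by apply: open_nbhs_nbhs; split.
exists C; first exact: xC.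
by rewrite -(closure_id C).1//; exact: subset_trans VU.
Qed.

Lemma clopen_bigcup_seq (I : eqType) (s : seq I) (f : I -> set Z) :
  (forall i, i \in s -> clopen (f i)) -> clopen (\big[setU/set0]_(i <- s) f i).
Proof.
elim: s => [|a s IHs] fcl; first by rewrite big_nil; split; [exact: open0|exact: closed0].
rewrite big_cons.
have [? ?] : clopen (f a) by apply: fcl; rewrite mem_head.
have [? ?] : clopen (\big[setU/set0]_(i <- s) f i).
  by apply: IHs => i is_; apply: fcl; rewrite in_cons is_ orbT.
by split; [exact: openU|exact: closedU].
Qed.

Lemma clopen_interpolation (C U : set Z) : compact [set: Z] -> clopen_base ->
  closed C -> open U -> C `<=` U -> exists D, [/\ clopen D, C `<=` D & D `<=` U].
Proof.
move=> Zcpt clb Ccl Uop CU.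
(* Sets outside the family are sent to the empty set, so that all of [set Z] can serve as index
   type. *)
pose f (B : set Z) := if `[< clopen B /\ B `<=` U >] then B else set0.
have fop B : open (f B).
  by rewrite /f; case: asboolP => [[[]]//|_]; exact: open0.
have fcl B : clopen (f B).
  rewrite /f; case: asboolP => [[[]]//|_]; split; [exact: open0|exact: closed0].
have fU B : f B `<=` U by rewrite /f; case: asboolP => [[]|_].
have [|s sP] := compact_subcover Zcpt Ccl fop.
  move=> x /CU Ux; have [B [Bcl Bx BU]] := clb _ _ Uop Ux.
  by exists B => //; rewrite /f; case: asboolP => // -[].
exists (\big[setU/set0]_(B <- s) f B); split.
- exact: clopen_bigcup_seq.
- by move=> x /sP[B Bs fBx]; rewrite -bigcup_seq; exists B.
- by rewrite -bigcup_seq => x [B _ /fU].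
Qed.

(** The part of [C] outside [V] is closed and lies in the open intersection of [U] and [C]; any
    clopen set in between serves as [D]. This makes inner contents subadditive on open sets. *)
Lemma clopen_disjoint_split (C U V : set Z) : compact [set: Z] -> clopen_base ->
  clopen C -> open U -> open V -> C `<=` U `|` V ->
  exists D E, [/\ clopen D, clopen E, D `<=` U, E `<=` V & C = D `|` E /\ D `&` E = set0].
Proof.
move=> Zcpt clb [Cop Ccl] Uop Vop CUV.
have [D [[Dop Dcl] CD DU]] : exists D, [/\ clopen D, C `\` V `<=` D & D `<=` U `&` C].
  apply: clopen_interpolation => //.
  - by rewrite setDE; apply: closedI => //; exact: open_closedC.
  - exact: openI.
  - by move=> x [Cx nVx]; split=> //; case: (CUV _ Cx).
exists D, (C `\` D); split.
- by [].
- split; rewrite setDE; [apply: openI => //; exact: closed_openC|].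
  by apply: closedI => //; exact: open_closedC.
- by move=> x /DU[].
- by move=> x [Cx nDx]; apply: contrapT => nVx; apply: nDx; exact: CD.
- split; last by rewrite setDE setICA setICr setI0.
  apply/seteqP; split=> x; last by move=> [/DU[]|[]].
  by move=> Cx; case: (pselect (D x)) => ?; [left|right].
Qed.

End compact_zero_dimensional.

(** * From isolated networks to Gruenhage families *)

Section descriptive_Gruenhage.
Variable Z : topologicalType.

Lemma descriptive_Gruenhage :
  clopen_base Z -> hausdorff_space Z -> descriptive_space Z -> Gruenhage_space Z.
Proof.
move=> clb Zhd [Zreg _ [N [netN [F [isoF NE]]]]]; split=> //.
pose O n E := ~` closure (\bigcup_(G in F n `\ E) G).
have Oop n E : open (O n E) by exact/closed_openC/closed_closure.
have OE n E : F n E -> E `<=` O n E.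
  by move=> FE x Ex cx; rewrite -[False]/(set0 x) -(isoF _ _ FE).
have Odisj n E G : F n E -> F n G -> E <> G -> E `&` O n G = set0.
  move=> FE FG EG; rewrite -subset0 => x [Ex]; apply; apply: subset_closure.
  by exists E => //; split.
(* Index [2n+1] carries the sets [O n E], index [2n] the sets [O n E] minus the closure of [E]. By
   isolation a point [x] of [E] lies in just one set of the first kind and in none of the second, so
   [x] is always the point of finite order. *)
exists (fun n => [set W | exists2 E, F n./2 E &
  W = if odd n then O n./2 E else O n./2 E `\` closure E]); split.
  move=> n V [E _ ->]; case: ifP => // _; rewrite setDE; apply: openI => //.
  exact/closed_openC/closed_closure.
move=> x y /eqP xy.
(* A network member inside a clopen [C] has its closure inside [C], so the closure still misses
   [y]. *)
have [C [[Cop Ccl] Cx nCy]] : exists C : set Z, [/\ clopen C, C x & ~ C y].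
  move: Zhd; rewrite open_hausdorff => /(_ _ _ xy)[[U V]/= [xU yV] [Uop Vop /eqP UV]].
  have [C [Ccl Cx CU]] := clb _ _ Uop (set_mem xU).
  exists C; split=> // /CU Uy; have : (U `&` V) y by split=> //; exact: set_mem.
  by rewrite UV.
have [E [NEE Ex EC]] := netN _ _ Cop Cx.
move: NEE; rewrite NE => -[n _ FE].
have ncEy : ~ closure E y.
  by move=> /(closureS EC); rewrite -(closure_id C).1.
have [Oy|nOy] := pselect (O n E y).
- exists n.*2, (O n E `\` closure E); split.
  + by exists E; rewrite ?doubleK ?odd_double.
  + exists y; apply/seteqP; split=> z /=; last by move=> ->; do !split => //; right.
    move=> [[Oz ncz] [zx|//]]; exfalso; apply: ncz.
    by rewrite zx; exact: subset_closure.
  + left; apply: sub_finite_set (@finite_set0 (set Z)) => W /=.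
    rewrite doubleK odd_double => -[[G FG ->] [Ox nGx]].
    have [EG|EG] := pselect (E = G); first by apply: nGx; rewrite -EG; exact: subset_closure.
    by have := Odisj _ _ _ FE FG EG; rewrite -subset0 => /(_ x); apply.
- exists n.*2.+1, (O n E); split.
  + by exists E; rewrite /= uphalf_double ?odd_double.
  + exists x; apply/seteqP; split=> z /=; last by move=> ->; do !split; [exact: OE|left].
    by move=> [Oz [//|zy]]; exfalso; apply: nOy; rewrite -zy.
  + left; apply: sub_finite_set (@finite_set1 _ (O n E)) => W /=.
    rewrite uphalf_double odd_double/= => -[[G FG ->] Ox].
    have [->//|EG] := pselect (E = G).
    by have := Odisj _ _ _ FE FG EG; rewrite -subset0 => /(_ x) H; exfalso; apply: H.
Qed.

End descriptive_Gruenhage.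

(** * The compact space of an adequate family *)

Section adequate_compact.
Variables (Gamma : choiceType) (A : set (set Gamma)).
Hypothesis hA : adequate A.

Definition supp (x : K A) : set Gamma := [set g | val x g].

Lemma supp_in (x : K A) : A (supp x).
Proof.
have [B AB Bx] := set_mem (valP x); suff -> : supp x = B by [].
by apply/seteqP; split=> g; rewrite /supp/= -Bx /chi inE.
Qed.

Lemma supp_chiK B (AB : A B) : supp (chiK AB) = B.
Proof. by apply/seteqP; split=> g; rewrite /supp/= /chi inE. Qed.

Lemma supp_inj : injective supp.
Proof.
move=> x y xy; apply/val_inj/funext => g.
have /seteqP[xley ylex] := xy.
by apply/idP/idP; [exact: xley|exact: ylex].
Qed.

Lemma chiK_supp (x : K A) (AB : A (supp x)) : chiK AB = x.
Proof. by apply: supp_inj; rewrite supp_chiK. Qed.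

(** The filter generated by the finite cylinders at [x] converges to [x] coordinatewise, hence in
    the product topology, so every open set around [x] contains one of them. *)
Lemma K_open_cylinder (x : K A) (U : set (K A)) : open U -> U x ->
  exists s : seq Gamma, forall y, (forall g, g \in s -> supp y g <-> supp x g) -> U y.
Proof.
move=> [V Vop VU] Ux.
pose F : set_system (prod_topology (fun _ : Gamma => bool)) :=
  filter_from setT (fun s : seq Gamma => [set f | forall g, g \in s -> f g = val x g]).
have FF : Filter F.
  apply: filter_from_filter; first by exists [::].
  move=> s t _ _; exists (s ++ t) => // u /= stu; split=> g gs; apply: stu;
    by rewrite mem_cat gs ?orbT.
have Fx : F --> val x.
  apply/cvg_sup => g W /= [W' [[B Bop BW'] W'x] W'W].
  exists [:: g] => // f /= /(_ g (mem_head _ _)) fg; apply: W'W.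
  by rewrite -BW'/= /proj fg; move: W'x; rewrite -BW'.
have Vx : V (val x) by move: Ux; rewrite -VU.
have [s _ sV] := Fx V (open_nbhs_nbhs (conj Vop Vx)).
exists s => y ys; rewrite -VU; apply: sV => g gs.
by apply/idP/idP => h; apply/ys.
Qed.

Lemma clopen_supp g : clopen [set x : K A | supp x g].
Proof.
have cont : continuous (fun x : K A => (val x : prod_topology (fun _ : Gamma => bool)) g).
  move=> x; have c1 : continuous (set_val : K A -> prod_topology (fun _ : Gamma => bool)).
    exact: initial_continuous.
  have c2 := @proj_continuous Gamma (fun=> bool) g.
  exact: (continuous_comp (c1 x) (c2 _)).
split.
  have -> : [set x : K A | supp x g] =
     (fun x : K A => (val x : prod_topology (fun _ : Gamma => bool)) g) @^-1` [set true].
    by apply/seteqP; split.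
  by move/continuousP: cont; apply; exact: discrete_open.
have -> : [set x : K A | supp x g] =
     (fun x : K A => (val x : prod_topology (fun _ : Gamma => bool)) g) @^-1` [set true].
  by apply/seteqP; split.
by move/continuous_closedP: cont; apply; exact: discrete_closed.
Qed.

Lemma clopen_all_supp (s : seq Gamma) (x : K A) :
  clopen [set y : K A | forall g, g \in s -> supp y g <-> supp x g].
Proof.
elim: s => [|a s [IHo IHc]].
  by rewrite [X in clopen X](_ : _ = setT); [split; [exact: openT|exact: closedT]|exact/seteqP].
have -> : [set y : K A | forall g, g \in a :: s -> supp y g <-> supp x g] =
  [set y | supp y a <-> supp x a] `&` [set y : K A | forall g, g \in s -> supp y g <-> supp x g].
  apply/seteqP; split=> y /=.
    by move=> h; split=> [|g gs]; apply: h; rewrite in_cons ?eqxx ?gs ?orbT.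
  by move=> [h1 h2] g; rewrite in_cons => /orP[/eqP->|/h2].
suff : clopen [set y | supp y a <-> supp x a].
  by move=> [? ?]; split; [exact: openI|exact: closedI].
have [ao ac] := clopen_supp a.
have [xa|nxa] := pselect (supp x a).
  by rewrite [X in clopen X](_ : _ = [set x : K A | supp x a])//; apply/seteqP; split=> y /=; tauto.
rewrite [X in clopen X](_ : _ = ~` [set x : K A | supp x a]).
  by split; [exact: closed_openC|exact: open_closedC].
by apply/seteqP; split=> y /=; tauto.
Qed.

Lemma K_clopen_base : clopen_base (K A).
Proof.
move=> x U Uop Ux; have [s sU] := K_open_cylinder Uop Ux.
by exists [set y : K A | forall g, g \in s -> supp y g <-> supp x g]; split => //; exact: clopen_all_supp.
Qed.

Lemma K_hausdorff : hausdorff_space (K A).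
Proof.
rewrite open_hausdorff => x y xy.
have [g xyg] : exists g, ~ (supp x g <-> supp y g).
  apply: contrapT => h; move/eqP: xy; apply; apply: supp_inj; apply/seteqP.
  by split=> g xg; have : supp x g <-> supp y g;
    [apply: contrapT => ?; apply: h; exists g|tauto|apply: contrapT => ?; apply: h; exists g|tauto].
have [go gc] := clopen_supp g.
have [xg|nxg] := pselect (supp x g).
  exists ([set x : K A | supp x g], ~` [set x : K A | supp x g]).
    by split; rewrite inE/=; tauto.
  by split => //=; [exact: closed_openC|rewrite setICr].
exists (~` [set x : K A | supp x g], [set x : K A | supp x g]).
  by split; rewrite inE/=; first tauto; apply: contrapT; tauto.
by split => //=; [exact: closed_openC|rewrite setICl].
Qed.

(** Condition (iii) of adequacy is what closes [K A] in the cube: a finite subset [H] of the limit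
    [p] is contained in some member of [A] whose indicator agrees with [p] on [H], so [H] belongs to
    [A]. *)
Lemma K_compact : compact [set: K A].
Proof.
move=> F FF _; pose G : set_system (prod_topology (fun _ : Gamma => bool)) := val @ F.
have cmp : compact [set: prod_topology (fun _ : Gamma => bool)].
  have := @tychonoff Gamma (fun=> bool) (fun=> setT) (fun=> bool_compact).
  by rewrite [X in compact X](_ : _ = setT)//; apply/seteqP; split.
have [p [_ pG]] := cmp G _ filterT.
have cyl (s : seq Gamma) : nbhs p [set f | forall g, g \in s -> f g = p g].
  elim: s => [|a s IHs]; first by apply: filterS filterT.
  have pa : nbhs p [set f : prod_topology (fun _ : Gamma => bool) | f a = p a].
    have pa : nbhs (proj a p) [set p a].
      by apply: open_nbhs_nbhs; split => //; exact: discrete_open.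
    exact: (@proj_continuous _ (fun _ : Gamma => bool) a p _ pa).
  apply: filterS (filterI pa IHs) => f [fa fs] g.
  by rewrite in_cons => /orP[/eqP->|/fs].
have Ap : A [set g | p g].
  case: (hA) => _ Asub; apply => H Hfin Hp.
  have [s Hs] := (finite_seqP _).1 Hfin.
  have GT : G [set f | f \in K A] by apply: (@filterE _ F) => x; exact: (valP x).
  have [f [/set_mem[B AB <-] fp]] := pG _ _ GT (cyl s).
  apply: Asub AB _ => g Hg; move: (fp g); rewrite /chi => fg; apply/set_mem.
  by rewrite fg; [exact: Hp|move: Hg; rewrite Hs].
have pK : p \in K A.
  by rewrite inE; exists [set g | p g] => //; apply/funext => g; rewrite /chi; apply/idP/idP; rewrite inE.
exists (exist _ p pK); split=> // U V FU; rewrite nbhsE => -[W [[T Top TW] Wp] WV].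
have GU : G (val @` U) by rewrite /G/=; apply: filterS FU => x Ux; exists x.
have Tp : nbhs p T by apply: open_nbhs_nbhs; split=> //; move: Wp; rewrite -TW.
have [_ [[x Ux <-] Tx]] := pG _ _ GU Tp.
by exists x; split => //; apply: WV; rewrite -TW.
Qed.

End adequate_compact.

(** * Descriptiveness from a strictly increasing function *)

Section increasing_descriptive.
Variables (R : realType) (Gamma : choiceType) (A : set (set Gamma)).
Hypothesis hA : adequate A.
Variable rho : K A -> R.
Hypothesis rho_inc : strictly_increasing rho.
Hypothesis rho_lsc : lower_semicontinuous (EFin \o rho).

(** On sets, points can be removed without building a new element of the subtype each time. Off [A]
    the value 0 is a default. *)
Let r (B : set Gamma) : R :=
  match pselect (A B) with left AB => rho (chiK AB) | right _ => 0 end.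

Let r_supp x : r (supp x) = rho x.
Proof.
rewrite /r; case: pselect => [AB|]; first by rewrite chiK_supp.
by move=> h; exfalso; apply: h; exact: supp_in.
Qed.

Let Asub B C : A B -> C `<=` B -> A C.
Proof. by case: hA => _ + _; apply. Qed.

Let r_lt B C : A C -> B `<` C -> r B < r C.
Proof.
move=> AC BC; rewrite /r; case: pselect => [AB|]; last first.
  by move=> h; exfalso; apply: h; apply: Asub AC _; exact: properW.
by case: pselect => // AC'; exact: rho_inc.
Qed.

Let r_le B C : A C -> B `<=` C -> r B <= r C.
Proof.
move=> AC BC; have [<-//|neq] := pselect (B = C).
by apply/ltW/r_lt => //; rewrite properEneq; split=> //; apply/eqP.
Qed.

(** A basic neighbourhood of [B] prescribes finitely many points inside and finitely many outside.
    Monotonicity disposes of the second kind: deleting from [C] the listed points outside [B] only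
    lowers [r]. *)
Let r_lsc B (q : R) : A B -> q < r B -> exists2 s : seq Gamma, [set` s] `<=` B &
  forall C, A C -> [set` s] `<=` C -> q < r C.
Proof.
move=> AB qB; move: (rho_lsc); rewrite lower_semicontinuousP => /(_ q) qop.
have [|s sP] := K_open_cylinder (x := chiK AB) qop.
  by rewrite /= lte_fin -r_supp supp_chiK.
exists [seq g <- s | `[< B g >]].
  by move=> g; rewrite /= mem_filter => /andP[/asboolP].
move=> C AC sC; pose C' := [set g | C g /\ (g \in s -> B g)].
have AC' : A C' by apply: Asub AC _ => g [].
apply: (@lt_le_trans _ _ (r C')); last by apply: r_le => // g [].
have /sP /= : forall g, g \in s -> supp (chiK AC') g <-> supp (chiK AB) g.
  move=> g gs; rewrite !supp_chiK; split; first by case=> _; apply.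
  by move=> Bg; split=> //; apply: sC; rewrite /= mem_filter gs andbT; apply/asboolP.
by rewrite lte_fin -r_supp supp_chiK.
Qed.

Let D (q : R) B := [set a | B a /\ r (B `\ a) <= q].

(* The sets [D q B] increase to [B] as [q] increases to [r B]. *)
Let D_usc B (q : R) : A B -> q < r B -> exists s : seq Gamma,
  [/\ [set` s] `<=` B, D q B `<=` [set` s] &
   forall C, A C -> [set` s] `<=` C -> q < r C /\ D q C `<=` D q B].
Proof.
move=> AB qB; have [s0 s0B s0P] := r_lsc AB qB.
(* If [a] in [C] were not listed in [s0], removing it would keep [s0] inside, and the value would
   stay above [q]. This is the finiteness of [D q C]. *)
have in_s0 C : A C -> [set` s0] `<=` C -> D q C `<=` [set` s0].
  move=> AC sC a [Ca rCa]; apply: contrapT => /= as0.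
  move: rCa; rewrite leNgt s0P//; first by apply: Asub AC _ => g [].
  by move=> g gs0; split; [exact: sC|move=> ga; apply: as0; rewrite -ga].
have ABa a : A (B `\ a) by apply: Asub AB _ => g [].
have /choice[t tP] : forall a, exists t : seq Gamma, q < r (B `\ a) ->
    [set` t] `<=` B `\ a /\ forall C, A C -> [set` t] `<=` C -> q < r C.
  move=> a; have [qa|] := boolP (q < r (B `\ a)); last by exists [::].
  by have [t t1 t2] := r_lsc (ABa a) qa; exists t.
(* Besides [s0], the list contains, for each [a] in [s0] with value above [q] after removal of [a],
   a finite set that keeps it above [q]. The filter by [B] guards against the unspecified [t a] of
   the other [a]. *)
exists (s0 ++ flatten [seq [seq g <- t a | `[< B g >]] | a <- s0]); split.
- move=> g /=; rewrite mem_cat => /orP[/s0B//|/flattenP[u /mapP[a _ ->]]].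
  by rewrite mem_filter => /andP[/asboolP].
- by move=> g /(in_s0 _ AB s0B) gs0; rewrite /= mem_cat gs0.
- move=> C AC sC.
  have s0C : [set` s0] `<=` C by move=> g /= gs; apply: sC; rewrite /= mem_cat gs.
  split=> [|a DCa]; first exact: s0P.
  have as0 := in_s0 _ AC s0C _ DCa; split; first exact: s0B.
  rewrite leNgt; apply/negP => qa; have [tB tP'] := tP _ qa.
  case: DCa => _; rewrite leNgt tP'//; first by apply: Asub AC _ => g [].
  move=> g gt; have [Bg ga] := tB _ gt; split=> //; apply: sC => /=.
  rewrite mem_cat; apply/orP; right; apply/flattenP.
  exists [seq g <- t a | `[< B g >]]; first by apply/mapP; exists a.
  by rewrite mem_filter; apply/andP; split=> //; apply/asboolP.
Qed.

Let piece (q p : R) (S : seq Gamma) : set (K A) :=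
  [set x | q < r (supp x) <= p /\ D q (supp x) = [set` S]].

Let pieces (k : nat) : set (set (K A)) :=
  match unpickle k : option (rat * rat * nat) with
  | None => set0
  | Some (q, p, n) => [set X | exists S : seq Gamma,
      [/\ uniq S, size S = n & X = piece (ratr q) (ratr p) S]]
  end.

(** Near [x] the sets [D q y] are contained in [D q x] by [D_usc]. In one family they all have the
    same cardinality, so they coincide with [D q x], and a piece met near [x] is the piece of
    [x]. *)
Let pieces_isolated k : isolated_family (pieces k).
Proof.
rewrite /pieces; case: unpickle => [[[q p] n]|]; last by move=> ? [].
move=> _ [S [Su Sn ->]]; rewrite -subset0 => x [[/andP[qx xp] DS] clx].
have [s [sx Ds sP]] := D_usc (supp_in x) qx.
pose W := [set y : K A | forall g, g \in s -> supp y g <-> supp x g].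
have xW : nbhs x W.
  by apply: open_nbhs_nbhs; split=> //; have [] := clopen_all_supp s x.
have [y [[_ [[S' [Su' Sn' ->]] /= SS'] [_ Dy]] Wy]] := clx _ xW.
have [g /= gs|_ DyDx] := sP _ (supp_in y); first by apply/Wy => //; exact: sx.
apply: SS'; have S'S : {subset S' <= S}.
  have : D (ratr q) (supp y) `<=` D (ratr q) (supp x) by [].
  by rewrite DS Dy => h g; exact: h.
have [|_ eqS] := uniq_min_size Su' S'S; first by rewrite Sn Sn'.
have -> // : [set` S'] = [set` S] -> piece (ratr q) (ratr p) S' = piece (ratr q) (ratr p) S.
  by rewrite /piece => ->.
by apply/seteqP; split=> g /=; rewrite eqS.
Qed.

Let ub_below (I : eqType) (s : seq I) (P : I -> Prop) (f : I -> R) (c : R) :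
  (forall i, i \in s -> P i -> f i < c) ->
  exists q : rat, ratr q < c /\ forall i, i \in s -> P i -> f i < ratr q.
Proof.
move=> fc; suff [d dc dP] : exists2 d, d < c & forall i, i \in s -> P i -> f i <= d.
  have [q] := rat_in_itvoo dc; rewrite in_itv/= => /andP[dq qc].
  by exists q; split=> // i si Pi; apply: le_lt_trans dq; exact: dP.
elim: s fc => [|a s IHs] fc; first by exists (c - 1) => //; rewrite gtrDl oppr_lt0.
have [|d dc dP] := IHs; first by move=> i si; apply: fc; rewrite in_cons si orbT.
have [Pa|nPa] := pselect (P a); last first.
  by exists d => // i; rewrite in_cons => /orP[/eqP-> //|]; exact: dP.
exists (Num.max d (f a)); first by rewrite gt_max dc fc// mem_head.
move=> i; rewrite in_cons => /orP[/eqP-> _|si Pi]; rewrite le_max ?lexx ?orbT//.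
by rewrite dP.
Qed.

(** Take [q] just below and [p] just above [r B]. The choice of [q] puts the points of [B] in a
    finite list [T] into [D q B], hence into every [y] of the piece. If such a [y] contained a point
    [g] of [s] outside [B], it would contain [t g], and its value would exceed [p]. *)
Let pieces_network : network (\bigcup_k pieces k).
Proof.
move=> x U Uop Ux; have [s sU] := K_open_cylinder Uop Ux.
pose B := supp x; have AB : A B := supp_in x.
(* [ub_below] yields upper bounds, hence the change of sign: [p] lies above [r B] and below the
   value of every member of [A] obtained by adding to [B] a point of [s]. *)
have [p' [p'B p'P]] : exists q : rat, ratr q < - r B /\
    forall g, g \in s -> ~ B g /\ A (g |` B) -> - r (g |` B) < ratr q.
  apply: ub_below => g _ [nBg AgB]; rewrite ltrN2; apply: r_lt => //.
  by split=> [|h]; [exact: subsetUr|exact: (nBg (h g (or_introl erefl)))].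
pose p := - p'.
have Bp : r B < ratr p by rewrite rmorphN/= ltrNr.
have /choice[t tP] : forall g, exists t : seq Gamma, g \in s -> ~ B g ->
    [set` t] `<=` g |` B /\ forall C, A C -> [set` t] `<=` C -> ratr p < r C.
  move=> g; have [[gs nBg]|h] := pselect (g \in s /\ ~ B g); last first.
    by exists [::] => gs nBg; exfalso; exact: h.
  have [AgB|nAgB] := pselect (A (g |` B)).
    have [|t t1 t2] := @r_lsc (g |` B) (ratr p) AgB; last by exists t.
    by rewrite rmorphN/= ltrNl; exact: p'P.
  (* If the enlarged set is not in [A], neither is some finite subset [H]. No member of [A] contains
     [H], so [H] can serve as [t g] vacuously. *)
  have [H [Hfin HgB nAH]] : exists H, [/\ finite_set H, H `<=` g |` B & ~ A H].
    apply: contrapT => h; apply: nAgB; case: hA => _ _; apply => H Hfin HgB.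
    by apply: contrapT => nAH; apply: h; exists H.
  have [t Ht] := (finite_seqP _).1 Hfin; exists t => _ _; rewrite -[[set` t]]Ht; split=> //.
  by move=> C hC HC; exfalso; apply: nAH; exact: Asub hC HC.
pose T := s ++ flatten [seq t g | g <- s].
have [q [qB qP]] : exists q : rat, ratr q < r B /\
    forall g, g \in T -> B g -> r (B `\ g) < ratr q.
  apply: ub_below => g _ Bg; apply: r_lt => //; split=> [g' []//|h].
  by have [_] := h _ Bg; apply.
have [S0 [_ DS0 _]] := D_usc AB qB.
have [S SD] : exists S : seq Gamma, D (ratr q) B = [set` S].
  by apply/finite_seqP; exact: sub_finite_set DS0 (finite_seq _).
exists (piece (ratr q) (ratr p) (undup S)).
have undupS : [set` undup S] = [set` S] :> set Gamma.
  by apply/seteqP; split=> g /=; rewrite mem_undup.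
split.
- exists (pickle (q, p, size (undup S))); first exact: I.
  rewrite /pieces pickleK.
  by exists (undup S); rewrite undup_uniq.
- by rewrite /piece/= undupS; split; [rewrite qB ltW|].
- move=> y [/andP[qy yp] Dy].
  have TC g : g \in T -> B g -> supp y g.
    move=> gT Bg; have : D (ratr q) (supp y) g.
      by rewrite Dy undupS -SD; split=> //; apply/ltW/qP.
    by case.
  apply: sU => g gs; split; last by apply: TC; rewrite mem_cat gs.
  move=> yg; apply: contrapT => nBg; have [tB tC] := tP _ gs nBg.
  move: yp; rewrite leNgt tC//; first exact: supp_in.
  move=> g' g't; have [->//|Bg'] := tB _ g't; apply: TC => //.
  rewrite mem_cat; apply/orP; right; apply/flattenP; exists (t g) => //.
  by apply/mapP; exists g.
Qed.

Lemma increasing_descriptive : descriptive_space (K A).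
Proof.
split; [exact/clopen_base_regular/K_clopen_base|exact: K_compact|].
exists (\bigcup_k pieces k); split; first exact: pieces_network.
by exists pieces; split; first exact: pieces_isolated.
Qed.

End increasing_descriptive.

(** * Averages over signs *)

Section sign_average.
Variables (R : realType) (Gamma : choiceType).
Implicit Types (f : (Gamma -> R) -> R) (s t : seq Gamma) (u v w : Gamma -> R).

Definition unit_fun (a : Gamma) : Gamma -> R := fun h => (h == a)%:R.
Local Notation e := unit_fun.

(** The expectation of [f] at [u] plus a random signed sum of the unit vectors of [s], written as a
    binary tree so that averages can be compared node by node. *)
Fixpoint sign_avg f s u : R :=
  if s is a :: s' then 2^-1 * (sign_avg f s' (u + e a) + sign_avg f s' (u - e a))
  else f u.

Fixpoint sign_leaf s u w : Prop :=
  if s is a :: s' then sign_leaf s' (u + e a) w \/ sign_leaf s' (u - e a) w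
  else w = u.

Lemma sign_avg_le f g s u :
  (forall w, sign_leaf s u w -> f w <= g w) -> sign_avg f s u <= sign_avg g s u.
Proof.
elim: s u => [|a s IHs] u fg /=; first exact: fg.
by rewrite ler_pM2l ?invr_gt0// lerD//; apply: IHs => w wl; apply: fg; [left|right].
Qed.

Lemma sign_avg_lt_leaf f g s u : sign_avg f s u < sign_avg g s u ->
  exists2 w, sign_leaf s u w & f w < g w.
Proof.
move=> fg; apply: contrapT => h; move: fg; rewrite ltNge => /negP; apply.
by apply: sign_avg_le => w wl; rewrite leNgt; apply/negP => ?; apply: h; exists w.
Qed.

Lemma sign_avgBc f c s u : sign_avg (fun w => f w - c) s u = sign_avg f s u - c.
Proof. by elim: s u => [//|a s IHs] u /=; rewrite !IHs; lra. Qed.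

Lemma sign_avg_cst c s u : sign_avg (fun=> c) s u = c.
Proof. by elim: s u => [//|a s IHs] u /=; rewrite !IHs; lra. Qed.

Lemma sign_avg_swap f a b s u : sign_avg f (a :: b :: s) u = sign_avg f (b :: a :: s) u.
Proof.
rewrite /= [u + e b + e a]addrAC [u + e b - e a]addrAC.
by rewrite [u - e b + e a]addrAC [u - e b - e a]addrAC; lra.
Qed.

Lemma sign_avg_rem f a s u : a \in s -> sign_avg f s u = sign_avg f (a :: rem a s) u.
Proof.
elim: s u => [//|b s IHs] u; rewrite in_cons.
have [->|ab] := eqVneq b a; first by rewrite /= eqxx.
rewrite /= => as_; rewrite ?(negbTE ab).
by rewrite -[RHS]/(sign_avg f [:: a, b & rem a s] u) sign_avg_swap /= !IHs.
Qed.

Lemma sign_leaf_notin s u w g : sign_leaf s u w -> g \notin s -> w g = u g.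
Proof.
elim: s u => [u -> //|a s IHs] u /=; rewrite in_cons negb_or => + /andP[ga gs].
have ea : e a g = 0 by rewrite /e (negbTE ga).
move=> [/IHs->|/IHs->] //.
  by rewrite -[LHS]/(u g + e a g) ea addr0.
by rewrite -[LHS]/(u g - e a g) ea subr0.
Qed.

End sign_average.

(** * The supremum of the sign averages is strictly increasing *)

Section average_increasing.
Variables (R : realType) (Gamma : choiceType) (A : set (set Gamma)).
Hypothesis hA : adequate A.
Implicit Types (s t : seq Gamma) (u v w : Gamma -> R) (B : set Gamma).
Local Notation e := (@unit_fun R Gamma).

Definition sign_vec u := (forall g, u g = 0 \/ `|u g| = 1) /\ A [set g | u g != 0].

Definition lin_form s (c : Gamma -> R) u : R := \sum_(g <- s) c g * u g.

(** An abstract form of the squared dual norm, scaled into the unit interval. [Phi_sup] makes it a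
    supremum of squares of forms in finitely many coordinates, the lower semicontinuity used for
    passing to a limit. *)
Variable Phi : (Gamma -> R) -> R.
Hypothesis Phi01 : forall u, sign_vec u -> 0 <= Phi u <= 1.
Hypothesis Phi_strict : forall u a, u a = 0 -> sign_vec u ->
  sign_vec (u + e a) -> sign_vec (u - e a) ->
  Phi u < 2^-1 * (Phi (u + e a) + Phi (u - e a)).
Hypothesis Phi_sup : forall u r, sign_vec u -> r < Phi u ->
  exists s c, r < (lin_form s c u) ^+ 2 /\
    forall v, sign_vec v -> (lin_form s c v) ^+ 2 <= Phi v.

Let Asub B C : A B -> C `<=` B -> A C.
Proof. by case: hA => _ + _; apply. Qed.

(** [B] holds the coordinates whose sign is still open, [u] the signs already chosen. Their union
    stays in [A], so any further choice of signs on [B] is a [sign_vec]. *)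
Let good B u := [/\ forall g, B g -> u g = 0, forall g, u g = 0 \/ `|u g| = 1 &
  A ([set g | u g != 0] `|` B)].

Let good_sign B u : good B u -> sign_vec u.
Proof. by case=> _ ? AB; split=> //; apply: Asub AB _ => g; left. Qed.

Let good_sub B C u : C `<=` B -> good B u -> good C u.
Proof.
move=> CB [u0 u1 AB]; split=> //; first by move=> g /CB; exact: u0.
by apply: Asub AB _ => g [ug|/CB Bg]; [left|right].
Qed.

Let good_step B u a (b : bool) : good B u -> B a ->
  good (B `\ a) (u + (-1) ^+ b *: e a).
Proof.
move=> [u0 u1 AB] Ba.
have ev g : (u + (-1) ^+ b *: e a) g = u g + (-1) ^+ b * (g == a)%:R by [].
split.
- by move=> g [Bg /eqP/negbTE ga]; rewrite ev ga mulr0 addr0 u0.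
- move=> g; rewrite ev; have [->|ga] := eqVneq g a; last by rewrite mulr0 addr0.
  by right; rewrite u0// add0r mulr1 normrX normrN normr1 expr1n.
- apply: Asub AB _ => g [|[]]; last by right.
  rewrite /= ev; have [->|ga] := eqVneq g a; first by right.
  by rewrite mulr0 addr0 => ug; left.
Qed.

Let good_stepD B u a : good B u -> B a -> good (B `\ a) (u + e a).
Proof. by move=> gu Ba; have := good_step false gu Ba; rewrite expr0 scale1r. Qed.

Let good_stepB B u a : good B u -> B a -> good (B `\ a) (u - e a).
Proof. by move=> gu Ba; have := good_step true gu Ba; rewrite expr1 scaleN1r. Qed.

Let setD_cons B a s : (B `\ a) `\` [set` s] = B `\` [set` a :: s].
Proof.
apply/seteqP; split=> g /=.
  by move=> [[Bg ga] gs]; split=> //; rewrite in_cons => /orP[/eqP|].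
move=> [Bg]; rewrite in_cons => /negP; rewrite negb_or => /andP[/eqP ga /negP gs].
by split.
Qed.

Let inB_tail B a s : uniq (a :: s) -> [set` a :: s] `<=` B ->
  [/\ B a, uniq s & [set` s] `<=` B `\ a].
Proof.
move=> /= /andP[as_ us] sB; split=> //; first by apply: sB; rewrite /= mem_head.
move=> g /= gs; split; first by apply: sB; rewrite /= in_cons gs orbT.
by move=> ga; move: as_; rewrite -ga gs.
Qed.

Let good_leaf B u s w : good B u -> uniq s -> [set` s] `<=` B -> sign_leaf s u w ->
  good (B `\` [set` s]) w.
Proof.
elim: s B u => [|a s IHs] B u gu us sB /=.
  by move=> ->; apply: good_sub gu => g [].
have [Ba us' sB'] := inB_tail us sB.
rewrite -setD_cons => -[]; apply: IHs => //; [exact: good_stepD|exact: good_stepB].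
Qed.

Let avg01 B u s : good B u -> uniq s -> [set` s] `<=` B ->
  0 <= sign_avg Phi s u <= 1.
Proof.
move=> gu us sB; apply/andP; split.
  rewrite -(sign_avg_cst 0 s u); apply: sign_avg_le => w /(good_leaf gu us sB) gw.
  by have /andP[] := Phi01 (good_sign gw).
rewrite -(sign_avg_cst 1 s u); apply: sign_avg_le => w /(good_leaf gu us sB) gw.
by have /andP[] := Phi01 (good_sign gw).
Qed.

(** The new coordinate [a] is swapped down to the leaves of the tree, where [Phi_strict] applies. *)
Let avg_cons_ge B u a s : good B u -> uniq (a :: s) -> [set` a :: s] `<=` B ->
  sign_avg Phi s u <= sign_avg Phi (a :: s) u.
Proof.
elim: s B u => [|b s IHs] B u gu us sB.
  have Ba : B a by apply: sB; rewrite /= mem_head.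
  apply/ltW/Phi_strict; first by case: gu => + _ _; apply.
  - exact: good_sign gu.
  - exact: good_sign (good_stepD gu Ba).
  - exact: good_sign (good_stepB gu Ba).
rewrite sign_avg_swap.
have us' : uniq (b :: a :: s).
  move: us => /=; rewrite !in_cons !negb_or -!andbA => /and4P[ab as_ bs ->].
  by rewrite eq_sym ab as_ bs.
have sB' : [set` b :: a :: s] `<=` B.
  by move=> g; rewrite /= !in_cons orbCA => h; apply: sB; rewrite /= !in_cons.
have [Bb us'' sB''] := inB_tail us' sB'.
rewrite [leLHS]/= [leRHS]/= ler_pM2l ?invr_gt0// lerD//.
  exact: (IHs _ _ (good_stepD gu Bb)).
exact: (IHs _ _ (good_stepB gu Bb)).
Qed.

Let avg_sub B u t s : good B u -> uniq t -> uniq s -> [set` s] `<=` B ->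
  {subset t <= s} -> sign_avg Phi t u <= sign_avg Phi s u.
Proof.
elim: t B u s => [|a t IHt] B u s gu ut us sB ts.
  elim: s us sB {ts} => [//|b s IHs] us sB.
  apply: le_trans (avg_cons_ge gu us sB); have [_ us' sB'] := inB_tail us sB.
  by apply: IHs => // g /sB'[].
have as_ : a \in s by apply: ts; rewrite mem_head.
rewrite (sign_avg_rem _ _ as_) /=.
have usr : uniq (a :: rem a s) by rewrite /= mem_rem_uniqF// rem_uniq.
have sBr : [set` a :: rem a s] `<=` B.
  by move=> g; rewrite /= in_cons => /orP[/eqP->|/mem_rem]; exact: sB.
have [Ba us' sB'] := inB_tail usr sBr.
have /= /andP[at_ ut'] := ut.
have tsr : {subset t <= rem a s}.
  move=> g gt; rewrite mem_rem_uniq// inE ts ?in_cons ?gt ?orbT// andbT.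
  by apply: contraNneq at_ => <-.
rewrite ler_pM2l ?invr_gt0// lerD//.
  exact: (IHt _ _ _ (good_stepD gu Ba)).
exact: (IHt _ _ _ (good_stepB gu Ba)).
Qed.

Let avgs B u := [set sign_avg Phi s u | s in [set s | uniq s /\ [set` s] `<=` B]].

Let G B u := sup (avgs B u).

Let avgs0 B u : avgs B u !=set0.
Proof. by exists (Phi u), [::]; split. Qed.

Let avgs_sup B u : good B u -> has_sup (avgs B u).
Proof.
move=> gu; split; first exact: avgs0.
by exists 1 => _ [s [us sB] <-]; have /andP[] := avg01 gu us sB.
Qed.

Let G_ub B u s : good B u -> uniq s -> [set` s] `<=` B -> sign_avg Phi s u <= G B u.
Proof. by move=> gu us sB; apply: (sup_upper_bound (avgs_sup gu)); exists s. Qed.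

Let G_le B u c : (forall s, uniq s -> [set` s] `<=` B -> sign_avg Phi s u <= c) ->
  G B u <= c.
Proof. by move=> h; apply: ge_sup; [exact: avgs0|move=> _ [s [us sB] <-]; exact: h]. Qed.

Let G_lt B u c : good B u -> c < G B u ->
  exists s, [/\ uniq s, [set` s] `<=` B & c < sign_avg Phi s u].
Proof.
move=> gu cG; have [|_ [s [us sB] <-]] := sup_adherent (eps := G B u - c) _ (avgs_sup gu).
  by rewrite subr_gt0.
by rewrite subKr => h; exists s.
Qed.

Let G_mono B C u : good C u -> B `<=` C -> G B u <= G C u.
Proof. by move=> gu BC; apply: G_le => s us sB; apply: G_ub => // g /sB/BC. Qed.

(** Averages grow with the list, so the suprema at both children are approached along one common
    list, and the supremum of the means is the mean of the suprema. Thus [G] is a martingale along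
    the tree of signs. *)
Let G_split B u b : good B u -> B b ->
  G B u = 2^-1 * (G (B `\ b) (u + e b) + G (B `\ b) (u - e b)).
Proof.
move=> gu Bb; have gD := good_stepD gu Bb; have gB := good_stepB gu Bb.
apply/eqP; rewrite eq_le; apply/andP; split.
  apply: G_le => s us sB.
  have usr : uniq (b :: rem b s) by rewrite /= mem_rem_uniqF// rem_uniq.
  have sBr : [set` b :: rem b s] `<=` B.
    by move=> g; rewrite /= in_cons => /orP[/eqP->//|/mem_rem]; exact: sB.
  have [_ us' sB'] := inB_tail usr sBr.
  apply: (@le_trans _ _ (sign_avg Phi (b :: rem b s) u)).
    apply: (avg_sub gu) => // g gs; rewrite in_cons.
    by have [//|gb] := eqVneq g b; rewrite mem_rem_uniq// inE gb.
  by rewrite /= ler_pM2l ?invr_gt0// lerD//; exact: G_ub.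
rewrite leNgt; apply/negP => lt.
pose d := 2^-1 * (G (B `\ b) (u + e b) + G (B `\ b) (u - e b)) - G B u.
have d0 : 0 < d by rewrite subr_gt0.
have [|s1 [us1 sB1 h1]] := G_lt (c := G (B `\ b) (u + e b) - d) gD.
  by rewrite ltrBlDr ltrDl.
have [|s2 [us2 sB2 h2]] := G_lt (c := G (B `\ b) (u - e b) - d) gB.
  by rewrite ltrBlDr ltrDl.
pose s := undup (s1 ++ s2); have us : uniq s by rewrite undup_uniq.
have sB : [set` s] `<=` B `\ b.
  by move=> g; rewrite /= mem_undup mem_cat => /orP[/sB1|/sB2].
have usb : uniq (b :: s).
  by rewrite /= us andbT; apply/negP => /sB [_]; apply.
have sBb : [set` b :: s] `<=` B.
  by move=> g; rewrite /= in_cons => /orP[/eqP->//|/sB[]].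
have := G_ub gu usb sBb; rewrite leNgt => /negP; apply => /=.
have : sign_avg Phi s1 (u + e b) <= sign_avg Phi s (u + e b).
  by apply: (avg_sub gD) => // g g1; rewrite mem_undup mem_cat g1.
have : sign_avg Phi s2 (u - e b) <= sign_avg Phi s (u - e b).
  by apply: (avg_sub gB) => // g g1; rewrite mem_undup mem_cat g1 orbT.
move: h1 h2; rewrite /d; lra.
Qed.

Let G_leaves B u s : good B u -> uniq s -> [set` s] `<=` B ->
  G B u = sign_avg (G (B `\` [set` s])) s u.
Proof.
elim: s B u => [|a s IHs] B u gu us sB.
  by rewrite /= [X in B `\` X](_ : _ = set0) ?setD0//; apply/seteqP; split.
have [Ba us' sB'] := inB_tail us sB.
rewrite (G_split gu Ba) /= -setD_cons -IHs//; last exact: good_stepD.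
by rewrite -IHs//; exact: good_stepB.
Qed.

Section strictness.
Variable a : Gamma.

(* Equality of the two averages at the root of the tree of signs propagates to
   all its nodes. *)
Let flat B u := [/\ ~ B a, good (a |` B) u & G (a |` B) u <= G B u].

(** Adding [a] cannot lower [G] at either child, while the means over the two children are in the
    opposite order; so equality holds at both. *)
Let flat_step B u b : flat B u -> B b ->
  flat (B `\ b) (u + e b) /\ flat (B `\ b) (u - e b).
Proof.
move=> [nBa gu Gle] Bb.
have ab : a <> b by move=> ab; rewrite ab in nBa.
have gB : good B u by apply: good_sub gu => g; right.
have aBb : (a |` B) b by right.
have aBE : (a |` B) `\ b = a |` (B `\ b).
  apply/seteqP; split=> g /=; first by move=> [[->|] ?]; [left|right].
  by move=> [->|[]]; split => //; [left|right].
have gD := good_stepD gu aBb; have gN := good_stepB gu aBb.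
rewrite aBE in gD gN.
have := G_split gu aBb; rewrite aBE => GaE.
have GE := G_split gB Bb.
have BaB : B `\ b `<=` a |` (B `\ b) by move=> g; right.
have m1 := G_mono gD BaB; have m2 := G_mono gN BaB.
move: Gle; rewrite GaE GE => Gle.
by split; split; [move=> []//|by []|lra|move=> []//|by []|lra].
Qed.

Let flat_leaf B u s w : flat B u -> uniq s -> [set` s] `<=` B -> sign_leaf s u w ->
  flat (B `\` [set` s]) w.
Proof.
elim: s B u => [|b s IHs] B u fu us sB /=.
  by move=> ->; rewrite [X in B `\` X](_ : _ = set0) ?setD0//; apply/seteqP; split.
have [Bb us' sB'] := inB_tail us sB; have [f1 f2] := flat_step fu Bb.
by rewrite -setD_cons => -[]; apply: IHs.
Qed.

Let flat_good B u : flat B u -> good B u.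
Proof. by case=> _ gu _; apply: good_sub gu => g; right. Qed.

(** Jensen for the square: the two signs of [b] average to the square at [u] plus the square at
    [e b]. *)
Let lin_form_avg s c t u : (lin_form s c u) ^+ 2 <=
  sign_avg (fun w => (lin_form s c w) ^+ 2) t u.
Proof.
elim: t u => [//|b t IHt] u /=.
have lD v w : lin_form s c (v + w) = lin_form s c v + lin_form s c w.
  by rewrite /lin_form -big_split/=; apply: eq_bigr => g _; rewrite -mulrDr.
have lN v : lin_form s c (- v) = - lin_form s c v.
  by rewrite /lin_form -sumrN; apply: eq_bigr => g _; rewrite -mulrN.
have := IHt (u + e b); have := IHt (u - e b); rewrite !lD lN.
have := sqr_ge0 (lin_form s c (e b)); rewrite !expr2; lra.
Qed.

(** Two descents. At some leaf [w] below an almost optimal average, [Phi] nearly reaches [G], and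
    some form nearly attains [Phi w]. The second descent decides the coordinates of this form that
    are still open; its square does not drop on average, so a suitable leaf exists, and from there
    on the form has a fixed value. *)
Let next_node B u (eta : R) : flat B u -> 0 < eta -> exists B' u', [/\ flat B' u',
  B' `<=` B, forall g, ~ B g -> u' g = u g & exists s c,
  [/\ forall v, sign_vec v -> (lin_form s c v) ^+ 2 <= Phi v,
      forall g, g \in s -> ~ B' g & G B' u' < (lin_form s c u') ^+ 2 + eta]].
Proof.
move=> fu eta0; have gu := flat_good fu; have eta20 : 0 < eta / 2 by rewrite divr_gt0.
have [|s1 [us1 sB1 h1]] := G_lt (c := G B u - eta / 2) gu; first by rewrite ltrBlDr ltrDl.
move: h1; rewrite {1}(G_leaves gu us1 sB1) -sign_avgBc => /sign_avg_lt_leaf[w lw Gw].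
have fw := flat_leaf fu us1 sB1 lw; have gw := flat_good fw.
have [s [c [lPhi Phil]]] := Phi_sup (good_sign gw) Gw.
pose B1 := B `\` [set` s1].
pose s2 := undup [seq g <- s | `[< B1 g >]].
have us2 : uniq s2 by rewrite undup_uniq.
have sB2 : [set` s2] `<=` B1.
  by move=> g; rewrite /= mem_undup mem_filter => /andP[/asboolP].
have : sign_avg (fun v => G (B1 `\` [set` s2]) v - eta) s2 w <
       sign_avg (fun v => (lin_form s c v) ^+ 2) s2 w.
  rewrite sign_avgBc -(G_leaves gw us2 sB2).
  by have := lin_form_avg s c s2 w; move: lPhi; rewrite -/B1; lra.
move=> /sign_avg_lt_leaf[v lv Gv].
exists (B1 `\` [set` s2]), v; split.
- exact: flat_leaf fw us2 sB2 lv.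
- by move=> g [[]].
- move=> g nBg; rewrite (sign_leaf_notin lv).
    by rewrite (sign_leaf_notin lw)//; apply/negP => /sB1.
  by apply/negP => /sB2[].
- exists s, c; split=> //.
    move=> g gs [Bg]; apply; rewrite /= mem_undup mem_filter gs andbT.
    exact/asboolP.
  by rewrite -ltrBlDr.
Qed.

Lemma no_flat B u : ~ flat B u.
Proof.
move=> f0; pose node := {p : set Gamma * (Gamma -> R) | flat p.1 p.2}.
have /choice[next nextP] : forall x : nat * node, exists y : node,
  [/\ (sval y).1 `<=` (sval x.2).1,
    forall g, ~ (sval x.2).1 g -> (sval y).2 g = (sval x.2).2 g & exists s c,
  [/\ forall v, sign_vec v -> (lin_form s c v) ^+ 2 <= Phi v,
      forall g, g \in s -> ~ (sval y).1 g &
      G (sval y).1 (sval y).2 < (lin_form s c (sval y).2) ^+ 2 + x.1.+1%:R^-1]].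
  move=> [k [[C v] fv]]; have [|C' [v' [fv' ? ? ?]]] := @next_node C v k.+1%:R^-1 fv.
    by rewrite invr_gt0 ltr0n.
  by exists (exist _ (C', v') fv').
pose node_ k : node := nat_rect (fun=> node) (exist _ (B, u) f0) (fun k x => next (k, x)) k.
pose B_ k := (sval (node_ k)).1; pose u_ k := (sval (node_ k)).2.
have fl k : flat (B_ k) (u_ k) by exact: svalP (node_ k).
have nx k : [/\ B_ k.+1 `<=` B_ k, forall g, ~ B_ k g -> u_ k.+1 g = u_ k g & exists s c,
  [/\ forall v, sign_vec v -> (lin_form s c v) ^+ 2 <= Phi v,
      forall g, g \in s -> ~ B_ k.+1 g &
      G (B_ k.+1) (u_ k.+1) < (lin_form s c (u_ k.+1)) ^+ 2 + k.+1%:R^-1]].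
  exact: nextP (k, node_ k).
have Bdec j k : (j <= k)%N -> B_ k `<=` B_ j.
  elim: k => [|k IHk]; first by rewrite leqn0 => /eqP->.
  rewrite leq_eqVlt => /orP[/eqP->//|/IHk h].
  by have [kB _ _] := nx k; exact: subset_trans kB h.
have uconst j k g : (j <= k)%N -> ~ B_ j g -> u_ k g = u_ j g.
  elim: k => [|k IHk]; first by rewrite leqn0 => /eqP->.
  rewrite leq_eqVlt => /orP[/eqP->//|jk] nB.
  by rewrite -(IHk jk nB); have [_ + _] := nx k; apply=> /(Bdec j k jk).
have supp_dec k g : (u_ k g != 0) || `[< B_ k g >] -> u_ 0 g <> 0 \/ B_ 0 g.
  have [B0g|nB0g] := pselect (B_ 0 g); first by right.
  rewrite (uconst 0 k)// => /orP[/eqP|/asboolP Bk]; first by left.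
  by right; apply: (Bdec 0 k).
(* A coordinate that stays open at all nodes has the value 0 at each of them, so its limit is 0. *)
have /choice[lim limP] : forall g, exists x, exists k0, forall k, (k0 <= k)%N -> u_ k g = x.
  move=> g; have [[k nB]|h] := pselect (exists k, ~ B_ k g).
    by exists (u_ k g), k => j kj; exact: uconst.
  exists 0, 0%N => k _; have [u0 _ _] := flat_good (fl k).
  by apply: u0; apply: contrapT => ?; apply: h; exists k.
have lim_eq k g : ~ B_ k g -> lim g = u_ k g.
  move=> nB; have [k0 k0P] := limP g.
  by rewrite -(k0P (maxn k k0)) ?leq_maxr// (uconst k)// leq_maxl.
have lim_seq s : exists k0, forall k, (k0 <= k)%N -> forall g, g \in s -> u_ k g = lim g.
  elim: s => [|g s [k0 k0P]]; first by exists 0%N.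
  have [k1 k1P] := limP g; exists (maxn k0 k1) => k; rewrite geq_max => /andP[h0 h1] g'.
  by rewrite in_cons => /orP[/eqP->|gs]; [exact: k1P|exact: k0P].
have [nB0a [u0 u1 A0] _] := fl 0.
have nBa k : ~ B_ k a by case: (fl k).
have lima : lim a = 0 by rewrite (lim_eq 0)//; apply: u0; left.
have good_lim : good [set a] lim.
  split=> [_ ->//|g|].
    have [k kP] := limP g; rewrite -(kP k)//.
    by have [_ + _] := flat_good (fl k); apply.
  apply: Asub A0 _ => g [/= lg|->]; last by right; left.
  have [k kP] := limP g; have [|ug|Bg] := supp_dec k g.
  - by rewrite (kP k) ?lg.
  - by left; apply/eqP.
  - by right; right.
have aa : [set a] a by [].
have sD := good_sign (good_stepD good_lim aa).
have sN := good_sign (good_stepB good_lim aa).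
have lt := Phi_strict lima (good_sign good_lim) sD sN.
(* Half of the gap in [Phi_strict]: one half pays for the forms at the two neighbours of [lim], the
   other for the error [1/(k+1)]. *)
pose d := (2^-1 * (Phi (lim + e a) + Phi (lim - e a)) - Phi lim) / 2.
have d0 : 0 < d by rewrite divr_gt0// subr_gt0.
have [|s1 [c1 [r1 l1]]] := Phi_sup (r := Phi (lim + e a) - d) sD; first by rewrite ltrBlDr ltrDl.
have [|s2 [c2 [r2 l2]]] := Phi_sup (r := Phi (lim - e a) - d) sN; first by rewrite ltrBlDr ltrDl.
have [k1 k1P] := lim_seq s1; have [k2 k2P] := lim_seq s2.
have [n nd] : exists n : nat, n.+1%:R^-1 < d.
  have [n _ nP] := near_infty_natSinv_lt (PosNum d0).
  by exists n; exact: nP (leqnn n).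
pose k := maxn n (maxn k1 k2).
have nk : (k.+1%:R^-1 : R) < d.
  apply: le_lt_trans nd; rewrite lef_pV2 ?posrE ?ltr0n// ler_nat ltnS.
  exact: leq_maxl.
have ku1 : (k1 <= k.+1)%N by apply: leqW; rewrite /k !leq_max leqnn orbT.
have ku2 : (k2 <= k.+1)%N by apply: leqW; rewrite /k !leq_max leqnn !orbT.
have [_ _ [s [c [lPhi sB Gl]]]] := nx k.
have ll : lin_form s c (u_ k.+1) = lin_form s c lim.
  by apply: eq_big_seq => g /sB/lim_eq ->.
have [_ gk Gk] := fl k.+1.
have aBa : (a |` B_ k.+1) a by left.
have ga : [set` [:: a]] `<=` a |` B_ k.+1.
  by move=> g; rewrite /= inE => /eqP ->; left.
have /= := G_ub gk (isT : uniq [:: a]) ga.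
have gD := good_sign (good_stepD gk aBa); have gN := good_sign (good_stepB gk aBa).
have := l1 _ gD; rewrite (_ : lin_form s1 c1 _ = lin_form s1 c1 (lim + e a)); last first.
  by apply: eq_big_seq => g gs; congr (_ * (_ + _)); exact: k1P.
have := l2 _ gN; rewrite (_ : lin_form s2 c2 _ = lin_form s2 c2 (lim - e a)); last first.
  by apply: eq_big_seq => g gs; congr (_ * (_ + _)); exact: k2P.
have := lPhi _ (good_sign good_lim); rewrite -ll; move: nk r1 r2 Gl Gk; rewrite /d.
move: (k.+1%:R^-1) (Phi (lim + e a)) (Phi (lim - e a)) (Phi lim).
move: (_ ^+ 2) (_ ^+ 2) (_ ^+ 2) (Phi (u_ k.+1 + e a)) (Phi (u_ k.+1 - e a)).
by move: (G _ _) (G _ _) => *; lra.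
Qed.

End strictness.

(** No gain from a new point would make the root 0 of the tree a flat node. Lower semicontinuity
    holds because each average involves finitely many coordinates. *)
Lemma sign_average_increasing : exists rho : K A -> R,
  [/\ forall x, 0 <= rho x <= 1, strictly_increasing rho &
      lower_semicontinuous (EFin \o rho)].
Proof.
have good0 B : A B -> good B 0.
  move=> AB; split=> // [g|]; first by left.
  by rewrite [X in X `|` _](_ : _ = set0) ?set0U//; apply/seteqP; split=> g //=; rewrite eqxx.
exists (fun x => G (supp x) 0); split.
- move=> x; have gx := good0 _ (supp_in x); apply/andP; split.
    have s0 : [set` ([::] : seq Gamma)] `<=` supp x by [].
    by have := @G_ub _ _ [::] gx isT s0; apply: le_trans; have /andP[] := Phi01 (good_sign gx).
  by apply: G_le => s us sB; have /andP[] := avg01 gx us sB.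
- move=> B C AB AC [BC nCB]; rewrite !supp_chiK.
  have [a [Ca nBa]] : exists a, C a /\ ~ B a.
    apply: contrapT => h; apply: nCB => a Ca; apply: contrapT => nBa.
    by apply: h; exists a.
  have aBC : a |` B `<=` C by move=> g [->|/BC].
  apply: lt_le_trans (G_mono (good0 _ AC) aBC).
  rewrite ltNge; apply/negP => Gle; apply: (@no_flat a B 0); split=> //.
  by apply: good0; exact: Asub AC _.
- move=> x q /=; rewrite lte_fin => /(G_lt (good0 _ (supp_in x)))[s [us sx qs]].
  exists [set y : K A | forall g, g \in s -> supp y g <-> supp x g].
    by apply: open_nbhs_nbhs; split=> //; have [] := clopen_all_supp s x.
  move=> y ys; rewrite lte_fin; apply: lt_le_trans qs _; apply: G_ub => //.
    exact: good0 (supp_in y).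
  by move=> g gs; apply/(ys _ gs); exact: sx.
Qed.

End average_increasing.

(** * Functionals on the sequence space *)

Lemma ultra_fmap (T S : Type) (f : T -> S) (F : set_system T) :
  UltraFilter F -> UltraFilter (f @ F).
Proof.
move=> FU; split; first exact: fmap_proper_filter.
move=> G PG FG; apply/seteqP; split=> // B GB.
have [//|FnB] := in_ultra_setVsetC (f @^-1` B) FU.
have GnB : G (~` B) by exact: FG.
by have [x [? []]] := filter_ex (filterI GB GnB).
Qed.

Section evaluation.
Variables (R : realType) (Gamma : choiceType) (A : set (set Gamma)).
Hypothesis hA : adequate A.
Local Notation X := (h_space R hA).
Implicit Types (x y : X) (u v : Gamma -> R) (s t : seq Gamma) (g : Gamma).

Let Asub B C : A B -> C `<=` B -> A C.
Proof. by case: hA => _ + _; apply. Qed.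

Definition entry x g : R := val (val x) g.

Lemma entryD x y g : entry (x + y) g = entry x g + entry y g.
Proof. by []. Qed.

Lemma entryZ (a : R) x g : entry (a *: x) g = a * entry x g.
Proof. by []. Qed.

Lemma sum_entry_le x s : uniq s -> A [set` s] -> \sum_(g <- s) `|entry x g| <= `|x|.
Proof.
move=> us As; have A0 : A !=set0 by exists [set` s].
rewrite -lee_fin -[X in (_ <= X%:E)%E]/(ell_norm (val x)) -sumnorm_ell// -sumEFin.
apply: le_trans (ereal_sup_ubound _); last by exists [set` s].
rewrite esum_fset//.
by rewrite le_eqVlt; apply/orP; left; apply/eqP; exact: fsbig_seq.
Qed.

Lemma sum_entry_gt x (r : R) : A !=set0 -> r < `|x| -> exists s,
  [/\ uniq s, A [set` s] & r < \sum_(g <- s) `|entry x g|].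
Proof.
move=> A0; rewrite -lte_fin -[X in (_ < X%:E)%E]/(ell_norm (val x)) -sumnorm_ell//.
move=> /ereal_sup_gt[_ [B AB <-]] /ereal_sup_gt[_ [F [Ffin FB] <-]].
have [s Fs] := (finite_seqP _).1 Ffin.
have sE : [set` undup s] = F.
  by rewrite Fs; apply/seteqP; split=> g /=; rewrite mem_undup.
have -> : (\sum_(i \in F) `|val (val x) i|%:E)%E = (\sum_(g <- undup s) `|entry x g|)%:E.
  by rewrite -sumEFin -sE; apply/esym; apply: fsbig_seq; exact: undup_uniq.
rewrite lte_fin => rs.
exists (undup s); split => //; first exact: undup_uniq.
by rewrite sE; exact: Asub FB.
Qed.

Lemma unit_in_h g : @unit_vector R Gamma A hA g \in @h_pred R Gamma A hA.
Proof.
rewrite inE; apply: subset_closure.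
by exists 1%N, (fun=> 1), (fun=> @unit_vector R Gamma A hA g); split; [exists g|rewrite big_ord1 scale1r].
Qed.

Definition unit_h g : X := exist _ (@unit_vector R Gamma A hA g) (unit_in_h g).

Lemma entry_unit_h g h : entry (unit_h g) h = (h == g)%:R.
Proof. by []. Qed.

Definition fin_supp x s := forall g, g \notin s -> entry x g = 0.

Lemma fin_supp_dense x (d : R) : 0 < d -> exists y s, fin_supp y s /\ `|x - y| < d.
Proof.
move=> d0; have := valP x; rewrite inE => /closure_normP/(_ _ d0)[y ySp xy].
have yh : y \in @h_pred R Gamma A hA by rewrite inE; exact: subset_closure.
have [n [c [s [sS yE]]]] := ySp.
have /choice[b bP] : forall i : 'I_n, exists g, @unit_vector R Gamma A hA g = s i.
  by move=> i; have [g _ gi] := sS i; exists g.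
exists (exist _ y yh), [seq b i | i <- enum 'I_n]; split=> // g gb.
rewrite /entry/= yE.
have -> : val (\sum_(i < n) c i *: s i) g = \sum_(i < n) c i * (g == b i)%:R.
  elim/big_ind2: _ => //= [u1 v1 u2 v2 <- <- //|i _].
  by rewrite -bP.
apply: big1 => i _; have [gbi|_] := eqVneq g (b i); last by rewrite mulr0.
by move: gb; rewrite gbi map_f// mem_enum.
Qed.

Let above : set_system (seq Gamma) :=
  filter_from setT (fun s : seq Gamma => [set t : seq Gamma | {subset s <= t}]).

Let above_proper : ProperFilter above.
Proof.
apply: filter_from_proper; last by move=> s _; exists s => /=.
apply: filter_from_filter; first by exists [::].
move=> s t _ _; exists (s ++ t) => // u /= stu; split=> i is_; apply: stu;
  by rewrite mem_cat is_ ?orbT.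
Qed.

(** Bounded partial sums converge along an ultrafilter that refines inclusion of finite lists, so
    [eval_at] exists by compactness and its linearity is that of limits. *)
Let ultra := sval (cid (ultraFilterLemma above_proper)).
Let ultraP : UltraFilter ultra /\ above `<=` ultra := svalP (cid (ultraFilterLemma above_proper)).
Let ultraF : UltraFilter ultra := ultraP.1.
#[local] Existing Instance ultraF.

Let partial u x s := \sum_(g <- undup s) u g * entry x g.

Definition eval_at u x : R := lim (partial u x @ ultra).

Definition evaluable u := exists B (M : R), [/\ A B, 0 <= M &
  forall g, `|u g| <= M /\ (u g != 0 -> B g)].

Let partial_le u x s B (M : R) : A B -> 0 <= M ->
  (forall g, `|u g| <= M /\ (u g != 0 -> B g)) -> `|partial u x s| <= M * `|x|.
Proof.
move=> AB M0 uP; pose s' := [seq g <- undup s | u g != 0].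
have -> : partial u x s = \sum_(g <- s') u g * entry x g.
  rewrite big_filter /partial [LHS](bigID (fun g => u g != 0))/= addrC big1 ?add0r//.
  by move=> g /negPn/eqP->; rewrite mul0r.
apply: le_trans (ler_norm_sum _ _ _) _.
have us : uniq s' by rewrite filter_uniq// undup_uniq.
have As : A [set` s'].
  by apply: Asub AB _ => g; rewrite /= mem_filter => /andP[ug _]; apply: (uP g).2.
apply: (@le_trans _ _ (\sum_(g <- s') M * `|entry x g|)).
  by apply: ler_sum => g _; rewrite normrM ler_wpM2r// (uP g).1.
by rewrite -mulr_sumr ler_wpM2l// sum_entry_le.
Qed.

Let eval_cvg u x : evaluable u -> partial u x t @[t --> ultra] --> eval_at u x.
Proof.
move=> [B [M [AB M0 uP]]].
have Uf : UltraFilter (partial u x t @[t --> ultra]) by exact: ultra_fmap.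
have := @segment_compact R (- (M * `|x|)) (M * `|x|).
rewrite compact_ultra => /(_ _ Uf)[|p [_ xp]].
  apply: (@filterE _ ultra) => s; rewrite /= in_itv/= -ler_norml.
  exact: partial_le AB M0 uP.
by rewrite /eval_at (cvg_lim _ xp).
Qed.

Lemma eval_le u x B (M : R) : A B -> 0 <= M ->
  (forall g, `|u g| <= M /\ (u g != 0 -> B g)) -> `|eval_at u x| <= M * `|x|.
Proof.
move=> AB M0 uP; have ev : evaluable u by exists B, M.
apply: (@cvgr_to_le _ ultra _ R (fun t => `|partial u x t|)).
  exact: cvg_norm (@eval_cvg u x ev).
by apply: filterE => s; exact: partial_le AB M0 uP.
Qed.

(** [A] need not be closed under unions, hence the common member [B] carrying both supports. *)
Lemma evaluableD u v : evaluable u -> evaluable v ->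
  (exists2 B, A B & forall g, u g != 0 \/ v g != 0 -> B g) -> evaluable (u + v).
Proof.
move=> [B1 [M [_ M0 uP]]] [B2 [N [_ N0 vP]]] [B AB uvB].
exists B, (M + N); split => // [|g]; first exact: addr_ge0.
split; first by apply: le_trans (ler_normD _ _) _; rewrite lerD// ?(uP g).1 ?(vP g).1.
apply: contraPP => nBg; have /not_orP[/negP/negPn/eqP ug /negP/negPn/eqP vg] :
  ~ (u g != 0 \/ v g != 0) by move/uvB.
by apply/negP/negPn; rewrite -[_ g]/(u g + v g) ug vg addr0.
Qed.

Lemma eval_linear u : evaluable u -> scalar (eval_at u).
Proof.
move=> ev a x y; have vx := @eval_cvg u x ev; have vy := @eval_cvg u y ev.
have h : (fun t => a * partial u x t + partial u y t) @ ultra --> a * eval_at u x + eval_at u y.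
  by apply: cvgD => //; apply: cvgM => //; exact: cvg_cst.
apply: (cvg_unique _ (@eval_cvg u (a *: x + y) ev)); first exact: Rhausdorff.
rewrite (_ : partial u (a *: x + y) = (fun t => a * partial u x t + partial u y t))//.
apply/funext => t; rewrite /partial mulr_sumr -big_split/=; apply: eq_bigr => g _.
by rewrite entryD entryZ mulrDr mulrCA.
Qed.

Lemma evalD u v x : evaluable u -> evaluable v -> evaluable (u + v) ->
  eval_at (u + v) x = eval_at u x + eval_at v x.
Proof.
move=> eu ev euv; apply: (cvg_unique _ (@eval_cvg (u + v) x euv)); first exact: Rhausdorff.
rewrite (_ : partial (u + v) x = (fun t => partial u x t + partial v x t)).
  exact: cvgD (@eval_cvg u x eu) (@eval_cvg v x ev).
apply/funext => t; rewrite /partial -big_split/=; apply: eq_bigr => g _.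
by rewrite -mulrDl.
Qed.

Lemma eval_finite u x s : (forall g, g \notin s -> u g * entry x g = 0) ->
  eval_at u x = \sum_(g <- undup s) u g * entry x g.
Proof.
move=> xs; apply: lim_near_cst; first exact: Rhausdorff.
apply: ultraP.2; exists s => // t /= st; rewrite /partial.
rewrite [LHS](bigID (fun g => g \in s))/= addrC big1 ?add0r; last exact: xs.
rewrite -big_filter; apply: perm_big; apply: uniq_perm.
- by rewrite filter_uniq// undup_uniq.
- exact: undup_uniq.
- move=> g; rewrite mem_filter !mem_undup; case: (boolP (g \in s)) => //= gs.
  exact: st.
Qed.

Lemma eval_fin_supp u x s : fin_supp x s -> eval_at u x = \sum_(g <- undup s) u g * entry x g.
Proof. by move=> xs; apply: eval_finite => g /xs ->; rewrite mulr0. Qed.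

Lemma eval_unit u g : eval_at u (unit_h g) = u g.
Proof.
rewrite (@eval_fin_supp _ _ [:: g]); last first.
  by move=> h; rewrite inE entry_unit_h => /negbTE ->.
by rewrite big_seq1 entry_unit_h eqxx mulr1.
Qed.

End evaluation.

Arguments eval_at {R Gamma A} hA u x.

Section scalar_functions.
Variables (R : realType) (V : lmodType R) (f : V -> R).
Hypothesis fl : scalar f.

Lemma scalar_fun0 : f 0 = 0.
Proof.
by have := fl 1 0 0; rewrite scale1r addr0 mul1r => /eqP; rewrite -subr_eq subrr eq_sym => /eqP.
Qed.

Lemma scalar_funZ a x : f (a *: x) = a * f x.
Proof. by have := fl a x 0; rewrite scalar_fun0 !addr0. Qed.

Lemma scalar_funD x y : f (x + y) = f x + f y.
Proof. by have := fl 1 x y; rewrite scale1r mul1r. Qed.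

Lemma scalar_funB x y : f (x - y) = f x - f y.
Proof. by rewrite scalar_funD -scaleN1r scalar_funZ mulN1r. Qed.

End scalar_functions.

Section dual_norm_theory.
Variables (R : realType) (V : lmodType R) (N : V -> R).
Hypothesis N_norm : is_norm N.
Implicit Types (f g : V -> R).

Lemma is_norm0 : N 0 = 0.
Proof. by case: N_norm => _ NZ _; rewrite -(scale0r 0) NZ normr0 mul0r. Qed.

Lemma is_normN x : N (- x) = N x.
Proof. by case: N_norm => _ NZ _; rewrite -scaleN1r NZ normrN normr1 mul1r. Qed.

Lemma is_norm_ge0 x : 0 <= N x.
Proof.
case: N_norm => ND _ _; have := ND x (- x); rewrite subrr is_norm0 is_normN; lra.
Qed.

Let dual_sup f : dual N f -> has_sup [set `|f x| | x in [set x | N x <= 1]].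
Proof.
move=> [_ [M fM]]; split; first by exists `|f 0|, 0 => //=; rewrite is_norm0.
exists (Num.max M 0) => _ [x /= Nx <-]; apply: le_trans (fM x) _.
have M0 : 0 <= Num.max M 0 by rewrite le_max lexx orbT.
apply: (@le_trans _ _ (Num.max M 0 * N x)).
  by rewrite ler_wpM2r ?is_norm_ge0// le_max lexx.
by rewrite ler_piMr.
Qed.

Lemma dual_norm_ub f x : dual N f -> N x <= 1 -> `|f x| <= dual_norm N f.
Proof. by move=> df Nx; apply: (sup_upper_bound (dual_sup df)); exists x. Qed.

Lemma dual_norm_le f c : (forall x, N x <= 1 -> `|f x| <= c) -> dual_norm N f <= c.
Proof.
move=> h; apply: ge_sup; first by exists `|f 0|, 0 => //=; rewrite is_norm0.
by move=> _ [x Nx <-]; exact: h.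
Qed.

Lemma dual_norm_gt f c : dual N f -> c < dual_norm N f -> exists2 x, N x <= 1 & c < `|f x|.
Proof.
move=> df cf; have [|_ [x Nx <-]] := sup_adherent (eps := dual_norm N f - c) _ (dual_sup df).
  by rewrite subr_gt0.
by rewrite subKr => h; exists x.
Qed.

Lemma dual_norm_ge0 f : dual N f -> 0 <= dual_norm N f.
Proof.
move=> df; apply: le_trans (dual_norm_ub (x := 0) df _); first exact: normr_ge0.
by rewrite is_norm0.
Qed.

Lemma dual_norm_bound f x : dual N f -> `|f x| <= dual_norm N f * N x.
Proof.
move=> df; have [fl _] := df; have [Nx0|Nx0] := eqVneq (N x) 0.
  by case: N_norm => _ _ /(_ _ Nx0) ->; rewrite scalar_fun0// normr0 is_norm0 mulr0.
have Nx : 0 < N x by rewrite lt_def Nx0 is_norm_ge0.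
have /(dual_norm_ub df) : N ((N x)^-1 *: x) <= 1.
  by case: N_norm => _ -> _; rewrite normfV gtr0_norm// mulVf.
by rewrite scalar_funZ// normrM normfV (gtr0_norm Nx) ler_pdivrMl// mulrC.
Qed.

Lemma dual_normD f g : dual N f -> dual N g ->
  dual_norm N (f + g) <= dual_norm N f + dual_norm N g.
Proof.
move=> df dg; apply: dual_norm_le => x Nx; apply: le_trans (ler_normD _ _) _.
by rewrite lerD// dual_norm_ub.
Qed.

End dual_norm_theory.

(** * From a strictly convex dual norm to the increasing function *)

Section strictly_convex_increasing.
Variables (R : realType) (Gamma : choiceType) (A : set (set Gamma)).
Hypothesis hA : adequate A.
Variable N : h_space R hA -> R.
Hypothesis N_equiv : equivalent_norm N.
Hypothesis N_sc : strictly_convex (dual N) (dual_norm N).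
Local Notation e := (@unit_fun R Gamma).

Lemma strictly_convex_increasing : exists rho : K A -> R,
  [/\ forall x, 0 <= rho x <= 1, strictly_increasing rho &
      lower_semicontinuous (EFin \o rho)].
Proof.
have [N_norm [c [C [c0 C0 Ncmp]]]] := N_equiv.
have sign_bound (u : Gamma -> R) g : sign_vec A u -> `|u g| <= 1 /\ (u g != 0 -> [set g | u g != 0] g).
  by move=> [u1 _]; split=> //; have [->|->] := u1 g; rewrite ?normr0.
have ev (u : Gamma -> R) : sign_vec A u -> evaluable A u.
  by move=> su; exists [set g | u g != 0], 1; split=> //; [case: su|move=> g; exact: sign_bound].
have ev_le (u : Gamma -> R) x : sign_vec A u -> `|eval_at hA u x| <= `|x|.
  move=> su; rewrite -[leRHS]mul1r; apply: (@eval_le _ _ _ _ u x [set g | u g != 0]) => //.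
    by case: su.
  by move=> g; exact: sign_bound.
have ev_leN (u : Gamma -> R) x : sign_vec A u -> `|eval_at hA u x| <= c^-1 * N x.
  move=> su; apply: le_trans (ev_le _ _ su) _; rewrite ler_pdivlMl//.
  by have /andP[] := Ncmp x.
have ev_dual (u : Gamma -> R) : sign_vec A u -> dual N (eval_at hA u).
  by move=> su; split; [exact/eval_linear/ev|exists c^-1 => x; exact: ev_leN].
(* Since [c] times the original norm is at most [N], sign vectors have dual norm at most [c^-1]; the
   factor [c] brings [Phi] into the unit interval. *)
pose Phi u := (c * dual_norm N (eval_at hA u)) ^+ 2.
apply: (@sign_average_increasing _ _ _ hA Phi).
- move=> u su; have du := ev_dual _ su; rewrite sqr_ge0/= expr_le1//.
    rewrite mulrC -ler_pdivlMr// mul1r; apply: dual_norm_le => // x Nx.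
    apply: le_trans (ev_leN _ _ su) _; rewrite -[leRHS]mulr1 ler_wpM2l// invr_ge0.
    exact: ltW.
  by rewrite mulr_ge0 ?dual_norm_ge0// ltW.
(* Let [p], [q], [n] be the dual norms at [u + e a], [u - e a], [u]. Failure means
   [p^2 + q^2 <= 2 n^2], while [2 n <= p + q]; hence [p = q = n]. Strict convexity then identifies
   the functionals of [u + e a] and [u - e a], which differ at the unit vector of [a]. *)
- move=> u a ua su sD sN; rewrite ltNge; apply/negP => h.
  have dD := ev_dual _ sD; have dN := ev_dual _ sN; have du := ev_dual _ su.
  have AD : A [set g | (u + e a) g != 0] by case: sD.
  have uvB g : (u + e a) g != 0 \/ (u - e a) g != 0 -> [set g | (u + e a) g != 0] g.
    rewrite /= -[(u + e a) g]/(u g + (g == a)%:R) -[(u - e a) g]/(u g - (g == a)%:R).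
    have [->|_] := eqVneq g a; last by rewrite addr0 subr0 => -[].
    by rewrite ua add0r oner_neq0.
  have uuB g : u g != 0 \/ u g != 0 -> [set g | u g != 0] g by case.
  have Au : A [set g | u g != 0] by case: su.
  have evDN : evaluable A ((u + e a) + (u - e a)).
    by apply: evaluableD; [exact: ev|exact: ev|exists [set g | (u + e a) g != 0]].
  have evuu : evaluable A (u + u).
    by apply: evaluableD; [exact: ev|exact: ev|exists [set g | u g != 0]].
  have fgE x : eval_at hA (u + e a) x + eval_at hA (u - e a) x = 2 * eval_at hA u x.
    rewrite -evalD//; [|exact: ev|exact: ev].
    rewrite addrACA subrr addr0 evalD//; [|exact: ev|exact: ev].
    by rewrite mulr_natl.
  have nE : dual_norm N (eval_at hA (u + e a) + eval_at hA (u - e a)) = 2 * dual_norm N (eval_at hA u).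
    apply/eqP; rewrite eq_le; apply/andP; split.
      apply: dual_norm_le => // x Nx.
      rewrite -[(_ + _) x]/(eval_at hA (u + e a) x + eval_at hA (u - e a) x) fgE normrM.
      by rewrite ger0_norm// ler_pM2l// dual_norm_ub.
    rewrite -ler_pdivlMl//; apply: dual_norm_le => // x Nx; rewrite ler_pdivlMl//.
    have : dual N (eval_at hA (u + e a) + eval_at hA (u - e a)).
      split.
        move=> k y z; rewrite -![(_ + _) (_ : h_space R hA)]/(eval_at hA (u + e a) _ + eval_at hA (u - e a) _) !fgE.
        by rewrite (eval_linear (ev _ su)) mulrDr mulrCA.
      exists (2 * c^-1) => y.
      rewrite -[(_ + _) y]/(eval_at hA (u + e a) y + eval_at hA (u - e a) y) fgE normrM ger0_norm// -mulrA.
      by rewrite ler_pM2l// ev_leN.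
    move=> /(dual_norm_ub N_norm)/(_ Nx).
    by rewrite -[(_ + _) x]/(eval_at hA (u + e a) x + eval_at hA (u - e a) x) fgE normrM ger0_norm.
  have := dual_normD N_norm dD dN; rewrite nE => nle.
  move: h; rewrite /Phi !exprMn -mulrDr mulrCA ler_pM2l ?exprn_gt0// => h.
  have p0 := dual_norm_ge0 N_norm dD; have q0 := dual_norm_ge0 N_norm dN.
  have n0 := dual_norm_ge0 N_norm du.
  have pq : dual_norm N (eval_at hA (u + e a)) = dual_norm N (eval_at hA (u - e a)).
    by move: h nle p0 q0 n0; rewrite !expr2; nra.
  have nq : dual_norm N (eval_at hA (u - e a)) = dual_norm N (eval_at hA u).
    by move: h nle p0 q0 n0; rewrite pq !expr2; nra.
  have /(congr1 (fun f => f (unit_h R hA a))) : eval_at hA (u + e a) = eval_at hA (u - e a).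
    by apply: N_sc => //; rewrite nE nq mulrA mulVf ?mul1r.
  rewrite !eval_unit -[(u + e a) a]/(u a + (a == a)%:R) -[(u - e a) a]/(u a - (a == a)%:R).
  by rewrite eqxx ua (_ : true%:R = 1 :> R)//; lra.
- move=> u r su ru; have du := ev_dual _ su.
  have [r0|r0] := ltP r 0.
    exists [::], (fun=> 0); rewrite /lin_form big_nil expr0n/=; split=> // v _.
    by rewrite /lin_form big_nil expr0n/= sqr_ge0.
  pose m := Num.sqrt r; have m0 : 0 <= m := sqrtr_ge0 r.
  have rm : r = m ^+ 2 by rewrite sqr_sqrtr.
  have : m / c < dual_norm N (eval_at hA u).
    rewrite ltr_pdivrMr// mulrC; move: ru; rewrite /Phi rm ltr_pXn2r ?nnegrE//.
    by rewrite mulr_ge0 ?dual_norm_ge0// ltW.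
  move=> /(dual_norm_gt N_norm du)[x Nx]; rewrite ltr_pdivrMr// mulrC.
  set k := `|_| => mk.
  (* The finitely supported [y], normalised to [z], must still satisfy [c (k - d) > m (1 + C d)],
     that is [d (c + m C) < c k - m]. The summand 1 makes this strict and the denominator
     positive. *)
  pose d := (c * k - m) / (c + m * C + 1).
  have den : 0 < c + m * C + 1 by rewrite ltr_wpDl// addr_ge0 ?mulr_ge0// ltW.
  have d0 : 0 < d by rewrite divr_gt0// subr_gt0.
  have [y [s [ys xy]]] := fin_supp_dense x d0.
  have t0 : 0 < 1 + C * d by rewrite ltr_wpDr// mulr_ge0// ltW.
  pose z := (1 + C * d)^-1 *: y.
  have Ny : N y <= 1 + C * d.
    have -> : y = x + (y - x) by rewrite addrC subrK.
    have [ND _ _] := N_norm; apply: le_trans (ND _ _) _; rewrite lerD//.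
    have /andP[_] := Ncmp (y - x); move=> /le_trans; apply; rewrite ler_pM2l//.
    by rewrite distrC ltW.
  have Nz : N z <= 1.
    have [_ -> _] := N_norm; rewrite normfV gtr0_norm// ler_pdivrMl// mulr1.
    exact: Ny.
  have zs : fin_supp z s by move=> g gs; rewrite /z entryZ ys// mulr0.
  exists (undup s), (fun g => c * entry z g).
  have lE v : lin_form (undup s) (fun g => c * entry z g) v = c * eval_at hA v z.
    rewrite (eval_fin_supp _ zs) /lin_form mulr_sumr; apply: eq_bigr => g _.
    by rewrite -mulrA [entry z g * _]mulrC.
  split=> [|v sv]; rewrite lE.
    rewrite rm -[ltRHS]real_normK ?num_real// ltr_pXn2r ?nnegrE//.
    have eD : scalar (eval_at hA u) by exact: eval_linear (ev _ su).
    rewrite normrM (gtr0_norm c0) /z (scalar_funZ eD) normrM normfV (gtr0_norm t0) mulrCA ltr_pdivlMl//.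
    have ky : k - d < `|eval_at hA u y|.
      have : `|eval_at hA u (x - y)| <= `|x - y| by exact: ev_le.
      rewrite (scalar_funB eD); have := lerB_dist (eval_at hA u x) (eval_at hA u y); rewrite -/k; lra.
    have : c * (k - d) < c * `|eval_at hA u y| by rewrite ltr_pM2l.
    have dE : d * (c + m * C + 1) = c * k - m by rewrite divfK// gt_eqF.
    by move: dE d0; rewrite !mulrDr !mulrDl; nra.
  have dv := ev_dual _ sv.
  rewrite /Phi -[leLHS]real_normK ?num_real// normrM (gtr0_norm c0) ler_pXn2r ?nnegrE//.
  - by rewrite ler_pM2l// dual_norm_ub.
  - by rewrite mulr_ge0// ltW.
  - by rewrite mulr_ge0 ?dual_norm_ge0// ltW.
Qed.

End strictly_convex_increasing.

(** * The Hahn-Banach theorem *)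

Section hahn_banach.
Variable R : realType.

Definition sublinear (Y : lmodType R) (q : Y -> R) :=
  (forall x y, q (x + y) <= q x + q y) /\
  (forall (t : R) x, 0 <= t -> q (t *: x) = t * q x).

Lemma sublinear0 (Y : lmodType R) (q : Y -> R) : sublinear q -> q 0 = 0.
Proof. by case=> _ qZ; rewrite -(scale0r 0) qZ// mul0r. Qed.

Lemma sublinear_ge (Y : lmodType R) (q : Y -> R) x : sublinear q -> - q (- x) <= q x.
Proof. by move=> sq; have [/(_ x (- x)) + _] := sq; rewrite subrr sublinear0//; lra. Qed.

Section lower_on_cone.
Variables (Y : lmodType R) (q : Y -> R) (S : set (Y * R)).
Hypothesis q_sub : sublinear q.
Hypothesis S0 : S (0, 0).
Hypothesis SD : forall x y, S x -> S y -> S (x.1 + y.1, x.2 + y.2).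
Hypothesis SZ : forall (t : R) x, 0 < t -> S x -> S (t *: x.1, t * x.2).
Hypothesis Sq : forall x, S x -> - q (- x.1) <= x.2.

(** [q'] is the infimal convolution of [q] with the upper bounds prescribed on the cone [S]; [Sq]
    keeps the infimum finite. *)
Let vals z := [set q (z - x.1) + x.2 | x in S].
Let q' z := inf (vals z).

Let vals_inf z : has_inf (vals z).
Proof.
split; first by exists (q (z - 0) + 0), (0, 0).
exists (- q (- z)) => _ [x Sx <-].
have [qD _] := q_sub; have := qD (z - x.1) (- z); rewrite addrAC subrr add0r.
by have := Sq Sx; lra.
Qed.

Let q'_lb z x : S x -> q' z <= q (z - x.1) + x.2.
Proof. by move=> Sx; apply: (ge_inf (vals_inf z).2); exists x. Qed.

Let q'_ge z c : (forall x, S x -> c <= q (z - x.1) + x.2) -> c <= q' z.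
Proof. by move=> h; apply: lb_le_inf; [exact: (vals_inf z).1|move=> _ [x Sx <-]; exact: h]. Qed.

Let q'_lt z c : q' z < c -> exists2 x, S x & q (z - x.1) + x.2 < c.
Proof.
move=> zc; have [|_ [x Sx <-]] := inf_adherent (eps := c - q' z) _ (vals_inf z).
  by rewrite subr_gt0.
by rewrite -/(q' z) => h; exists x => //; lra.
Qed.

Lemma sublinear_lower_on_cone : exists r : Y -> R,
  [/\ sublinear r, forall y, r y <= q y & forall x, S x -> r x.1 <= x.2].
Proof.
have [qD qZ] := q_sub; have q0 := sublinear0 q_sub.
have q'D x y : q' (x + y) <= q' x + q' y.
  rewrite leNgt; apply/negP => h.
  have [|a Sa xa] := @q'_lt x (q' x + (q' (x + y) - q' x - q' y) / 2); first lra.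
  have [|b Sb yb] := @q'_lt y (q' y + (q' (x + y) - q' x - q' y) / 2); first lra.
  have := q'_lb (x + y) (SD Sa Sb); rewrite /= opprD addrACA.
  by have := qD (x - a.1) (y - b.1); lra.
have q'Z_le (t : R) x : 0 < t -> q' (t *: x) <= t * q' x.
  move=> t0; rewrite -ler_pdivrMl//; apply: q'_ge => a Sa.
  rewrite ler_pdivrMl// mulrDr -(qZ _ _ (ltW t0)) scalerBr.
  exact: q'_lb _ (SZ t0 Sa).
have q'0 : q' 0 = 0.
  apply/eqP; rewrite eq_le; apply/andP; split.
    by have := q'_lb 0 S0; rewrite /= subr0 q0 addr0.
  by apply: q'_ge => a /Sq; rewrite add0r; lra.
exists q'; split; [split=> //|..].
- move=> t x; rewrite le_eqVlt => /orP[/eqP<-|t0].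
    by rewrite scale0r mul0r.
  apply/eqP; rewrite eq_le q'Z_le//=.
  have := q'Z_le t^-1 (t *: x); rewrite invr_gt0 => /(_ t0).
  by rewrite scalerA mulVf ?gt_eqF// scale1r ler_pdivlMl.
- by move=> y; have := q'_lb y S0; rewrite /= subr0 addr0.
- by move=> x Sx; have := q'_lb x.1 Sx; rewrite subrr q0 add0r.
Qed.

End lower_on_cone.

(* Minimal sublinear functions are linear, which turns Zorn's lemma into an
   extension theorem without any bookkeeping of partial functionals. *)
Lemma minimal_sublinear (Y : lmodType R) (p : Y -> R) : sublinear p ->
  exists q, [/\ sublinear q, forall y, q y <= p y &
    forall r, sublinear r -> (forall y, r y <= q y) -> forall y, r y = q y].
Proof.
move=> p_sub; pose T := {q : Y -> R | sublinear q /\ forall y, q y <= p y}.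
(* The order is reversed, so that a maximal element in Zorn's lemma is a pointwise minimal function.
   A nonempty chain is bounded by its pointwise infimum. *)
pose below (q r : T) := `[< forall y, sval r y <= sval q y >].
have pT : sublinear p /\ forall y, p y <= p y by [].
have [||C Ctot|q qmin] := @ZL_preorder T (exist _ p pT) below.
- by move=> q; apply/asboolP.
- by move=> q r t /asboolP qr /asboolP rt; apply/asboolP => y; exact: le_trans (rt y) (qr y).
- have [[q0 Cq0]|C0] := pselect (C !=set0); last first.
    by exists (exist _ p pT) => q Cq; exfalso; apply: C0; exists q.
  pose vals y := [set sval q y | q in C].
  have vinf y : has_inf (vals y).
    split; first by exists (sval q0 y), q0.
    exists (- p (- y)) => _ [[q [qs qp]] Cq <-] /=.
    by apply: le_trans (sublinear_ge y qs); rewrite lerN2.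
  pose m y := inf (vals y).
  have m_lb y q : C q -> m y <= sval q y by move=> Cq; apply: (ge_inf (vinf y).2); exists q.
  have m_lt y c : m y < c -> exists2 q, C q & sval q y < c.
    move=> yc; have [|_ [q Cq <-]] := inf_adherent (eps := c - m y) _ (vinf y).
      by rewrite subr_gt0.
    by rewrite -/(m y) => h; exists q => //; lra.
  have m_ge y c : (forall q, C q -> c <= sval q y) -> c <= m y.
    by move=> h; apply: lb_le_inf; [exact: (vinf y).1|move=> _ [q Cq <-]; exact: h].
  have mT : sublinear m /\ forall y, m y <= p y.
    split; [split|].
    + move=> x y; rewrite leNgt; apply/negP => h.
      have [|a Ca xa] := @m_lt x (m x + (m (x + y) - m x - m y) / 2); first lra.
      have [|b Cb yb] := @m_lt y (m y + (m (x + y) - m x - m y) / 2); first lra.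
      have [/asboolP ab|/asboolP ba] := Ctot _ _ Ca Cb.
        have [[bD _] _] := svalP b; have := m_lb (x + y) _ Cb.
        by have := bD x y; have := ab x; lra.
      have [[aD _] _] := svalP a; have := m_lb (x + y) _ Ca.
      by have := aD x y; have := ba y; lra.
    + move=> t x t0; apply/eqP; rewrite eq_le; apply/andP; split; last first.
        apply: m_ge => q Cq; have [[_ qZ] _] := svalP q.
        by rewrite qZ// ler_wpM2l// m_lb.
      have [{}t0|tle0] := ltP 0 t; last first.
        rewrite (_ : t = 0); last by apply/eqP; rewrite eq_le tle0.
        rewrite scale0r mul0r; have [q0s _] := svalP q0.
        by have := m_lb 0 _ Cq0; rewrite (sublinear0 q0s).
      rewrite -ler_pdivrMl//; apply: m_ge => q Cq; rewrite ler_pdivrMl//.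
      by have [[_ qZ] _] := svalP q; rewrite -(qZ _ _ (ltW t0)) m_lb.
    + move=> y; have [_ q0p] := svalP q0; exact: le_trans (m_lb y _ Cq0) (q0p y).
  exists (exist _ m mT) => q Cq; apply/asboolP => y /=; exact: m_lb.
- have [qs qp] := svalP q; exists (sval q); split=> // r rs rq y.
  have rT : sublinear r /\ forall y, r y <= p y.
    by split=> // z; exact: le_trans (rq z) (qp z).
  have /asboolP h := qmin (exist _ r rT) (introT (asboolP _) rq).
  by apply/eqP; rewrite eq_le rq h.
Qed.

(** Prescribing the value [- q y] at [- y] along a ray gives a sublinear function below [q], which
    by minimality is [q] itself. So [q (- y) <= - q y], and subadditivity becomes additivity. *)
Lemma minimal_sublinear_linear (Y : lmodType R) (q : Y -> R) : sublinear q ->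
  (forall r, sublinear r -> (forall y, r y <= q y) -> forall y, r y = q y) ->
  scalar q.
Proof.
move=> qs qmin; have [qD qZ] := qs; have q0 := sublinear0 qs.
have additive x y : q (x + y) = q x + q y.
  apply/eqP; rewrite eq_le qD/=.
  pose S := [set a : Y * R | exists2 t, 0 <= t & a = (- (t *: y), - (t * q y))].
  have [||||r [rs rq rS]] := @sublinear_lower_on_cone Y q S qs.
  - by exists 0; rewrite // scale0r mul0r !oppr0.
  - move=> _ _ [t t0 ->] [u u0 ->]; exists (t + u); first exact: addr_ge0.
    by rewrite /= scalerDl mulrDl !opprD.
  - move=> t _ t0 [u u0 ->]; exists (t * u); first by rewrite mulr_ge0// ltW.
    by rewrite /= -scalerA -mulrA scalerN mulrN.
  - by move=> _ [t t0 ->] /=; rewrite opprK qZ.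
  have /rS /= : S (- y, - q y) by exists 1; rewrite ?scale1r ?mul1r.
  rewrite (qmin r rs rq) => qNy.
  by have := qD (x + y) (- y); rewrite addrK; lra.
have qN x : q (- x) = - q x.
  by have := additive x (- x); rewrite subrr q0; lra.
move=> a x y; rewrite additive; congr (_ + _).
have [a0|a0] := leP 0 a; first exact: qZ.
by rewrite -[a]opprK scaleNr qN qZ ?mulNr// oppr_ge0 ltW.
Qed.

(** The cone is the graph of pairs [(T x, f x)], whose compatibility with [p] is the assumed bound
    at [- x]. A minimal function below then satisfies [F (T x) <= f x], and the same at [- x] gives
    equality. *)
Lemma hahn_banach (X Y : lmodType R) (T : X -> Y) (f : X -> R) (p : Y -> R) :
  linear T -> scalar f -> sublinear p -> (forall x, f x <= p (T x)) ->
  exists F : Y -> R, [/\ scalar F, forall y, F y <= p y & forall x, F (T x) = f x].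
Proof.
move=> Tl fl ps fp; pose S := [set (T x, f x) | x in [set: X]].
have TD x y : T (x + y) = T x + T y by have := Tl 1 x y; rewrite !scale1r.
have T0 : T 0 = 0 by apply: (addrI (T 0)); rewrite -TD !addr0.
have TZ a x : T (a *: x) = a *: T x by have := Tl a x 0; rewrite T0 !addr0.
have f0 : f 0 = 0 by exact: scalar_fun0 fl.
have [||||r [rs rp rS]] := @sublinear_lower_on_cone Y p S ps.
- by exists 0 => //; rewrite T0 f0.
- by move=> _ _ [x _ <-] [y _ <-]; exists (x + y) => //=; rewrite TD (scalar_funD fl).
- by move=> t _ t0 [x _ <-]; exists (t *: x) => //=; rewrite TZ (scalar_funZ fl).
- move=> _ [x _ <-] /=; have := fp (- x); rewrite -[- x]scaleN1r (scalar_funZ fl) TZ.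
  by rewrite scaleN1r mulN1r lerNl.
have [F [Fs Fr Fmin]] := minimal_sublinear rs.
have Fl := minimal_sublinear_linear Fs Fmin.
have le x : F (T x) <= f x by apply: le_trans (Fr _) _; apply: (rS (T x, f x)); exists x.
exists F; split=> // [y|x]; first exact: le_trans (Fr y) (rp y).
apply/eqP; rewrite eq_le le/=.
have := le (- x); rewrite -(scaleN1r x) TZ (scalar_funZ Fl) (scalar_funZ fl).
by rewrite !mulN1r lerN2.
Qed.

End hahn_banach.

(** * Contents on clopen sets and sunflowers *)

Section content.
Variables (R : realType) (Z : topologicalType).
Hypothesis Zcpt : compact [set: Z].
Hypothesis clb : clopen_base Z.
Implicit Types (C D E U V W X O : set Z) (c : set Z -> R).

Definition clopen_content c := (forall C, clopen C -> 0 <= c C) /\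
  (forall C D, clopen C -> clopen D -> C `&` D = set0 -> c (C `|` D) = c C + c D).

Definition inner c V : R := sup [set c C | C in [set C | clopen C /\ C `<=` V]].

(** The outer regular extension of a content, built as for measures but with finite operations only.
    Differences of nested open sets, such as petals without their kernel, split every set additively
    ([outer_split]). *)
Definition outer c X : R := inf [set inner c V | V in [set V | open V /\ X `<=` V]].

Let clopen0 : clopen (@set0 Z).
Proof. by split; [exact: open0|exact: closed0]. Qed.

Let clopenU2 C D : clopen C -> clopen D -> clopen (C `|` D).
Proof. by move=> [? ?] [? ?]; split; [exact: openU|exact: closedU]. Qed.

Let clopen_setD C D : clopen C -> clopen D -> clopen (C `\` D).
Proof.
move=> [? ?] [? ?]; rewrite setDE; split.
  by apply: openI => //; exact: closed_openC.
by apply: closedI => //; exact: open_closedC.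
Qed.

Lemma open_setD U C : open U -> closed C -> open (U `\` C).
Proof. by move=> Uop Ccl; rewrite setDE; apply: openI => //; exact: closed_openC. Qed.

Section one_content.
Variable c : set Z -> R.
Hypothesis c_content : clopen_content c.

Lemma content_mono C D : clopen C -> clopen D -> C `<=` D -> c C <= c D.
Proof.
move=> Ccl Dcl CD; have [c0 cD] := c_content.
rewrite -(setDUK CD) cD ?lerDl ?c0//; try exact: clopen_setD.
by rewrite setDE setICA setICr setI0.
Qed.

Lemma content0 : c set0 = 0.
Proof.
have [_ cD] := c_content; have := cD _ _ clopen0 clopen0 (setI0 _).
by rewrite setU0; lra.
Qed.

Let inner_sup V : has_sup [set c C | C in [set C | clopen C /\ C `<=` V]].
Proof.
split; first by exists (c set0), set0 => //; split; [exact: clopen0|exact: sub0set].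
exists (c setT) => _ [C [Ccl _] <-]; apply: content_mono => //.
by split; [exact: openT|exact: closedT].
Qed.

Lemma inner_ub C V : clopen C -> C `<=` V -> c C <= inner c V.
Proof. by move=> Ccl CV; apply: (sup_upper_bound (inner_sup V)); exists C. Qed.

Lemma inner_le V r : (forall C, clopen C -> C `<=` V -> c C <= r) -> inner c V <= r.
Proof.
move=> h; apply: ge_sup; first by exists (c set0), set0 => //; split; [exact: clopen0|exact: sub0set].
by move=> _ [C [Ccl CV] <-]; exact: h.
Qed.

Lemma inner_lt V r : r < inner c V -> exists C, [/\ clopen C, C `<=` V & r < c C].
Proof.
move=> rV; have [|_ [C [Ccl CV] <-]] := sup_adherent (eps := inner c V - r) _ (inner_sup V).
  by rewrite subr_gt0.
by rewrite subKr => h; exists C.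
Qed.

Lemma inner_mono V W : V `<=` W -> inner c V <= inner c W.
Proof.
by move=> VW; apply: inner_le => C Ccl CV; apply: inner_ub => //; exact: subset_trans VW.
Qed.

Lemma inner_clopen C : clopen C -> inner c C = c C.
Proof.
move=> Ccl; apply/eqP; rewrite eq_le inner_ub// andbT; apply: inner_le => D Dcl.
exact: content_mono.
Qed.

Lemma inner_ge0 V : 0 <= inner c V.
Proof. by rewrite -content0; exact: inner_ub. Qed.

Lemma innerU U V : open U -> open V -> inner c (U `|` V) <= inner c U + inner c V.
Proof.
move=> Uop Vop; apply: inner_le => C Ccl CUV.
have [D [E [Dcl Ecl DU EV [-> DE]]]] := clopen_disjoint_split Zcpt clb Ccl Uop Vop CUV.
by have [_ -> //] := c_content; rewrite lerD// inner_ub.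
Qed.

Let outer_inf X : has_inf [set inner c V | V in [set V | open V /\ X `<=` V]].
Proof.
split; first by exists (inner c setT), setT => //; split=> //; exact: openT.
by exists 0 => _ [V _ <-]; exact: inner_ge0.
Qed.

Lemma outer_lb X V : open V -> X `<=` V -> outer c X <= inner c V.
Proof. by move=> Vop XV; apply: (ge_inf (outer_inf X).2); exists V. Qed.

Lemma outer_ge X r : (forall V, open V -> X `<=` V -> r <= inner c V) -> r <= outer c X.
Proof.
move=> h; apply: lb_le_inf; first exact: (outer_inf X).1.
by move=> _ [V [Vop XV] <-]; exact: h.
Qed.

Lemma outer_lt X r : outer c X < r -> exists V, [/\ open V, X `<=` V & inner c V < r].
Proof.
move=> Xr; have [|_ [V [Vop XV] <-]] := inf_adherent (eps := r - outer c X) _ (outer_inf X).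
  by rewrite subr_gt0.
by rewrite -/(outer c X) => h; exists V; split=> //; lra.
Qed.

Lemma outer_open V : open V -> outer c V = inner c V.
Proof.
move=> Vop; apply/eqP; rewrite eq_le outer_lb//=; apply: outer_ge => W _.
exact: inner_mono.
Qed.

Lemma outer_clopen C : clopen C -> outer c C = c C.
Proof. by move=> Ccl; rewrite outer_open ?inner_clopen//; case: Ccl. Qed.

Lemma outer_ge0 X : 0 <= outer c X.
Proof. by apply: outer_ge => *; exact: inner_ge0. Qed.

Lemma outer_mono X Y : X `<=` Y -> outer c X <= outer c Y.
Proof.
by move=> XY; apply: outer_ge => V Vop YV; apply: outer_lb => //; exact: subset_trans YV.
Qed.

Lemma outerU X Y : outer c (X `|` Y) <= outer c X + outer c Y.
Proof.
rewrite leNgt; apply/negP => h.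
have [|U [Uop XU Ur]] := @outer_lt X (outer c X + (outer c (X `|` Y) - outer c X - outer c Y) / 2); first lra.
have [|V [Vop YV Vr]] := @outer_lt Y (outer c Y + (outer c (X `|` Y) - outer c X - outer c Y) / 2); first lra.
have := outer_lb (openU Uop Vop) (setUSS XU YV); have := innerU Uop Vop; lra.
Qed.

(** Caratheodory's condition for open [V]: if a clopen [C] nearly exhausts the intersection of [W]
    and [V], the rest of [W] is open and covers [X] outside [V]. *)
Lemma outer_split_open V X : open V -> outer c X = outer c (X `&` V) + outer c (X `\` V).
Proof.
move=> Vop; apply/eqP; rewrite eq_le; apply/andP; split.
  by rewrite -{1}(setUIDK X V) outerU.
apply: outer_ge => W Wop XW; rewrite leNgt; apply/negP => h.
have WVop := openI Wop Vop.
have [|C [Ccl CWV hC]] := @inner_lt (W `&` V)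
  (inner c (W `&` V) - (outer c (X `&` V) + outer c (X `\` V) - inner c W)); first lra.
have WCop : open (W `\` C) by apply: open_setD => //; case: Ccl.
have le1 : outer c (X `&` V) <= inner c (W `&` V).
  by apply: outer_lb => //; exact: setSI.
have le2 : outer c (X `\` V) <= inner c (W `\` C).
  by apply: outer_lb => // x [/XW Wx nVx]; split=> // /CWV[].
have : inner c (W `\` C) <= inner c W - c C.
  apply: inner_le => D Dcl DWC; rewrite lerBrDr.
  have [_ cD] := c_content; rewrite -cD//; last first.
    by rewrite -subset0 => x [/DWC[]].
  apply: inner_ub; first exact: clopenU2.
  by move=> x [/DWC[]|/CWV[]].
lra.
Qed.

Lemma outer_split V W X : open V -> open W -> W `<=` V ->
  outer c X = outer c (X `&` (V `\` W)) + outer c (X `\` (V `\` W)).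
Proof.
move=> Vop Wop WV; rewrite (outer_split_open X Vop) (outer_split_open (X `&` V) Wop).
rewrite (outer_split_open (X `\` (V `\` W)) Wop).
have -> : X `&` V `&` W = (X `\` (V `\` W)) `&` W.
  apply/seteqP; split=> x /=; first by move=> [[Xx Vx] Wx]; split=> //; split=> // -[].
  by move=> [[Xx _] Wx]; split=> //; split=> //; exact: WV.
have -> : X `&` V `\` W = X `&` (V `\` W) by rewrite setIDA.
have -> : X `\` (V `\` W) `\` W = X `\` V; last by rewrite [RHS]addrCA addrA.
apply/seteqP; split=> x /=.
  by move=> [[Xx nVW] nWx]; split=> // Vx; exact: nVW.
by move=> [Xx nVx]; split=> [|/WV//]; split=> // -[].
Qed.

Lemma outer_setD V W : open V -> open W -> W `<=` V ->
  outer c (V `\` W) = inner c V - inner c W.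
Proof.
move=> Vop Wop WV; have := outer_split_open V Wop.
rewrite (setIidr WV) (outer_open Vop) (outer_open Wop); lra.
Qed.

Lemma outer_bigcup_seq (I : eqType) (s : seq I) (f : I -> set Z) :
  outer c (\big[setU/set0]_(i <- s) f i) <= \sum_(i <- s) outer c (f i).
Proof.
elim: s => [|a s IHs]; first by rewrite !big_nil outer_clopen// content0.
by rewrite !big_cons; apply: le_trans (outerU _ _) _; rewrite lerD2l.
Qed.

End one_content.

Section sum_content.
Variables c d : set Z -> R.
Hypothesis c_content : clopen_content c.
Hypothesis d_content : clopen_content d.

Lemma contentD : clopen_content (fun C => c C + d C).
Proof.
have [c0 cD] := c_content; have [d0 dD] := d_content; split.
  by move=> C Ccl; rewrite addr_ge0 ?c0 ?d0.
by move=> C D Ccl Dcl CD; rewrite cD// dD// addrACA.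
Qed.

(** Clopen subsets of [V] are directed under union, so one of them nearly attains both suprema. *)
Lemma innerD V : inner (fun C => c C + d C) V = inner c V + inner d V.
Proof.
apply/eqP; rewrite eq_le; apply/andP; split.
  by apply: inner_le => C Ccl CV; rewrite lerD// inner_ub.
rewrite leNgt; apply/negP => h.
pose e := (inner c V + inner d V - inner (fun C => c C + d C) V) / 2.
have e0 : 0 < e by rewrite /e; lra.
have [|C [Ccl CV hC]] := @inner_lt c c_content V (inner c V - e); first by lra.
have [|D [Dcl DV hD]] := @inner_lt d d_content V (inner d V - e); first by lra.
have CDcl := clopenU2 Ccl Dcl.
have := inner_ub contentD CDcl (_ : C `|` D `<=` V); rewrite subUset => /(_ (conj CV DV)).
have := content_mono c_content Ccl CDcl (@subsetUl _ C D).
have := content_mono d_content Dcl CDcl (@subsetUr _ C D).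
rewrite /= /e in hC hD *; lra.
Qed.

End sum_content.

End content.

(** * Sunflowers of open sets *)

Section sunflower.
Variables (R : realType) (Z : topologicalType).
Hypothesis Zcpt : compact [set: Z].
Hypothesis clb : clopen_base Z.
Implicit Types (C D E U V W X O : set Z) (c : set Z -> R) (F : set Z * set (set Z)).

(* [F.1] is the kernel and [F.2] the set of petals. *)
Definition sunflower F := [/\ open F.1, forall V, F.2 V -> open V /\ F.1 `<=` V &
  forall V W, F.2 V -> F.2 W -> V <> W -> V `&` W `<=` F.1].

(** Off the kernel the petals are disjoint, and each open petal can be peeled off additively. *)
Lemma sunflower_sum c F (l : seq (set Z)) : clopen_content c -> sunflower F -> uniq l ->
  (forall V, V \in l -> F.2 V) -> \sum_(V <- l) outer c (V `\` F.1) <= c setT.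
Proof.
move=> cc [F1op F2 F12].
suff h : uniq l -> (forall V, V \in l -> F.2 V) ->
    \sum_(V <- l) outer c (V `\` F.1) <= outer c (\big[setU/set0]_(V <- l) V `\` F.1).
  move=> ul lF; apply: le_trans (h ul lF) _.
  have clT : clopen [set: Z] by split; [exact: openT|exact: closedT].
  by rewrite -(outer_clopen cc clT); exact: outer_mono.
elim: l => [|V l IHl] /=; first by rewrite !big_nil outer_ge0.
move=> /andP[Vl ul] lF; rewrite !big_cons.
have FV : F.2 V by apply: lF; rewrite mem_head.
have [Vop F1V] := F2 _ FV.
rewrite [leRHS](outer_split_open Zcpt clb cc _ Vop) lerD//.
  by apply: outer_mono => // x [Vx nF]; split=> //; split=> //; left.
apply: le_trans (IHl ul _) _; first by move=> W Wl; apply: lF; rewrite in_cons Wl orbT.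
apply: outer_mono => // x [lx nF]; split; first by split=> //; right.
move=> Vx; move: lx; rewrite -bigcup_seq => -[W /= Wl Wx]; apply: nF.
have WV : V <> W by move=> VW; rewrite VW Wl in Vl.
by apply: (F12 _ _ FV (lF W _) WV) => //; rewrite in_cons Wl orbT.
Qed.

(* Up to an open set of small content, a sunflower is a finite family of
   clopen sets. *)
Lemma sunflower_near_clopen c F (eps : R) : clopen_content c -> sunflower F -> 0 < eps ->
  exists O (l : seq (set Z)) (E : set Z -> set Z), [/\ open O, inner c O <= eps,
    forall V, V \in l -> F.2 V /\ clopen (E V) &
    forall V x, F.2 V -> ~ O x -> (V `\` F.1) x <-> V \in l /\ E V x].
Proof.
move=> cc Fsun eps0; have [F1op F2 F12] := Fsun.
pose sums := [set \sum_(V <- l) outer c (V `\` F.1) |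
  l in [set l : seq (set Z) | uniq l /\ forall V, V \in l -> F.2 V]].
have sums_sup : has_sup sums.
  split; first by exists 0, [::] => //; rewrite big_nil.
  by exists (c setT) => _ [l [ul lF] <-]; exact: sunflower_sum.
(* The budget: [Y] minus [B] costs at most [2 d], the petals of [l] minus their clopen parts cost at
   most [d] together. *)
pose d := eps / 4; have d0 : 0 < d by rewrite divr_gt0.
have [_ [l [ul lF] <-] hl] := sup_adherent d0 sums_sup.
pose rest V := F.2 V /\ V \notin l.
pose Y := F.1 `|` \bigcup_(V in [set V | rest V]) V.
have Yop : open Y by apply: openU => //; apply: bigcup_open => V [/F2[]].
(* The petals outside [l] add at most [d] to the kernel: finitely many of them could be appended to
   the almost optimal list [l]. *)
have Y_le : inner c Y <= inner c F.1 + d.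
  apply: inner_le => C Ccl CY.
  (* Every index needs an open set, so sets outside [rest] default to the kernel; in the covering
     below, [None] is the kernel itself. *)
  pose f V := if `[< rest V >] then V else F.1.
  have fop V : open (f V) by rewrite /f; case: asboolP => // -[/F2[]].
  have Cf : C `<=` F.1 `|` \bigcup_V f V.
    move=> x /CY[|[V rV Vx]]; first by left.
    by right; exists V => //; rewrite /f; case: asboolP.
  have [||s sP] := @compact_subcover _ (option (set Z)) C
    (fun o => if o is Some V then f V else F.1) Zcpt Ccl.2.
  - by case.
  - by move=> x /Cf[|[V _ fV]]; [exists None|exists (Some V)].
  pose s' := undup [seq V <- pmap id s | `[< rest V >]].
  have s'rest V : V \in s' -> rest V.
    by rewrite mem_undup mem_filter => /andP[/asboolP].
  have Cs : C `<=` F.1 `|` \big[setU/set0]_(V <- s') (V `\` F.1).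
    move=> x /sP[[V|] Vs]; last by left.
    rewrite /f; case: asboolP => [rV Vx|]; last by left.
    have [|nF1] := pselect (F.1 x); first by left.
    right; rewrite -bigcup_seq; exists V => //=.
    by rewrite mem_undup mem_filter mem_pmap map_id Vs andbT; apply/asboolP.
  rewrite -(outer_clopen cc Ccl); apply: le_trans (outer_mono cc Cs) _.
  apply: le_trans (outerU Zcpt clb cc _ _) _.
  rewrite (outer_open cc F1op) lerD2l.
  apply: le_trans (outer_bigcup_seq Zcpt clb cc _ _) _.
  have : sums (\sum_(V <- l ++ s') outer c (V `\` F.1)).
    exists (l ++ s') => //; split.
      rewrite cat_uniq ul undup_uniq andbT/=; apply/hasPn => V /s'rest[_].
      by [].
    by move=> V; rewrite mem_cat => /orP[/lF|/s'rest[]].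
  move=> /(sup_upper_bound sums_sup); rewrite big_cat/=; lra.
have [|B [Bcl BF hB]] := @inner_lt _ _ c cc F.1 (inner c F.1 - d); first lra.
have tol0 : 0 < d / (size l).+1%:R by rewrite divr_gt0.
have /choice[E EP] : forall V, exists E, V \in l ->
    [/\ clopen E, E `<=` V & inner c V - d / (size l).+1%:R < c E].
  move=> V; have [|E EP] := @inner_lt _ _ c cc V (inner c V - d / (size l).+1%:R).
    by rewrite ltrBlDr ltrDl.
  by exists E.
pose O := (Y `\` B) `|` \big[setU/set0]_(V <- l) (V `\` E V).
have F1Y : F.1 `<=` Y by move=> x; left.
exists O, l, (fun V => E V `\` B); split.
- apply: openU; first by apply: open_setD => //; case: Bcl.
  rewrite -bigcup_seq; apply: bigcup_open => V /= Vl.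
  by apply: open_setD; [have [] := F2 _ (lF _ Vl)|have [[]] := EP _ Vl].
- have Oop : open O.
    apply: openU; first by apply: open_setD => //; case: Bcl.
    rewrite -bigcup_seq; apply: bigcup_open => V /= Vl.
    by apply: open_setD; [have [] := F2 _ (lF _ Vl)|have [[]] := EP _ Vl].
  rewrite -(outer_open cc Oop); apply: le_trans (outerU Zcpt clb cc _ _) _.
  have YB : outer c (Y `\` B) <= d + d.
    rewrite (outer_setD Zcpt clb cc Yop Bcl.1 (subset_trans BF F1Y)).
    by rewrite (inner_clopen cc Bcl); lra.
  have : outer c (\big[setU/set0]_(V <- l) (V `\` E V)) <= d.
    apply: le_trans (outer_bigcup_seq Zcpt clb cc _ _) _.
    apply: (@le_trans _ _ (\sum_(V <- l) d / (size l).+1%:R)).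
      rewrite big_seq [leRHS]big_seq; apply: ler_sum => V Vl.
      have [Ecl EV hE] := EP _ Vl; have [Vop _] := F2 _ (lF _ Vl).
      rewrite (outer_setD Zcpt clb cc Vop Ecl.1 EV) (inner_clopen cc Ecl).
      by rewrite lerBlDr addrC -lerBlDr ltW.
    rewrite big_const_seq count_predT iter_addr_0 -[leLHS]mulr_natr mulrAC.
    by rewrite ler_pdivrMr ?ltr0n// ler_pM2l// ler_nat.
  by rewrite /d in YB *; lra.
- move=> V Vl; split; first exact: lF.
  have [[? ?] _ _] := EP _ Vl; have [? ?] := Bcl; rewrite setDE; split.
    by apply: openI => //; exact: closed_openC.
  by apply: closedI => //; exact: open_closedC.
- move=> V x FV nO; split.
    move=> [Vx nF]; have [Vl|Vl] := boolP (V \in l).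
      split=> //; split; last by move=> /BF.
      apply: contrapT => nE; apply: nO; right; rewrite -bigcup_seq.
      by exists V.
    by exfalso; apply: nO; left; split; [right; exists V|move=> /BF].
  move=> [Vl [EVx nB]]; have [_ EV _] := EP _ Vl; split; first exact: EV.
  by move=> F1x; apply: nO; left; split=> //; left.
Qed.

End sunflower.

Lemma sum_geometric_le (R : realType) (I : countType) (s : seq I) : uniq s ->
  \sum_(i <- s) (2 ^- (pickle i).+1 : R) <= 1.
Proof.
move=> us; rewrite -(big_map pickle xpredT (fun n => 2 ^- n.+1 : R)).
set l := map _ _; have ul : uniq l by rewrite map_inj_uniq//; exact: pcan_inj pickleK.
have geom n : \sum_(0 <= t < n) (2 ^- t.+1 : R) = 1 - 2 ^- n.
  elim: n => [|n IHn]; first by rewrite big_geq// expr0 invr1 subrr.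
  by rewrite big_nat_recr//= IHn exprS invfM; move: (2 ^+ n)^-1 => z; lra.
pose n := (\max_(t <- l) t).+1.
have ps : perm_eq l [seq t <- index_iota 0 n | t \in l].
  apply: uniq_perm; rewrite ?filter_uniq ?iota_uniq// => t.
  rewrite mem_filter; case: (boolP (t \in l)) => //= tl.
  by rewrite mem_index_iota/= ltnS leq_bigmax_seq.
rewrite (perm_big _ ps) big_filter big_mkcond/=.
apply: (@le_trans _ _ (\sum_(0 <= t < n) (2 ^- t.+1 : R))).
  by apply: ler_sum => t _; case: ifP => // _; rewrite invr_ge0 exprn_ge0.
by rewrite geom gerBl invr_ge0 exprn_ge0.
Qed.

(** * Contents are determined by separating petals *)

Section separation.
Variables (R : realType) (Z : topologicalType).
Hypothesis Zcpt : compact [set: Z].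
Hypothesis clb : clopen_base Z.
Variable F : nat -> set Z * set (set Z).
Hypothesis F_sun : forall t, sunflower (F t).

Definition section_of_petal (D : set Z) := exists t V, (F t).2 V /\ D = V `\` (F t).1.

Hypothesis petalI : forall D E, section_of_petal D -> section_of_petal E ->
  section_of_petal (D `&` E).
Hypothesis petal_sep : forall x y, x <> y ->
  exists D, section_of_petal D /\ ~ (D x <-> D y).

Variables c d : set Z -> R.
Hypothesis cc : clopen_content c.
Hypothesis dc : clopen_content d.
Hypothesis cdT : c setT = d setT.
Hypothesis cd_petal : forall D, section_of_petal D -> outer c D = outer d D.

Let clT : clopen [set: Z].
Proof. by split; [exact: openT|exact: closedT]. Qed.

Let split_petal (e : set Z -> R) D X : clopen_content e -> section_of_petal D ->
  outer e X = outer e (X `&` D) + outer e (X `\` D).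
Proof.
move=> ec [t [V [FV ->]]]; have [F1op F2 _] := F_sun t; have [Vop F1V] := F2 _ FV.
exact: outer_split.
Qed.

(* [P] is an atom of the finite algebra generated by the petals treated so far. *)
Let split_estimate (C O P : set Z) (L : seq (set Z)) :
  (forall D, D \in L -> section_of_petal D) ->
  outer c P = outer d P ->
  (forall E, section_of_petal E -> outer c (E `&` P) = outer d (E `&` P)) ->
  (forall x y, C x -> ~ C y -> P x -> P y -> ~ O x -> ~ O y ->
    exists2 D, D \in L & ~ (D x <-> D y)) ->
  `|outer c (C `&` P) - outer d (C `&` P)| <= outer c (O `&` P) + outer d (O `&` P).
Proof.
elim: L P => [|D L IHL] P LP cdP cdE sep.
  (* With no petal left, all points of [P] outside [O] lie on the same side of [C]: up to [O], the
     set [C] contains all of [P] or misses it. *)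
  have [[x [[Cx Px] nOx]]|noC] := pselect (exists x, (C `&` P) x /\ ~ O x).
    have PC : P `<=` (C `&` P) `|` (O `&` P).
      move=> y Py; have [Oy|nOy] := pselect (O y); first by right.
      left; split=> //; apply: contrapT => nCy.
      by have [] := sep x y Cx nCy Px Py nOx nOy.
    have h (e : set Z -> R) : clopen_content e ->
        outer e (C `&` P) <= outer e P <= outer e (C `&` P) + outer e (O `&` P).
      move=> ec; rewrite outer_mono//=.
      by apply: le_trans (outer_mono ec PC) _; exact: outerU.
    have /andP[c1 c2] := h c cc; have /andP[d1 d2] := h d dc.
    have := outer_ge0 cc (O `&` P); have := outer_ge0 dc (O `&` P).
    by rewrite ler_norml; move: c1 c2 d1 d2; rewrite cdP => *; apply/andP; split; lra.
  have CPO : C `&` P `<=` O `&` P.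
    move=> x [Cx Px]; split=> //; apply: contrapT => nOx; apply: noC.
    by exists x.
  have := outer_mono cc CPO; have := outer_mono dc CPO.
  have := outer_ge0 cc (C `&` P); have := outer_ge0 dc (C `&` P).
  by rewrite ler_norml => *; apply/andP; split; lra.
have DS : section_of_petal D by apply: LP; rewrite mem_head.
have LS E : E \in L -> section_of_petal E by move=> EL; apply: LP; rewrite in_cons EL orbT.
have cdPD : outer c (P `&` D) = outer d (P `&` D) by rewrite setIC cdE.
have cdPnD : outer c (P `\` D) = outer d (P `\` D).
  by have := split_petal P cc DS; have := split_petal P dc DS; rewrite cdP cdPD; lra.
have cdED E : section_of_petal E -> outer c (E `&` (P `&` D)) = outer d (E `&` (P `&` D)).
  by move=> ES; rewrite [P `&` D]setIC setIA; apply: cdE; exact: petalI.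
have cdEnD E : section_of_petal E -> outer c (E `&` (P `\` D)) = outer d (E `&` (P `\` D)).
  move=> ES; have := split_petal (E `&` P) cc DS; have := split_petal (E `&` P) dc DS.
  by rewrite -!setIA -!setIDA cdE// cdED//; lra.
have h1 := IHL (P `&` D) LS cdPD cdED; have h2 := IHL (P `\` D) LS cdPnD cdEnD.
have {h1} := h1 _; have {h2} := h2 _.
move=> h2 h1.
have {}h1 : `|outer c (C `&` (P `&` D)) - outer d (C `&` (P `&` D))| <=
    outer c (O `&` (P `&` D)) + outer d (O `&` (P `&` D)).
  apply: h1 => x y Cx nCy [Px Dx] [Py Dy] nOx nOy.
  have [E + nE] := sep x y Cx nCy Px Py nOx nOy.
  by rewrite in_cons => /orP[/eqP ED|EL]; [exfalso; apply: nE; rewrite ED; split|exists E].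
have {}h2 : `|outer c (C `&` (P `\` D)) - outer d (C `&` (P `\` D))| <=
    outer c (O `&` (P `\` D)) + outer d (O `&` (P `\` D)).
  apply: h2 => x y Cx nCy [Px Dx] [Py Dy] nOx nOy.
  have [E + nE] := sep x y Cx nCy Px Py nOx nOy.
  by rewrite in_cons => /orP[/eqP ED|EL]; [exfalso; apply: nE; rewrite ED; split|exists E].
have sp (e : set Z -> R) X : clopen_content e ->
    outer e (X `&` P) = outer e (X `&` (P `&` D)) + outer e (X `&` (P `\` D)).
  by move=> ec; rewrite (split_petal (X `&` P) ec DS) setIA setIDA.
rewrite (sp c C cc) (sp d C dc) (sp c O cc) (sp d O dc).
by move: h1 h2; rewrite !ler_norml => /andP[? ?] /andP[? ?]; apply/andP; split; lra.
Qed.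

Let prod_compact : compact [set: Z * Z].
Proof. by rewrite -setXTT; exact: compact_setX. Qed.

Let fst_continuous : continuous (@fst Z Z).
Proof. by move=> x; exact: cvg_fst. Qed.

Let snd_continuous : continuous (@snd Z Z).
Proof. by move=> x; exact: cvg_snd. Qed.

Let open_rect (U V : set Z) : open U -> open V -> open (U `*` V : set (Z * Z)).
Proof.
move=> Uop Vop; have -> : U `*` V = fst @^-1` U `&` snd @^-1` V by [].
apply: openI.
  by move/continuousP: fst_continuous; exact.
by move/continuousP: snd_continuous; exact.
Qed.

Let closed_rect (U V : set Z) : closed U -> closed V -> closed (U `*` V : set (Z * Z)).
Proof.
move=> Ucl Vcl; have -> : U `*` V = fst @^-1` U `&` snd @^-1` V by [].
apply: closedI.
  by move/continuous_closedP: fst_continuous; exact.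
by move/continuous_closedP: snd_continuous; exact.
Qed.

(* Off an open set of small content, finitely many petals are clopen and
   separate [C] from its complement. *)
Lemma petals_determine_content (C : set Z) : clopen C -> c C = d C.
Proof.
move=> Ccl; apply/eqP; rewrite -subr_eq0 -normr_le0; apply/ler_addgt0Pr => eps eps0.
rewrite add0r.
have lc := contentD cc dc; pose e (X : set Z) := c X + d X.
(* The tolerances are summable with total at most [eps], since the finite list of sunflowers is
   known only after compactness has been applied. *)
pose tol t : R := eps / 2 ^+ t.+1.
have tol0 t : 0 < tol t by rewrite divr_gt0// exprn_gt0.
have /choice[ O OP] : forall t, exists O (l : seq (set Z)) (E : set Z -> set Z),
    [/\ open O, inner e O <= tol t,
    forall V, V \in l -> (F t).2 V /\ clopen (E V) &
    forall V x, (F t).2 V -> ~ O x -> (V `\` (F t).1) x <-> V \in l /\ E V x].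
  by move=> t; exact: sunflower_near_clopen.
have /choice[l lP] := OP; have /choice[E OlE] := lP.
(* Pairs that have a point in the small set [O t] or are separated by a clopen trace of a petal.
   These open sets cover the compact product of [C] with its complement. *)
pose G t : set (Z * Z) := (O t `*` setT) `|` (setT `*` O t) `|`
  \bigcup_(V in [set` l t]) ((E t V `*` ~` E t V) `|` (~` E t V `*` E t V)).
have Gop t : open (G t).
  have [Oop _ Ecl _] := OlE t; apply: openU; first apply: openU.
  - by apply: open_rect => //; exact: openT.
  - by apply: open_rect => //; exact: openT.
  - apply: bigcup_open => V /Ecl[_ [Eop Ecl']].
    by apply: openU; apply: open_rect => //; exact: closed_openC.
have [|||T TP] := @compact_subcover _ nat (C `*` ~` C) G prod_compact.
- by apply: closed_rect; [exact: Ccl.2|exact: open_closedC Ccl.1].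
- exact: Gop.
- move=> [x y] [/= Cx nCy].
  have [D [[t [V [FV ->]]] Dxy]] : exists D, section_of_petal D /\ ~ (D x <-> D y).
    by apply: petal_sep => xy; rewrite xy in Cx.
  exists t => //; have [_ _ _ Dl] := OlE t.
  have [Ox|nOx] := pselect (O t x); first by left; left.
  have [Oy|nOy] := pselect (O t y); first by left; right.
  right; have hx := Dl V x FV nOx; have hy := Dl V y FV nOy.
  have Vl : V \in l t by apply: contrapT => nVl; apply: Dxy; split=> [/hx[]|/hy[]].
  exists V => //=.
  have [Ex|nEx] := pselect (E t V x); have [Ey|nEy] := pselect (E t V y).
  + by exfalso; apply: Dxy; split=> _; [apply/hy|apply/hx].
  + by left.
  + by right.
  + by exfalso; apply: Dxy; split=> [/hx[]|/hy[]].
pose W := \big[setU/set0]_(t <- undup T) O t.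
pose L := flatten [seq [seq V `\` (F t).1 | V <- l t] | t <- T].
have LS D : D \in L -> section_of_petal D.
  move=> /flattenP[_ /mapP[t _ ->] /mapP[V Vl ->]]; exists t, V; split=> //.
  by have [_ _ /(_ _ Vl)[]] := OlE t.
have cdE0 D : section_of_petal D -> outer c (D `&` setT) = outer d (D `&` setT).
  by rewrite setIT; exact: cd_petal.
have := @split_estimate C W setT L LS.
rewrite !setIT !(outer_clopen _ clT)// !(outer_clopen _ Ccl)// => /(_ cdT).
move=> /(_ cdE0) h; apply: (le_trans (h _)).
  move=> x y Cx nCy _ _ nWx nWy.
  have notO z t : ~ W z -> t \in T -> ~ O t z.
    move=> nW tT Oz; apply: nW; rewrite /W -bigcup_seq; exists t => //=.
    by rewrite mem_undup.
  have [t tT] := TP (x, y) (conj Cx nCy).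
  move=> [[[Ox _]|[_ Oy]]|[V /= Vl EV]].
  - by exfalso; exact: notO Ox.
  - by exfalso; exact: notO Oy.
  - have [_ _ lF Dl] := OlE t; have [FV _] := lF _ Vl.
    have hx := Dl V x FV (notO x t nWx tT); have hy := Dl V y FV (notO y t nWy tT).
    exists (V `\` (F t).1).
      apply/flattenP; exists [seq V `\` (F t).1 | V <- l t].
        by apply/mapP; exists t.
      by apply/mapP; exists V.
    move=> xy; case: EV => -[/= h1 h2].
      by apply: h2; have /hy[] : (V `\` (F t).1) y by apply/xy/hx.
    by apply: h1; have /hx[] : (V `\` (F t).1) x by apply/xy/hy.
have Wop : open W.
  by rewrite /W -bigcup_seq; apply: bigcup_open => t _; have [] := OlE t.
rewrite !outer_open// -(innerD cc dc) -(outer_open lc Wop).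
apply: le_trans (outer_bigcup_seq Zcpt clb lc _ _) _.
apply: (@le_trans _ _ (eps * \sum_(t <- undup T) 2 ^- (pickle t).+1)).
  rewrite mulr_sumr; apply: ler_sum => t _; have [Oop + _ _] := OlE t.
  by rewrite (outer_open lc Oop).
by rewrite -[leRHS]mulr1 ler_pM2l// sum_geometric_le ?undup_uniq.
Qed.

End separation.

(** * Sunflowers from Gruenhage families *)

Section Gruenhage_sunflowers.
Variable Z : topologicalType.
Implicit Types (F : set Z * set (set Z)) (V W D E : set Z).

Definition petal_of F D := exists2 V, F.2 V & D = V `\` F.1.

(** With the union of both kernels as kernel, the petals without kernel are exactly the
    intersections of those of [F1] with those of [F2]. *)
Definition meet_sunflower F1 F2 : set Z * set (set Z) :=
  (F1.1 `|` F2.1, [set W | exists V1 V2, [/\ F1.2 V1, F2.2 V2 &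
    W = (V1 `&` V2) `|` (F1.1 `|` F2.1)]]).

Let meet_petal (V1 V2 R1 R2 : set Z) :
  ((V1 `&` V2) `|` (R1 `|` R2)) `\` (R1 `|` R2) = (V1 `\` R1) `&` (V2 `\` R2).
Proof. by apply/seteqP; split=> x /=; tauto. Qed.

Lemma meet_sunflowerP F1 F2 : sunflower F1 -> sunflower F2 ->
  sunflower (meet_sunflower F1 F2).
Proof.
move=> [k1 p1 d1] [k2 p2 d2]; split.
- exact: openU.
- move=> _ [V1 [V2 [FV1 FV2 ->]]]; split; last exact: subsetUr.
  by apply: openU; [apply: openI; [exact: (p1 _ FV1).1|exact: (p2 _ FV2).1]|exact: openU].
- move=> _ _ [V1 [V2 [FV1 FV2 ->]]] [W1 [W2 [FW1 FW2 ->]]] neq x [[[V1x V2x]|//] [[W1x W2x]|//]].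
  have [V1W1|n1] := pselect (V1 = W1); last by left; exact: (d1 _ _ FV1 FW1 n1).
  have [V2W2|n2] := pselect (V2 = W2); last by right; exact: (d2 _ _ FV2 FW2 n2).
  by exfalso; apply: neq; rewrite V1W1 V2W2.
Qed.

Lemma petal_meet F1 F2 D1 D2 : petal_of F1 D1 -> petal_of F2 D2 ->
  petal_of (meet_sunflower F1 F2) (D1 `&` D2).
Proof.
move=> [V1 FV1 ->] [V2 FV2 ->]; exists ((V1 `&` V2) `|` (F1.1 `|` F2.1)).
  by exists V1, V2.
by rewrite meet_petal.
Qed.

Let unit_sunflower : set Z * set (set Z) := (set0, [set setT]).

Let unit_sunflowerP : sunflower unit_sunflower.
Proof.
split; first exact: open0.
- by move=> _ ->; split; [exact: openT|exact: sub0set].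
- by move=> _ _ -> -> /(_ erefl).
Qed.

Section closure_under_meets.
Variables (I : countType) (B : I -> set Z * set (set Z)).
Hypothesis B_sun : forall i, sunflower (B i).

Let meets (s : seq I) := foldr (fun i => meet_sunflower (B i)) unit_sunflower s.

Let meetsP s : sunflower (meets s).
Proof. by elim: s => [|i s IHs] /=; [exact: unit_sunflowerP|exact: meet_sunflowerP]. Qed.

Let petal_cat s t D E : petal_of (meets s) D -> petal_of (meets t) E ->
  petal_of (meets (s ++ t)) (D `&` E).
Proof.
elim: s D => [|i s IHs] D /=; first by move=> [_ -> ->]; rewrite setD0 setTI.
move=> [_ [V1 [V2 [FV1 FV2 ->]]] ->] tE; rewrite /= meet_petal -setIA.
by apply: petal_meet; [exists V1|apply: IHs => //; exists V2].
Qed.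

(** Finite lists over a countable index are countable, and concatenation of lists realises
    intersection of petals. *)
Lemma sunflowers_closed_meet : exists F : nat -> set Z * set (set Z),
  [/\ forall t, sunflower (F t),
      forall D E, (exists t, petal_of (F t) D) -> (exists t, petal_of (F t) E) ->
        exists t, petal_of (F t) (D `&` E) &
      forall i D, petal_of (B i) D -> exists t, petal_of (F t) D].
Proof.
pose F t := if (unpickle t : option (seq I)) is Some s then meets s else unit_sunflower.
have Fs s : F (pickle s) = meets s by rewrite /F pickleK.
exists F; split.
- by move=> t; rewrite /F; case: unpickle => [s|]; [exact: meetsP|exact: unit_sunflowerP].
- have toS D : (exists t, petal_of (F t) D) -> exists s, petal_of (meets s) D.
    by move=> [t]; rewrite /F; case: unpickle => [s|] FD; [exists s|exists [::]].
  move=> D E /toS[s sD] /toS[t tE]; exists (pickle (s ++ t)); rewrite Fs.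
  exact: petal_cat.
- move=> i D BD; exists (pickle [:: i]); rewrite Fs -[D]setIT.
  by apply: petal_meet => //; exists setT; rewrite // setD0.
Qed.

End closure_under_meets.

Variable U : nat -> set (set Z).
Hypothesis Uop : forall n V, U n V -> open V.

(** The points of order at least [k] in the family [U n]. *)
Let multi n k : set Z := [set x | exists l : seq (set Z),
  [/\ uniq l, size l = k & forall V, V \in l -> U n V /\ V x]].

Let multi_open n k : open (multi n k).
Proof.
have -> : multi n k = \bigcup_(l in [set l : seq (set Z) | [/\ uniq l, size l = k &
    forall V, V \in l -> U n V]]) \big[setI/setT]_(V <- l) V.
  apply/seteqP; split=> x.
    move=> [l [ul sl lU]]; exists l; first by split=> // V /lU[].
    by rewrite -bigcap_seq => V /lU[].
  move=> [l [ul sl lU]]; rewrite -bigcap_seq => lx; exists l; split=> // V Vl.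
  by split; [exact: lU|exact: lx].
apply: bigcup_open => l [_ _ lU]; elim: l lU => [|V l IHl] lU.
  by rewrite big_nil; exact: openT.
rewrite big_cons; apply: openI; first by apply: (Uop (n := n)); apply: lU; rewrite mem_head.
by apply: IHl => W Wl; apply: lU; rewrite in_cons Wl orbT.
Qed.

(** Petals come from the [k]-element subfamilies of [U n]: a point common to two different ones lies
    in at least [k+1] members, hence in the kernel. *)
Let level n k : set Z * set (set Z) := (multi n k.+1,
  [set W | exists l : seq (set Z), [/\ uniq l, size l = k, forall V, V \in l -> U n V &
    W = (\bigcap_(V in [set` l]) V) `|` multi n k.+1]]).

Let levelP n k : sunflower (level n k).
Proof.
split; first exact: multi_open.
- move=> _ [l [ul sl lU ->]]; split; last exact: subsetUr.
  apply: openU; last exact: multi_open.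
  rewrite bigcap_seq; elim: l lU {ul sl} => [|V l IHl] lU.
    by rewrite big_nil; exact: openT.
  rewrite big_cons; apply: openI; first by apply: (Uop (n := n)); apply: lU; rewrite mem_head.
  by apply: IHl => W Wl; apply: lU; rewrite in_cons Wl orbT.
- move=> _ _ [l [ul sl lU ->]] [l' [ul' sl' lU' ->]] neq x [[lx|//] [lx'|//]].
  have [[W [Wl' Wl]]|h] := pselect (exists W, W \in l' /\ W \notin l).
    exists (W :: l); split; rewrite /= ?Wl ?sl// => V; rewrite in_cons => /orP[/eqP->|Vl].
      by split; [exact: lU'|exact: lx'].
    by split; [exact: lU|exact: lx].
  have l'l : {subset l' <= l}.
    by move=> W Wl'; apply: contrapT => /negP Wl; apply: h; exists W.
  have [|_ eql] := uniq_min_size ul' l'l; first by rewrite sl sl'.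
  exfalso; apply: neq; congr (_ `|` _).
  by apply/seteqP; split=> y yl V /=; [rewrite eql|rewrite -eql]; exact: yl.
Qed.

(** A sunflower with one petal and empty kernel, which turns [multi n k] itself into a petal. *)
Let kernel n k : set Z * set (set Z) := (set0, [set multi n k]).

Let kernelP n k : sunflower (kernel n k).
Proof.
split; first exact: open0.
- by move=> _ ->; split; [exact: multi_open|exact: sub0set].
- by move=> _ _ -> -> /(_ erefl).
Qed.

Hypothesis U_sep : forall x y : Z, x <> y -> exists n V,
  [/\ U n V, exists z, V `&` [set x; y] = [set z] &
      finite_set [set W | U n W /\ W x] \/ finite_set [set W | U n W /\ W y]].

Let base (i : nat * nat * bool) := let: (n, k, b) := i in if b then level n k else kernel n k.

(** Let [k] be the finite order of [x]. If [y] has larger order, [multi n k.+1] separates the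
    points. Otherwise the petal of the members around [x] does: a [y] in it would lie in exactly
    these members, against the choice of [V]. *)
Let base_sep_fin x y n V : U n V -> ~ (V x <-> V y) ->
  finite_set [set W | U n W /\ W x] -> exists i D, petal_of (base i) D /\ ~ (D x <-> D y).
Proof.
move=> UV Vxy /finite_seqP[l0 l0E]; pose l := undup l0.
have lE W : W \in l <-> U n W /\ W x.
  have : [set W | U n W /\ W x] W <-> [set` l0] W by rewrite l0E.
  by rewrite mem_undup /=; tauto.
have ul : uniq l by rewrite undup_uniq.
have nGx : ~ multi n (size l).+1 x.
  move=> [l' [ul' sl' l'U]]; have : {subset l' <= l} by move=> W /l'U/lE.
  by move=> /(uniq_leq_size ul'); rewrite sl' ltnn.
have [Gy|nGy] := pselect (multi n (size l).+1 y).
  exists (n, (size l).+1, false), (multi n (size l).+1); split.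
    by exists (multi n (size l).+1); rewrite //= setD0.
  by move=> [_ /(_ Gy)].
exists (n, size l, true), (\bigcap_(V in [set` l]) V `\` multi n (size l).+1); split.
  exists ((\bigcap_(V in [set` l]) V) `|` multi n (size l).+1).
    by exists l; split=> // W /lE[].
  by apply/seteqP; split=> z /=; tauto.
move=> [h _]; have [|ly _] := h; first by split=> // W /lE[].
apply: Vxy; split=> [Vx|Vy].
  by apply: ly; apply/lE.
apply: contrapT => nVx; apply: nGy; exists (V :: l); split=> //=.
  by rewrite ul andbT; apply/negP => /lE[].
move=> W; rewrite in_cons => /orP[/eqP-> //|Wl]; split; last exact: ly.
by have /lE[] := Wl.
Qed.

Lemma Gruenhage_sunflowers : exists F : nat -> set Z * set (set Z),
  [/\ forall t, sunflower (F t),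
      forall D E, section_of_petal F D -> section_of_petal F E ->
        section_of_petal F (D `&` E) &
      forall x y, x <> y -> exists D, section_of_petal F D /\ ~ (D x <-> D y)].
Proof.
have base_sun i : sunflower (base i).
  by move: i => [[n k] []]; [exact: levelP|exact: kernelP].
have [F [Fsun FI Fbase]] := sunflowers_closed_meet base_sun.
have secE D : section_of_petal F D <-> exists t, petal_of (F t) D.
  by split=> [[t [V [FV ->]]]|[t [V FV ->]]]; [exists t, V|exists t, V].
exists F; split=> //.
  by move=> D E /secE sD /secE sE; apply/secE; exact: FI.
move=> x y xy; have [n [V [UV [z Vz] fin]]] := U_sep xy.
have Vxy : ~ (V x <-> V y).
  have : (V `&` [set x; y]) z by rewrite Vz.
  move=> [Vz' zxy] [h1 h2].
  have Vx : V x by case: zxy => [<-//|zy]; apply: h2; rewrite -zy.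
  have Vy := h1 Vx.
  have : [set z] x by rewrite -Vz; split=> //; left.
  have : [set z] y by rewrite -Vz; split=> //; right.
  by move=> /= yz xz; apply: xy; rewrite xz.
have [i [D [BD Dxy]]] : exists i D, petal_of (base i) D /\ ~ (D x <-> D y).
  case: fin => fin; first exact: base_sep_fin UV Vxy fin.
  have [|i [D [BD Dyx]]] := @base_sep_fin y x n V UV _ fin; first by move=> [h1 h2]; apply: Vxy; split.
  by exists i, D; split=> // -[h1 h2]; apply: Dyx; split.
by exists D; split=> //; apply/secE; exact: Fbase BD.
Qed.

End Gruenhage_sunflowers.

(** * Renorming *)

Section strictly_convex_dual_norm.
Variables (R : realType) (X : normedModType R) (Y : lmodType R) (T : X -> Y).
Hypothesis T_lin : linear T.
Variables (P : set Y) (J : eqType) (w : J -> R) (B : J -> set Y).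
Hypothesis w_gt0 : forall j, 0 < w j.
Hypothesis B0 : forall j, B j !=set0.
Hypothesis BP : forall j y, B j y -> P y.

(* The admissible functionals form a convex set described by countably many
   quadratic constraints. *)
Definition admissible (m : Y -> R) := [/\ scalar m, forall y, P y -> 0 <= m y &
  forall (s : seq J) (b : J -> Y), uniq s -> (forall j, B j (b j)) ->
    \sum_(j <- s) w j * m (b j) ^+ 2 <= 1].

Hypothesis adm_bounded : forall y, exists M, forall m, admissible m -> m y <= M.
Variables C c : R.
Hypothesis C_gt0 : 0 < C.
Hypothesis c_gt0 : 0 < c.
Hypothesis adm_upper : forall m x, admissible m -> m (T x) <= C * `|x|.
Hypothesis adm_lower : forall x r, r < c * `|x| -> 0 < `|x| ->
  exists2 m, admissible m & r < m (T x).
Hypothesis adm_flip : forall m, admissible m ->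
  exists2 m', admissible m' & forall x, m' (T x) = - m (T x).

Let sups (m : Y -> R) (j : J) : R := sup [set m y | y in B j].

Variable D : set X.
Hypothesis adm_separated : forall m1 m2, admissible m1 -> admissible m2 ->
  (forall j, sups m1 j = sups m2 j /\
     sups (fun y => m1 y + m2 y) j = sups m1 j + sups m2 j) ->
  forall x, D x -> m1 (T x) = m2 (T x).
Hypothesis D_total : forall f g : X -> R, scalar f -> scalar g ->
  (exists M, forall x, `|f x| <= M * `|x|) -> (exists M, forall x, `|g x| <= M * `|x|) ->
  (forall x, D x -> f x = g x) -> f = g.

Let adm0 : admissible (fun=> 0).
Proof.
split=> // [a x y|s b _ _]; first by rewrite mulr0 addr0.
by rewrite big1// => j _; rewrite expr0n/= mulr0.
Qed.

Let p (y : Y) : R := sup [set m y | m in admissible].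

Let p_sup y : has_sup [set m y | m in admissible].
Proof.
split; first by exists 0, (fun=> 0).
by have [M MP] := adm_bounded y; exists M => _ [m am <-]; exact: MP.
Qed.

Let p_ub m y : admissible m -> m y <= p y.
Proof. by move=> am; apply: (sup_upper_bound (p_sup y)); exists m. Qed.

Let p_le y r : (forall m, admissible m -> m y <= r) -> p y <= r.
Proof. by move=> h; apply: ge_sup; [exact: (p_sup y).1|move=> _ [m am <-]; exact: h]. Qed.

Let p_sublinear : sublinear p.
Proof.
split=> [x y|t x t0].
  apply: p_le => m am; have [ml _ _] := am; rewrite (scalar_funD ml).
  by rewrite lerD// p_ub.
have le (u : R) y : 0 < u -> p (u *: y) <= u * p y.
  move=> u0; apply: p_le => m am; have [ml _ _] := am; rewrite (scalar_funZ ml).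
  by rewrite ler_pM2l// p_ub.
move: t0; rewrite le_eqVlt => /orP[/eqP<-|t0].
  rewrite mul0r scale0r; apply/eqP; rewrite eq_le (p_ub _ adm0) andbT.
  by apply: p_le => m [ml _ _]; rewrite (scalar_fun0 ml).
apply/eqP; rewrite eq_le le//=.
have := le t^-1 (t *: x); rewrite invr_gt0 => /(_ t0).
by rewrite scalerA mulVf ?gt_eqF// scale1r ler_pdivlMl.
Qed.

Let TD x y : T (x + y) = T x + T y.
Proof. by have := T_lin 1 x y; rewrite !scale1r. Qed.

Let T0 : T 0 = 0.
Proof. by apply: (addrI (T 0)); rewrite -TD !addr0. Qed.

Let TZ a x : T (a *: x) = a *: T x.
Proof. by have := T_lin a x 0; rewrite T0 !addr0. Qed.

Let N x := p (T x).

Let NN x : N (- x) = N x.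
Proof.
have le y : N (- y) <= N y.
  apply: p_le => m am; have [ml _ _] := am; have [m' am' m'E] := adm_flip am.
  rewrite -scaleN1r TZ (scalar_funZ ml) mulN1r -m'E; exact: p_ub.
by apply/eqP; rewrite eq_le le/= -{1}(opprK x) le.
Qed.

Let N_lower x : c * `|x| <= N x.
Proof.
have [x0|x0] := leP `|x| 0.
  have -> : `|x| = 0 by apply/eqP; rewrite eq_le x0 normr_ge0.
  by rewrite mulr0; exact: p_ub adm0.
rewrite leNgt; apply/negP => /adm_lower/(_ x0)[m am].
by rewrite ltNge p_ub.
Qed.

Let N_equiv : equivalent_norm N.
Proof.
have [pD pZ] := p_sublinear; split; last first.
  exists c, C; split=> // x; rewrite N_lower/=; apply: p_le => m; exact: adm_upper.
split=> [x y|a x|x Nx0].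
- by rewrite /N TD; exact: pD.
- have [a0|a0] := leP 0 a; first by rewrite /N TZ pZ// ger0_norm.
  rewrite -NN -scaleNr /N TZ pZ ?oppr_ge0 ?ltW// ltr0_norm//.
- have := N_lower x; rewrite Nx0 pmulr_rle0// normr_le0 => /eqP //.
Qed.

(** Any linear [m] below [p] is admissible: positivity is read off from [p (- y) <= 0], and the
    quadratic constraint from evaluating [m] at the combination of the [b j] with coefficients
    [w j * m (b j)], where [m] takes the value to be bounded. *)
Let dual_adm f (d : R) : dual N f -> 0 < d -> dual_norm N f <= d ->
  exists2 m, admissible m & forall x, f x = d * m (T x).
Proof.
move=> df d0 fd; have [N_norm _] := N_equiv; have [fl _] := df.
have fdl : scalar (fun x => d^-1 * f x).
  by move=> a x y; rewrite fl mulrDr mulrCA.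
have fp x : d^-1 * f x <= p (T x).
  rewrite ler_pdivrMl//; apply: le_trans (ler_norm _) _.
  apply: le_trans (dual_norm_bound N_norm x df) _.
  by rewrite ler_wpM2r//; exact: is_norm_ge0.
have [m [ml mp mT]] := hahn_banach T_lin fdl p_sublinear fp.
exists m; last by move=> x; rewrite mT mulrA mulfV ?gt_eqF// mul1r.
split=> // [y Py|s b us Bb].
  rewrite -oppr_le0 -mulN1r -(scalar_funZ ml) scaleN1r; apply: le_trans (mp _) _.
  apply: p_le => m' [m'l m'P _]; rewrite -scaleN1r (scalar_funZ m'l) mulN1r oppr_le0.
  exact: m'P.
have sumE (m' : Y -> R) : scalar m' -> m' (\sum_(j <- s) (w j * m (b j)) *: b j) =
    \sum_(j <- s) w j * m (b j) * m' (b j).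
  move=> m'l; elim: s {us} => [|j s IHs]; first by rewrite !big_nil (scalar_fun0 m'l).
  by rewrite !big_cons (scalar_funD m'l) (scalar_funZ m'l) IHs.
have := mp (\sum_(j <- s) (w j * m (b j)) *: b j); rewrite (sumE _ ml).
(* AM-GM: [m y * m' y <= (m y ^ 2 + m' y ^ 2) / 2] *)
have : p (\sum_(j <- s) (w j * m (b j)) *: b j) <=
    2^-1 * (\sum_(j <- s) w j * m (b j) ^+ 2 + 1).
  apply: p_le => m' am'; have [m'l _ m'1] := am'; rewrite (sumE _ m'l).
  apply: (@le_trans _ _ (\sum_(j <- s) 2^-1 * (w j * m (b j) ^+ 2 + w j * m' (b j) ^+ 2))).
    apply: ler_sum => j _; rewrite -mulrDr mulrCA -mulrA (ler_pM2l (w_gt0 j)).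
    by have := sqr_ge0 (m (b j) - m' (b j)); rewrite !expr2; lra.
  rewrite -mulr_sumr big_split/= ler_pM2l ?invr_gt0// lerD2l.
  exact: m'1.
have -> : \sum_(j <- s) w j * m (b j) * m (b j) = \sum_(j <- s) w j * m (b j) ^+ 2.
  by apply: eq_bigr => j _; rewrite expr2 mulrA.
by lra.
Qed.

Let B_sup m j : admissible m -> has_sup [set m y | y in B j].
Proof.
move=> [ml mP m1]; split; first by have [y By] := B0 j; exists (m y), y.
exists (1 + (w j)^-1) => _ [y By <-].
have /choice[b bP] : forall i, exists y, B i y by [].
pose b' i := if i == j then y else b i.
have /(m1 [:: j] b' isT) : forall i, B i (b' i).
  by move=> i; rewrite /b'; case: eqP => // ->.
rewrite big_seq1 /b' eqxx -ler_pdivlMl// mulr1 => h.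
have := sqr_ge0 (m y); have := sqr_ge0 (m y - 1); rewrite !expr2 in h *; lra.
Qed.

Let sups_ub m j y : admissible m -> B j y -> m y <= sups m j.
Proof. by move=> am By; apply: (sup_upper_bound (B_sup j am)); exists y. Qed.

Let sups_ge0 m j : admissible m -> 0 <= sups m j.
Proof.
move=> am; have [y By] := B0 j; apply: le_trans (sups_ub am By).
by case: am => _ mP _; apply: mP; exact: BP By.
Qed.

Let sups_sqr_lt m j r : admissible m -> r < sups m j ^+ 2 ->
  exists2 y, B j y & r < m y ^+ 2.
Proof.
move=> am rs; have [r0|r0] := ltP r 0.
  by have [y By] := B0 j; exists y => //; exact: lt_le_trans (sqr_ge0 _).
pose q := Num.sqrt r; have rE : r = q ^+ 2 by rewrite sqr_sqrtr.
have q0 : 0 <= q := sqrtr_ge0 r.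
move: rs; rewrite rE ltr_pXn2r ?nnegrE ?sups_ge0// => qs.
have [|_ [y By <-]] := sup_adherent (eps := sups m j - q) _ (B_sup j am).
  by rewrite subr_gt0.
rewrite subKr => qy; exists y => //.
by rewrite ltr_pXn2r ?nnegrE// ltW// (le_lt_trans q0).
Qed.

(* If the suprema over some test set [B j] do not agree, the midpoint of two
   admissible functionals satisfies all the constraints with some room. *)
Let midpoint_room m1 m2 j0 : admissible m1 -> admissible m2 ->
  ~ (sups m1 j0 = sups m2 j0 /\
     sups (fun y => m1 y + m2 y) j0 = sups m1 j0 + sups m2 j0) ->
  exists2 k, 0 < k & forall (s : seq J) (b : J -> Y), uniq s -> (forall j, B j (b j)) ->
    \sum_(j <- s) w j * (2^-1 * (m1 (b j) + m2 (b j))) ^+ 2 <= 1 - k.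
Proof.
move=> am1 am2 neq; have [m1l m1P m11] := am1; have [m2l m2P m21] := am2.
set a := sups m1 j0 in neq; set b0 := sups m2 j0 in neq.
set g := sups (fun y => m1 y + m2 y) j0 in neq.
have a0 : 0 <= a by exact: sups_ge0.
have b00 : 0 <= b0 by exact: sups_ge0.
have g_sup : has_sup [set m1 y + m2 y | y in B j0].
  split; first by have [y By] := B0 j0; exists (m1 y + m2 y), y.
  by exists (a + b0) => _ [y By <-]; rewrite lerD// sups_ub.
have g_ub y : B j0 y -> m1 y + m2 y <= g.
  by move=> By; apply: (sup_upper_bound g_sup); exists y.
have gab : g <= a + b0.
  apply: ge_sup; first exact: g_sup.1.
  by move=> _ [y By <-]; rewrite lerD// sups_ub.
have g0 : 0 <= g.
  have [y By] := B0 j0; apply: le_trans (g_ub y By).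
  by rewrite addr_ge0// ?m1P ?m2P//; exact: BP By.
(* The convexity defect at [j0]; it vanishes only if [a = b0] and [g = a + b0]. *)
pose k := 2^-1 * (a ^+ 2 + b0 ^+ 2) - (2^-1 * g) ^+ 2.
have k0 : 0 < k.
  rewrite ltNge; apply/negP; rewrite /k => k_le0; apply: neq.
  have ab : a = b0 by move: k_le0; rewrite !expr2; nra.
  by split=> //; move: k_le0 gab g0 a0; rewrite -ab !expr2; nra.
have k20 : 0 < k / 2 by rewrite divr_gt0.
have [|y1 By1 h1] := @sups_sqr_lt m1 j0 (a ^+ 2 - k / 2) am1.
  by rewrite ltrBlDr ltrDl.
have [|y2 By2 h2] := @sups_sqr_lt m2 j0 (b0 ^+ 2 - k / 2) am2.
  by rewrite ltrBlDr ltrDl.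
exists (w j0 * (k / 2)); first by rewrite mulr_gt0.
have main (s : seq J) (b : J -> Y) : uniq s -> j0 \in s -> (forall j, B j (b j)) ->
    \sum_(j <- s) w j * (2^-1 * (m1 (b j) + m2 (b j))) ^+ 2 <= 1 - w j0 * (k / 2).
  (* The constraint holds for every choice of test vectors, so at [j0] each functional may use its
     own almost optimal one. The two losses of [k / 2] leave half of the defect. *)
  move=> us js Bb; pose b1 i := if i == j0 then y1 else b i.
  pose b2 i := if i == j0 then y2 else b i.
  have Bb1 i : B i (b1 i) by rewrite /b1; case: eqP => // ->.
  have Bb2 i : B i (b2 i) by rewrite /b2; case: eqP => // ->.
  have := m11 s b1 us Bb1; have := m21 s b2 us Bb2.
  rewrite !(bigD1_seq j0 js us)/= /b1 /b2 eqxx.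
  have -> : \sum_(i <- s | i != j0) w i * m1 (if i == j0 then y1 else b i) ^+ 2 =
            \sum_(i <- s | i != j0) w i * m1 (b i) ^+ 2.
    by apply: eq_bigr => i /negbTE ->.
  have -> : \sum_(i <- s | i != j0) w i * m2 (if i == j0 then y2 else b i) ^+ 2 =
            \sum_(i <- s | i != j0) w i * m2 (b i) ^+ 2.
    by apply: eq_bigr => i /negbTE ->.
  have : \sum_(i <- s | i != j0) w i * (2^-1 * (m1 (b i) + m2 (b i))) ^+ 2 <=
         2^-1 * (\sum_(i <- s | i != j0) w i * m1 (b i) ^+ 2 +
                 \sum_(i <- s | i != j0) w i * m2 (b i) ^+ 2).
    rewrite -big_split/= mulr_sumr; apply: ler_sum => i _.
    rewrite -mulrDr [leRHS]mulrCA (ler_pM2l (w_gt0 i)).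
    by have := sqr_ge0 (m1 (b i) - m2 (b i)); rewrite !expr2; lra.
  have : w j0 * (2^-1 * (m1 (b j0) + m2 (b j0))) ^+ 2 <= w j0 * (2^-1 * g) ^+ 2.
    rewrite ler_pM2l// ler_pXn2r ?nnegrE ?mulr_ge0 ?invr_ge0 ?addr_ge0 ?m1P ?m2P//.
    - by rewrite ler_pM2l ?invr_gt0// g_ub.
    - exact: BP (Bb j0).
    - exact: BP (Bb j0).
  have e1 : w j0 * a ^+ 2 - w j0 * k / 2 <= w j0 * m1 y1 ^+ 2.
    by rewrite -[w j0 * k / 2]mulrA -mulrBr ler_pM2l// ltW.
  have e2 : w j0 * b0 ^+ 2 - w j0 * k / 2 <= w j0 * m2 y2 ^+ 2.
    by rewrite -[w j0 * k / 2]mulrA -mulrBr ler_pM2l// ltW.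
  have e3 : w j0 * (2^-1 * g) ^+ 2 =
      2^-1 * (w j0 * a ^+ 2 + w j0 * b0 ^+ 2) - w j0 * k.
    by rewrite -mulrDr [2^-1 * (_ * _)]mulrCA -mulrBr /k subKr.
  move: e1 e2 e3; rewrite [w j0 * (k / 2)]mulrA.
  move: (\sum_(i <- s | _) _) (\sum_(i <- s | _) _) (\sum_(i <- s | _) _).
  move: (w j0 * a ^+ 2) (w j0 * b0 ^+ 2) (w j0 * k) (w j0 * (2^-1 * g) ^+ 2).
  move: (w j0 * m1 y1 ^+ 2) (w j0 * m2 y2 ^+ 2).
  by move: (w j0 * (2^-1 * (m1 (b j0) + m2 (b j0))) ^+ 2) => *; lra.
move=> s b us Bb; have [js|js] := boolP (j0 \in s); first exact: main.
apply: le_trans (main (j0 :: s) b _ _ Bb); rewrite /= ?js ?us ?mem_head//.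
by rewrite big_cons lerDr mulr_ge0 ?sqr_ge0// ltW.
Qed.

Lemma strictly_convex_dual_norm : exists N : X -> R,
  equivalent_norm N /\ strictly_convex (dual N) (dual_norm N).
Proof.
exists N; split; first exact: N_equiv.
move=> f g df dg fg gE; have [N_norm [_ [_ [_ _ _]]]] := N_equiv.
set d := dual_norm N g in fg gE.
have [fl _] := df; have [gl _] := dg.
have bdd (h : X -> R) : dual N h -> exists M, forall x, `|h x| <= M * `|x|.
  move=> dh; exists (dual_norm N h * C) => x; apply: le_trans (dual_norm_bound N_norm x dh) _.
  rewrite -mulrA ler_wpM2l ?dual_norm_ge0//; apply: p_le => m; exact: adm_upper.
have [d0|d0] := leP d 0.
  have z (h : X -> R) : dual N h -> dual_norm N h <= 0 -> h = fun=> 0.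
    move=> dh h0; apply/funext => x; apply/eqP; rewrite -normr_le0.
    apply: le_trans (dual_norm_bound N_norm x dh) _.
    by rewrite mulr_le0_ge0//; exact: is_norm_ge0.
  have f0 : dual_norm N f <= 0 by rewrite fg.
  by rewrite (z f df f0) (z g dg d0).
have [m1 am1 m1E] : exists2 m, admissible m & forall x, f x = d * m (T x).
  by apply: dual_adm => //; rewrite fg.
have [m2 am2 m2E] : exists2 m, admissible m & forall x, g x = d * m (T x).
  exact: dual_adm.
have [m1l m1P _] := am1; have [m2l m2P _] := am2.
have eq_sups j : sups m1 j = sups m2 j /\
     sups (fun y => m1 y + m2 y) j = sups m1 j + sups m2 j.
  apply: contrapT => neq; have [k k0 kP] := midpoint_room am1 am2 neq.
  have k1 : k <= 1.
    have /choice[b bP] : forall i, exists y, B i y by [].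
    by have := kP [::] b isT bP; rewrite big_nil subr_ge0.
  (* For [0 < k <= 1] one has [l^2 (1 - k) <= 1], so the midpoint stays admissible after scaling by
     [l > 1]. The dual norm of [f + g] is then at most [2 d / l], against the assumed [2 d]. *)
  pose l := 1 + k / 4; have l1 : 1 < l by rewrite ltrDl divr_gt0.
  have l0 : 0 < l := lt_trans ltr01 l1.
  pose m y := l * (2^-1 * (m1 y + m2 y)).
  have am : admissible m.
    split=> [a x y|y Py|s b us Bb].
    - have e : m1 (a *: x + y) + m2 (a *: x + y) = a * (m1 x + m2 x) + (m1 y + m2 y).
        by rewrite m1l m2l addrACA mulrDr.
      rewrite /m e [2^-1 * _]mulrDr [l * (_ + _)]mulrDr; congr (_ + _).
      by rewrite [2^-1 * _]mulrCA; exact: mulrCA.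
    - apply: mulr_ge0; first exact: ltW.
      by apply: mulr_ge0; rewrite ?invr_ge0// addr_ge0// ?m1P ?m2P.
    - have -> : \sum_(i <- s) w i * m (b i) ^+ 2 =
          l ^+ 2 * \sum_(i <- s) w i * (2^-1 * (m1 (b i) + m2 (b i))) ^+ 2.
        by rewrite mulr_sumr; apply: eq_bigr => i _; rewrite /m exprMn mulrCA.
      apply: le_trans (ler_wpM2l (sqr_ge0 _) (kP s b us Bb)) _.
      by rewrite /l expr2; nra.
  have fgE x : (f + g) x = d * (2 * l^-1 * m (T x)).
    rewrite -[LHS]/(f x + g x) m1E m2E -mulrDr /m; congr (_ * _).
    by rewrite -mulrA mulKf ?gt_eqF// mulrA divff// mul1r.
  have : dual_norm N (f + g) <= d * (2 * l^-1).
    apply: dual_norm_le => // x Nx; rewrite fgE mulrA normrM gtr0_norm; last first.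
      by rewrite !mulr_gt0 ?invr_gt0.
    rewrite -[leRHS]mulr1 ler_pM2l; last by rewrite !mulr_gt0 ?invr_gt0.
    rewrite ler_norml; have h := p_ub (T x) am; rewrite (le_trans h)// andbT.
    rewrite lerNl; apply: le_trans Nx; rewrite -NN; apply: le_trans (p_ub (T (- x)) am).
    by case: am => ml _ _; rewrite -scaleN1r TZ (scalar_funZ ml) mulN1r.
  have li : l^-1 < 1 by rewrite invf_lt1.
  have : d * (2 * l^-1) < d * 2 by rewrite ltr_pM2l// gtr_pMr.
  by move: gE => /=; move: (dual_norm N (f + g)) => q; lra.
apply: D_total => //; [exact: bdd|exact: bdd|].
by move=> x Dx; rewrite m1E m2E (adm_separated am1 am2 eq_sups).
Qed.

End strictly_convex_dual_norm.

Section bounded_functions.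
Variables (R : realType) (Z : Type).

Definition bdd_pred : {pred Z -> R} :=
  [pred y | `[< exists M : R, forall z, `|y z| <= M >]].

Lemma bdd_submod_closed : submod_closed bdd_pred.
Proof.
split; first by apply/asboolP; exists 0 => z; rewrite normr0.
move=> a x y /asboolP[M xM] /asboolP[N yN]; apply/asboolP.
exists (`|a| * M + N) => z; apply: le_trans (ler_normD _ _) _.
by rewrite lerD// normrM ler_wpM2l.
Qed.

HB.instance Definition _ :=
  GRing.isSubmodClosed.Build _ _ bdd_pred bdd_submod_closed.

Definition bdd_fun := {y : Z -> R | y \in bdd_pred}.

HB.instance Definition _ := SubChoice.on bdd_fun.
HB.instance Definition _ := [SubChoice_isSubLmodule of bdd_fun by <:].

Lemma bdd_fun_linE (a : R) (y y' : bdd_fun) z : val (a *: y + y') z = a * val y z + val y' z.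
Proof. by []. Qed.

Lemma indic_bounded (C : set Z) : (fun z => `[< C z >]%:R) \in bdd_pred.
Proof. by apply/asboolP; exists 1 => z; rewrite normr_nat lern1 leq_b1. Qed.

Definition indic_fun (C : set Z) : bdd_fun :=
  exist (fun y => y \in bdd_pred) _ (indic_bounded C).

Lemma indic_funU (C D : set Z) : C `&` D = set0 ->
  indic_fun (C `|` D) = indic_fun C + indic_fun D.
Proof.
move=> CD; apply/val_inj/funext => z /=.
rewrite -[RHS]/(`[< C z >]%:R + `[< D z >]%:R).
have [Cz|nCz] := pselect (C z); have [Dz|nDz] := pselect (D z).
- by have : (C `&` D) z by []; rewrite CD.
- by rewrite (asboolT (or_introl Cz : (C `|` D) z)) (asboolT Cz) (asboolF nDz) addr0.
- by rewrite (asboolT (or_intror Dz : (C `|` D) z)) (asboolF nCz) (asboolT Dz) add0r.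
- by rewrite (asboolF nCz) (asboolF nDz) addr0 asboolF// => -[].
Qed.

End bounded_functions.

(** * Recovering values from their largest finite sums *)

Section top_sums.
Variables (R : realType) (I : choiceType) (P : set I) (v v' : I -> R) (r K : R).
Variables S S' S'' : nat -> R.
Hypothesis r_ge0 : 0 <= r.
Hypothesis rv : forall i, P i -> r <= v i.
Hypothesis rv' : forall i, P i -> r <= v' i.
Let sub (l : seq I) := uniq l /\ [set` l] `<=` P.
Hypothesis vK : forall l, sub l -> \sum_(i <- l) (v i - r) <= K.
Hypothesis v'K : forall l, sub l -> \sum_(i <- l) (v' i - r) <= K.
Hypothesis vS : forall k l, sub l -> (size l <= k)%N -> \sum_(i <- l) v i <= S k.
Hypothesis v'S : forall k l, sub l -> (size l <= k)%N -> \sum_(i <- l) v' i <= S' k.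
Hypothesis S''_le : forall k q, (forall l, sub l -> (size l <= k)%N ->
  \sum_(i <- l) (v i + v' i) <= q) -> S'' k <= q.
Hypothesis SS' : forall k, S k = S' k.
Hypothesis S''E : forall k, S'' k = S k + S' k.

Let W i := v i + v' i.

(* A set of indices on which [v + v'] takes its largest values realises both
   suprema [S] and [S']. *)
Let top_eq L t : sub L -> 0 <= t -> (forall i, i \in L -> t <= W i) ->
  (forall i, P i -> i \notin L -> W i <= t) ->
  \sum_(i <- L) v i = \sum_(i <- L) v' i.
Proof.
move=> sL t0 LW nLW.
have : S'' (size L) <= \sum_(i <- L) W i.
  apply: S''_le => l [ul lP] lL; rewrite -/(W _).
  have tE (s : seq I) : \sum_(i <- s) W i = \sum_(i <- s) (W i - t) + t * (size s)%:R.
    elim: s => [|a s IHs]; first by rewrite !big_nil mulr0 addr0.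
    by rewrite !big_cons IHs /= -natr1 mulrDr; lra.
  rewrite [leLHS]tE [leRHS]tE; apply: lerD; last by rewrite ler_wpM2l// ler_nat.
  apply: (@le_trans _ _ (\sum_(i <- l | i \in L) (W i - t))).
    rewrite [leLHS](bigID (fun i => i \in L))/= gerDl big_seq_cond.
    by apply: sumr_le0 => i /andP[/lP Pi iL]; rewrite subr_le0; exact: nLW.
  have ps : perm_eq [seq i <- l | i \in L] [seq i <- L | i \in l].
    apply: uniq_perm; rewrite ?filter_uniq//; first by case: sL.
    by move=> i; rewrite !mem_filter andbC.
  rewrite -big_filter (perm_big _ ps) big_filter.
  rewrite [leRHS](bigID (fun i => i \in l))/= lerDl big_seq_cond.
  by apply: sumr_ge0 => i /andP[/LW]; rewrite subr_ge0.
rewrite S''E big_split/=; have := vS sL (leqnn _); have := v'S sL (leqnn _).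
by have := SS' (size L); lra.
Qed.

(** Above the level [t = W i] there are only finitely many indices. By [top_eq] the sums of [v] and
    [v'] agree over these, and also after adding [i]; the difference is the claim. *)
Lemma top_sums_determine i : P i -> v i = v' i.
Proof.
move=> Pi; apply: contrapT => neq; pose t := W i.
(* Both values are at least [r], so unequal values push [t] strictly above [2 r]. The bound [K] on
   the excess over [r] then makes the indices above [t] finite in number. *)
have t2r : 0 < t - (r + r).
  move/eqP: neq; rewrite neq_lt /t /W => /orP[] *;
    by have := rv Pi; have := rv' Pi; lra.
have K0 : 0 <= K by have := @vK [::]; rewrite big_nil; apply.
pose big l := sub l /\ forall j, j \in l -> t < W j.
have [n nP] : exists n : nat, forall l, big l -> (size l <= n)%N.
  have d0 : 0 < (t - (r + r)) / (K + K + 1) by rewrite divr_gt0// ltr_wpDl// addr_ge0.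
  have [n _ nP] := near_infty_natSinv_lt (PosNum d0).
  exists n.+1 => l [sl lt]; rewrite leqNgt; apply/negP => nl.
  have := nP n (leqnn n) => /=; rewrite ltNge => /negP; apply.
  rewrite ler_pdivrMr ?ltr_wpDl ?addr_ge0// ler_pdivlMl ?ltr0n//.
  have : \sum_(j <- l) (t - (r + r)) <= \sum_(j <- l) (W j - (r + r)).
    by rewrite big_seq [leRHS]big_seq; apply: ler_sum => j /lt/ltW; rewrite lerD2r.
  have -> : \sum_(j <- l) (W j - (r + r)) = \sum_(j <- l) (v j - r) + \sum_(j <- l) (v' j - r).
    by rewrite -big_split/=; apply: eq_bigr => j _; rewrite /W; lra.
  rewrite big_const_seq count_predT iter_addr_0 -[leLHS]mulr_natl.
  have := vK sl; have := v'K sl.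
  have : n.+1%:R * (t - (r + r)) <= (size l)%:R * (t - (r + r)).
    by rewrite ler_pM2r// ler_nat ltnW.
  lra.
pose hasn k := `[< exists l, big l /\ size l = k >].
have ex0 : exists k, hasn k by exists 0%N; apply/asboolP; exists [::].
have le_n k : hasn k -> (k <= n)%N by move=> /asboolP[l [/nP + <-]].
case: (ex_maxnP ex0 le_n) => k /asboolP[l [[sl lt] lk]] kmax.
have lall j : P j -> t < W j -> j \in l.
  move=> Pj tj; apply: contrapT => /negP jl.
  have : hasn k.+1.
    apply/asboolP; exists (j :: l); rewrite /= lk; split=> //; split.
      split=> /=; first by rewrite jl; case: sl.
      by move=> j'; rewrite /= in_cons => /orP[/eqP->//|]; case: sl => _; apply.
    by move=> j'; rewrite in_cons => /orP[/eqP->//|]; exact: lt.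
  by move=> /kmax; rewrite ltnn.
have t0 : 0 <= t by move: t2r r_ge0; lra.
have il : i \notin l by apply/negP => /lt; rewrite ltxx.
have e1 := top_eq sl t0 (fun j jl => ltW (lt j jl)).
have e2 := @top_eq (i :: l) t.
have {}e1 : \sum_(j <- l) v j = \sum_(j <- l) v' j.
  by apply: e1 => j Pj jl; rewrite leNgt; apply/negP => /(lall _ Pj); exact/negP.
have : \sum_(j <- i :: l) v j = \sum_(j <- i :: l) v' j.
  apply: e2 => //.
  - split; first by rewrite /= il; case: sl.
    by move=> j; rewrite /= in_cons => /orP[/eqP->//|]; case: sl => _; apply.
  - by move=> j; rewrite in_cons => /orP[/eqP->//|/lt/ltW].
  - move=> j Pj; rewrite in_cons negb_or => /andP[_ jl]; rewrite leNgt.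
    by apply/negP => /(lall _ Pj); exact/negP.
rewrite !big_cons e1 => /addIr; exact: neq.
Qed.

End top_sums.

(** * The norm for a Gruenhage compact space *)

Section Gruenhage_renorming.
Variables (R : realType) (Gamma : choiceType) (A : set (set Gamma)).
Hypothesis hA : adequate A.
Local Notation X := (h_space R hA).
Local Notation Z := (set_type (K A)).
Local Notation bfun := (bdd_fun R Z).
Local Notation Y := (bfun * bfun)%type.
Hypothesis Z_Gruenhage : Gruenhage_space Z.

Let Zcpt : compact [set: Z] := K_compact hA.
Let clb : clopen_base Z := @K_clopen_base Gamma A.

Let Fex : exists F : nat -> set Z * set (set Z),
  [/\ forall t, sunflower (F t),
      forall D E, section_of_petal F D -> section_of_petal F E ->
        section_of_petal F (D `&` E) &
      forall x y, x <> y -> exists D, section_of_petal F D /\ ~ (D x <-> D y)].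
Proof.
by case: Z_Gruenhage => _ [U [Uop Usep]]; exact: (Gruenhage_sunflowers Uop Usep).
Qed.

Let F := sval (cid Fex).
Let F_sun t : sunflower (F t).
Proof. by have [h _ _] := svalP (cid Fex); exact: h. Qed.
Let petalI D E : section_of_petal F D -> section_of_petal F E -> section_of_petal F (D `&` E).
Proof. by have [_ h _] := svalP (cid Fex); exact: h. Qed.
Let petal_sep x y : x <> y -> exists D, section_of_petal F D /\ ~ (D x <-> D y).
Proof. by have [_ _ h] := svalP (cid Fex); exact: h. Qed.

Let clT : clopen [set: Z].
Proof. by split; [exact: openT|exact: closedT]. Qed.

(* A set of [K A] acts on [x] by summation of the coordinates; a functional on
   [h_space] is represented by a pair of positive functionals, one for each
   sign. *)
Let sum_at (x : X) (z : Z) : R := eval_at hA (fun g => `[< supp z g >]%:R) x.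

Let char_bound (z : Z) g : `|(`[< supp z g >]%:R : R)| <= 1 /\ (`[< supp z g >]%:R != 0 :> R -> supp z g).
Proof.
split; first by rewrite normr_nat lern1 leq_b1.
by case: asboolP => // _; rewrite eqxx.
Qed.

Let char_eval (z : Z) : evaluable A (fun g => `[< supp z g >]%:R : R).
Proof. by exists (supp z), 1; split; [exact: supp_in|by []|move=> g; exact: char_bound]. Qed.

Let sum_at_le x z : `|sum_at x z| <= `|x|.
Proof.
rewrite -[leRHS]mul1r; apply: (@eval_le _ _ _ hA _ x (supp z)) => //; exact: supp_in.
Qed.

Let sum_bounded x : sum_at x \in @bdd_pred R Z.
Proof. by apply/asboolP; exists `|x|; exact: sum_at_le. Qed.

Let sum_fun x : bfun := exist (fun y => y \in @bdd_pred R Z) _ (sum_bounded x).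

Let T x : Y := (sum_fun x, - sum_fun x).

Let sum_fun_linear : linear sum_fun.
Proof.
move=> a x y; apply/val_inj/funext => z; exact: (eval_linear (char_eval z)).
Qed.

Let T_linear : linear T.
Proof.
move=> a x y; rewrite /T sum_fun_linear; congr (_, _).
by rewrite opprD -scalerN.
Qed.

Let lift (s : bool) (y : bfun) : Y := if s then (y, 0) else (0, y).

Let index := option (nat * option nat).

Let clopen_sum (l : seq (set Z)) (C : set Z -> set Z) : bfun :=
  \sum_(V <- l) indic_fun R (C V).

(** Indicators of clopen sets are used throughout, so that suprema over a test set are inner
    contents: of the whole space, of a kernel, or of at most [k] petals added up. *)
Let tests (i : index) : set bfun :=
  match i with
  | None => [set indic_fun R setT]
  | Some (t, None) => [set indic_fun R C | C in [set C | clopen C /\ C `<=` (F t).1]]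
  | Some (t, Some k) => [set y | exists l C, [/\ uniq l, (size l <= k)%N,
      forall V, V \in l -> [/\ (F t).2 V, clopen (C V) & C V `<=` V] &
      y = clopen_sum l C]]
  end.

Let J := (bool * index)%type.

Let B (j : J) : set Y := [set lift j.1 y | y in tests j.2].

Let bound (i : index) : R := if i is Some (_, Some k) then k.+1%:R else 1.

(** Geometric weights over the countable index, divided by the square of the bound of the test
    functions, so that halved point evaluations are admissible. *)
Let w (j : J) : R := 2 ^- (pickle j.2).+1 * (bound j.2) ^- 2.

Let P : set Y := [set y | forall z, 0 <= val y.1 z /\ 0 <= val y.2 z].

Let bound_gt0 i : 0 < bound i.
Proof. by case: i => [[t [k|]]|] /=; rewrite ?ltr0n. Qed.

Let w_gt0 j : 0 < w j.
Proof. by rewrite mulr_gt0// invr_gt0 exprn_gt0. Qed.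

Let val_clopen_sum l C z : val (clopen_sum l C) z = \sum_(V <- l) `[< C V z >]%:R.
Proof.
rewrite /clopen_sum; elim: l => [|V l IHl]; first by rewrite !big_nil.
by rewrite !big_cons -IHl.
Qed.

Let tests_range i y z : tests i y -> 0 <= val y z <= bound i.
Proof.
case: i => [[t [k|]]|] /=.
- move=> [l [C [ul lk _ ->]]]; rewrite val_clopen_sum sumr_ge0//=.
  apply: (@le_trans _ _ (\sum_(V <- l) 1)).
    by apply: ler_sum => V _; rewrite lern1 leq_b1.
  by rewrite big_const_seq count_predT iter_addr_0 ler_nat leqW.
- by move=> [C _ <-] /=; rewrite ler0n lern1 leq_b1.
- by move=> -> /=; rewrite ler0n lern1 leq_b1.
Qed.

Let lift_val s y z : (val (lift s y).1 z = if s then val y z else 0) /\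
  (val (lift s y).2 z = if s then 0 else val y z).
Proof. by case: s. Qed.

Let BP j y : B j y -> P y.
Proof.
move=> [y' ty <-] z; have /andP[y0 _] := tests_range z ty.
by have [-> ->] := lift_val j.1 y' z; case: ifP.
Qed.

Let B0 j : B j !=set0.
Proof.
case: j => s [[t [k|]]|].
- by exists (lift s (clopen_sum [::] id)), (clopen_sum [::] id) => //; exists [::], id.
- exists (lift s (indic_fun R set0)), (indic_fun R set0) => //; exists set0 => //.
  by split; [split; [exact: open0|exact: closed0]|exact: sub0set].
- by exists (lift s (indic_fun R setT)), (indic_fun R setT).
Qed.

Local Notation adm := (admissible P w B).

Let adm_norm : exists2 C : R, 0 < C & forall m y (M : R), adm m -> 0 <= M ->
  (forall z, `|val y.1 z| <= M /\ `|val y.2 z| <= M) -> m y <= M * C.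
Proof.
pose o s := lift s (indic_fun R setT).
(* The value [t] of [m] at a constant test satisfies [w t^2 <= 1], hence [t <= 1 + t^2 <= 1 + w^-1].
   The two constants, one for each component, dominate [y] up to the factor [M]. *)
exists (2 + ((w (true, None))^-1 + (w (false, None))^-1)).
  by rewrite ltr_wpDr// addr_ge0// invr_ge0 ltW.
move=> m y M [ml mP m1] M0 yM.
have mo s : m (o s) <= 1 + (w (s, None))^-1.
  have /choice[b bP] : forall j, exists y, B j y by [].
  pose b' j := if j == (s, None) then o s else b j.
  have /(m1 [:: (s, None)] b' isT) : forall j, B j (b' j).
    move=> j; rewrite /b'; case: eqP => // ->.
    by exists (indic_fun R setT).
  rewrite big_seq1 /b' eqxx -ler_pdivlMl// mulr1 => h.
  have := sqr_ge0 (m (o s)); have := sqr_ge0 (m (o s) - 1); rewrite !expr2 in h *; lra.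
have : 0 <= m (M *: (o true + o false) - y).
  apply: mP => z; have one : (`[< [set: Z] z >]%:R : R) = 1 by rewrite asboolT.
  have -> : val (M *: (o true + o false) - y).1 z = M - val y.1 z.
    rewrite -[LHS]/(M * (`[< [set: Z] z >]%:R + 0) - val y.1 z).
    by rewrite one addr0 mulr1.
  have -> : val (M *: (o true + o false) - y).2 z = M - val y.2 z.
    rewrite -[LHS]/(M * (0 + `[< [set: Z] z >]%:R) - val y.2 z).
    by rewrite one add0r mulr1.
  have [y1 y2] := yM z; have := ler_norm (val y.1 z); have := ler_norm (val y.2 z).
  by move=> *; split; lra.
rewrite (scalar_funB ml) (scalar_funZ ml) (scalar_funD ml) subr_ge0 => /le_trans; apply.
rewrite ler_wpM2l//; have := mo true; have := mo false; lra.
Qed.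

(** Exchanging the two components turns [T x] into [- T x] and permutes the tests. *)
Let adm_flip m : adm m -> exists2 m', adm m' & forall x, m' (T x) = - m (T x).
Proof.
move=> [ml mP m1]; exists (fun y => m (y.2, y.1)).
  split=> [a y y'|y Py|s b us Bb].
  - exact: (ml a (y.2, y.1) (y'.2, y'.1)).
  - by apply: mP => z; have [] := Py z.
  - pose fl (j : J) : J := (~~ j.1, j.2).
    have flK : involutive fl by move=> [[] i].
    pose b' j := ((b (fl j)).2, (b (fl j)).1).
    have Bb' j : B j (b' j).
      have [y ty yb] := Bb (fl j); exists y => //; rewrite /b' -yb /fl.
      by case: j.1.
    have uf : uniq (map fl s) by rewrite map_inj_uniq//; exact: inv_inj.
    apply: le_trans (m1 _ b' uf Bb'); rewrite big_map le_eqVlt; apply/orP; left.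
    by apply/eqP/eq_bigr => j _; rewrite /b' flK.
move=> x; rewrite -mulN1r -(scalar_funZ ml); congr m; rewrite /T/=.
by rewrite -[RHS]/(-1 *: sum_fun x, -1 *: - sum_fun x) scalerN scaleN1r opprK.
Qed.

Let sum_at_unit g z : sum_at (unit_h R hA g) z = `[< supp z g >]%:R.
Proof. by rewrite /sum_at eval_unit. Qed.

(** The geometric weights occur once for each sign and sum to at most 2; the square of the factor
    [2^-1] absorbs this. *)
Let adm_point (s : bool) (z : Z) : adm (fun y : Y => 2^-1 * (if s then val y.1 z else val y.2 z)).
Proof.
split.
- have lin : scalar (fun y : bfun => 2^-1 * val y z).
    by move=> a y y'; rewrite bdd_fun_linE mulrDr mulrCA.
  by move=> a y y'; case: (s); [exact: (lin a y.1 y'.1)|exact: (lin a y.2 y'.2)].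
- by move=> y /(_ z)[? ?]; rewrite mulr_ge0 ?invr_ge0//; case: s.
- move=> l b ul Bb.
  have le j : w j * (2^-1 * (if s then val (b j).1 z else val (b j).2 z)) ^+ 2 <=
      2^-1 * 2 ^- (pickle j.2).+1.
    have [y ty <-] := Bb j; have /andP[y0 y1] := tests_range z ty.
    have [-> ->] := lift_val j.1 y z.
    have : (if s then if j.1 then val y z else 0 else if j.1 then 0 else val y z) ^+ 2 <= bound j.2 ^+ 2.
      by case: (s); case: (j.1); rewrite ler_pXn2r ?nnegrE// ?ltW.
    rewrite exprMn /w; move: (_ ^+ 2) => q qb.
    rewrite -mulrA [leRHS]mulrC ler_pM2l ?invr_gt0 ?exprn_gt0//.
    rewrite ler_pdivrMl ?exprn_gt0//.
    have b2 : 0 <= bound j.2 ^+ 2 by rewrite sqr_ge0.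
    by rewrite expr2; lra.
  apply: (@le_trans _ _ (\sum_(j <- l) 2^-1 * 2 ^- (pickle j.2).+1)).
    by apply: ler_sum => j _; exact: le.
  rewrite -mulr_sumr (bigID (fun j : J => j.1))/=.
  have half (s' : bool) : \sum_(j <- l | j.1 == s') (2 ^- (pickle j.2).+1 : R) <= 1.
    rewrite -big_filter -(big_map snd xpredT (fun i => 2 ^- (pickle i).+1 : R)).
    apply: sum_geometric_le; rewrite map_inj_in_uniq ?filter_uniq//.
    move=> [s1 i1] [s2 i2]; rewrite !mem_filter/= => /andP[/eqP-> _] /andP[/eqP-> _].
    by move=> ->.
  have h1 := half true; have h2 := half false.
  rewrite (eq_bigl (fun j : J => j.1 == true)); last by move=> [[]].
  rewrite [X in _ + X](eq_bigl (fun j : J => j.1 == false)); last by move=> [[]].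
  lra.
Qed.

(** The constant [4^-1]: one half is lost by keeping only the coordinates of the better sign, whose
    set is a point of [K A], and another half in [adm_point]. *)
Let adm_lower x (r : R) : r < 4^-1 * `|x| -> 0 < `|x| -> exists2 m, adm m & r < m (T x).
Proof.
move=> rx x0; have A0 : A !=set0.
  have [//|nA] := pselect (A !=set0); exfalso.
  have AE : A = set0 by apply/seteqP; split=> // B' AB'; apply: nA; exists B'.
  by move: x0; rewrite -[`|x|]/(ell_norm (val x)) ell_norm_set0// ltxx.
have [|s [us As rs]] := @sum_entry_gt _ _ _ hA x (4 * r) A0.
  by rewrite -ltr_pdivlMl.
pose sg (b : bool) := [seq g <- s | (0 <= entry x g) == b].
have Asg b : A [set` sg b].
  case: hA => _ + _; apply; first exact: As.
  by move=> g; rewrite /= mem_filter => /andP[].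
have sumE b : sum_at x (chiK (Asg b)) = \sum_(g <- sg b) entry x g.
  rewrite /sum_at (@eval_finite _ _ _ _ _ x (sg b)); last first.
    move=> g gb; rewrite supp_chiK asboolF ?mul0r//; exact/negP.
  have usg : uniq (sg b) by rewrite filter_uniq.
  rewrite undup_id//; apply: eq_big_seq => g gb.
  by rewrite supp_chiK asboolT ?mul1r.
have split_sum : \sum_(g <- s) `|entry x g| =
    \sum_(g <- sg true) entry x g - \sum_(g <- sg false) entry x g.
  rewrite (bigID (fun g => 0 <= entry x g))/= !big_filter; congr (_ + _).
    rewrite (eq_bigl (fun g => (0 <= entry x g) == true)); last by move=> g; case: (0 <= _).
    by apply: eq_bigr => g /eqP g0; rewrite ger0_norm.
  rewrite -sumrN (eq_bigl (fun g => (0 <= entry x g) == false)); last by move=> g; case: (0 <= _).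
  by apply: eq_bigr => g /eqP/negbT; rewrite -ltNge => g0; rewrite ltr0_norm.
have e1 b : val (T x).1 (chiK (Asg b)) = sum_at x (chiK (Asg b)) by [].
have e2 b : val (T x).2 (chiK (Asg b)) = - sum_at x (chiK (Asg b)) by [].
have [h|h] := ltP (2 * r) (\sum_(g <- sg true) entry x g).
  exists (fun y : Y => 2^-1 * val y.1 (chiK (Asg true))); first exact: (adm_point true).
  by rewrite e1 sumE ltr_pdivlMl.
exists (fun y : Y => 2^-1 * val y.2 (chiK (Asg false))); first exact: (adm_point false).
rewrite e2 sumE ltr_pdivlMl//.
by move: rs; rewrite split_sum; move: h; lra.
Qed.

Let test_has_sup m j : adm m -> has_sup [set m y | y in B j].
Proof.
move=> am; have [C _ normC] := adm_norm; split.
  by have [y By] := B0 j; exists (m y), y.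
exists (bound j.2 * C) => _ [_ [y ty <-] <-]; apply: normC => // [|z]; first exact: ltW.
have /andP[y0 y1] := tests_range z ty.
have [-> ->] := lift_val j.1 y z.
by case: ifP => _; rewrite normr0 ger0_norm// (ltW (bound_gt0 _)).
Qed.

Let content_of (m : Y -> R) s C := m (lift s (indic_fun R C)).

Let liftD s y y' : lift s (y + y') = lift s y + lift s y'.
Proof.
case: s; rewrite /lift; first by rewrite -[RHS]/(y + y', 0 + 0) addr0.
by rewrite -[RHS]/(0 + 0, y + y') addr0.
Qed.

Let lift0 s : lift s 0 = 0.
Proof. by case: s. Qed.

Let content_ofP m s : scalar m -> (forall y, P y -> 0 <= m y) -> clopen_content (content_of m s).
Proof.
move=> m_lin m_pos; split=> [C _|C D _ _ CD].
  apply: m_pos => z; have [-> ->] := lift_val s (indic_fun R C) z.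
  by case: ifP => _; rewrite ?ler0n.
by rewrite /content_of indic_funU// liftD (scalar_funD m_lin).
Qed.

Let m_clopen_sum m s l C : scalar m ->
  m (lift s (clopen_sum l C)) = \sum_(V <- l) content_of m s (C V).
Proof.
move=> m_lin; rewrite /clopen_sum; elim: l => [|V l IHl].
  by rewrite !big_nil lift0 (scalar_fun0 m_lin).
by rewrite !big_cons liftD (scalar_funD m_lin) IHl.
Qed.

Let sups_total m s : sup [set m y | y in B (s, None)] = content_of m s setT.
Proof.
rewrite [X in sup X](_ : _ = [set content_of m s setT]) ?sup1//.
apply/seteqP; split=> q /=; first by move=> [_ [_ -> <-] <-].
by move=> ->; exists (lift s (indic_fun R setT)) => //; exists (indic_fun R setT).
Qed.

Let sups_kernel m s t : sup [set m y | y in B (s, Some (t, None))] = inner (content_of m s) (F t).1.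
Proof.
rewrite /inner; congr sup; apply/seteqP; split=> q /=.
  by move=> [_ [_ [C CF <-] <-] <-]; exists C.
move=> [C CF <-]; exists (lift s (indic_fun R C)) => //.
by exists (indic_fun R C) => //; exists C.
Qed.

Let sups_petals_le m s t k q : scalar m -> (forall y, P y -> 0 <= m y) ->
  (forall l, uniq l /\ [set` l] `<=` (F t).2 -> (size l <= k)%N ->
    \sum_(V <- l) inner (content_of m s) V <= q) ->
  sup [set m y | y in B (s, Some (t, Some k))] <= q.
Proof.
move=> m_lin m_pos h; apply: ge_sup.
  by have [y By] := B0 (s, Some (t, Some k)); exists (m y), y.
move=> _ [_ [_ [l [C [ul lk lC ->]]] <-] <-]; rewrite [lift _ _]/= (m_clopen_sum _ _ _ m_lin).
apply: le_trans (h l _ lk); last by split=> // V /lC[].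
rewrite big_seq [leRHS]big_seq; apply: ler_sum => V /lC[_ Ccl CV].
exact: (inner_ub (content_ofP s m_lin m_pos) Ccl CV).
Qed.

(** With [sups_petals_le] this identifies the test value as the supremum of the sums of inner
    contents over at most [k] petals. The error is shared among the petals; [(size l).+1] covers the
    empty list. *)
Let sups_petals_ge m s t k l : scalar m -> (forall y, P y -> 0 <= m y) ->
  has_sup [set m y | y in B (s, Some (t, Some k))] ->
  uniq l /\ [set` l] `<=` (F t).2 -> (size l <= k)%N ->
  \sum_(V <- l) inner (content_of m s) V <= sup [set m y | y in B (s, Some (t, Some k))].
Proof.
move=> m_lin m_pos hs [ul lF] lk; set q := sup _; apply/ler_addgt0Pr => eps eps0.
pose d := eps / (size l).+1%:R; have d0 : 0 < d by rewrite divr_gt0.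
have /choice[C CP] : forall V, exists C, [/\ clopen C, C `<=` V &
    inner (content_of m s) V - d < content_of m s C].
  move=> V; apply: (inner_lt (content_ofP s m_lin m_pos)).
  by rewrite ltrBlDr ltrDl.
have : m (lift s (clopen_sum l C)) <= q.
  apply: (sup_upper_bound hs); exists (lift s (clopen_sum l C)) => //.
  exists (clopen_sum l C) => //; exists l, C; split=> // V Vl.
  by have [Ccl CV _] := CP V; split=> //; exact: lF.
rewrite (m_clopen_sum _ _ _ m_lin) => hq.
apply: (@le_trans _ _ (\sum_(V <- l) (content_of m s (C V) + d))).
  by apply: ler_sum => V _; rewrite -lerBlDr ltW//; have [] := CP V.
rewrite big_split/= lerD// big_const_seq count_predT iter_addr_0 -[leLHS]mulr_natr.
by rewrite /d mulrAC ler_pdivrMr ?ltr0n// ler_pM2l// ler_nat.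
Qed.

(** Totals and kernels agree directly, inner contents of petals by [top_sums_determine], hence outer
    contents of petals without kernel and, by separation, contents of all clopen sets. At a unit
    vector, [T] is a difference of lifted clopen indicators. *)
Let adm_separated m1 m2 : adm m1 -> adm m2 ->
  (forall j, sup [set m1 y | y in B j] = sup [set m2 y | y in B j] /\
     sup [set m1 y + m2 y | y in B j] = sup [set m1 y | y in B j] + sup [set m2 y | y in B j]) ->
  forall x, range (unit_h R hA) x -> m1 (T x) = m2 (T x).
Proof.
move=> am1 am2 eq_sup _ [g _ <-]; have [l1 p1 _] := am1; have [l2 p2 _] := am2.
have c1 s : clopen_content (content_of m1 s) by exact: content_ofP.
have c2 s : clopen_content (content_of m2 s) by exact: content_ofP.
have l12 : scalar (fun y => m1 y + m2 y).
  by move=> a y y'; rewrite l1 l2 addrACA -mulrDr.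
have p12 y : P y -> 0 <= m1 y + m2 y by move=> Py; rewrite addr_ge0 ?p1 ?p2.
have total s : content_of m1 s setT = content_of m2 s setT.
  by have [+ _] := eq_sup (s, None); rewrite !sups_total.
have kernel s t : inner (content_of m1 s) (F t).1 = inner (content_of m2 s) (F t).1.
  by have [+ _] := eq_sup (s, Some (t, None)); rewrite !sups_kernel.
have petal_inner s t V : (F t).2 V -> inner (content_of m1 s) V = inner (content_of m2 s) V.
  have [F1op F2 _] := F_sun t.
  pose S (m : Y -> R) k := sup [set m y | y in B (s, Some (t, Some k))].
  have outerE (c : set Z -> R) (l : seq (set Z)) : clopen_content c -> [set` l] `<=` (F t).2 ->
      \sum_(U <- l) (inner c U - inner c (F t).1) = \sum_(U <- l) outer c (U `\` (F t).1).
    move=> cc lF; apply: eq_big_seq => U /lF FU; have [Uop FU1] := F2 _ FU.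
    by rewrite (outer_setD Zcpt clb cc).
  (* The content of the kernel is the common lower bound [r], and by [sunflower_sum] the total
     content bounds the sums of the excesses. *)
  apply: (@top_sums_determine R _ (F t).2 _ _ (inner (content_of m1 s) (F t).1)
    (content_of m1 s setT) (S m1) (S m2) (S (fun y => m1 y + m2 y))).
  - exact: inner_ge0.
  - by move=> U /F2[_ FU]; exact: inner_mono.
  - by move=> U /F2[_ FU]; rewrite kernel; exact: inner_mono.
  - by move=> l [ul lF]; rewrite outerE//; exact: sunflower_sum.
  - by move=> l [ul lF]; rewrite kernel outerE// total; exact: sunflower_sum.
  - by move=> k l sl lk; apply: sups_petals_ge => //; exact: test_has_sup.
  - by move=> k l sl lk; apply: sups_petals_ge => //; exact: test_has_sup.
  - move=> k q h; apply: sups_petals_le => // l sl lk; apply: le_trans (h l sl lk).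
    by apply: ler_sum => U _; rewrite -innerD.
  - by move=> k; have [] := eq_sup (s, Some (t, Some k)).
  - by move=> k; have [_] := eq_sup (s, Some (t, Some k)).
have petal s D : section_of_petal F D -> outer (content_of m1 s) D = outer (content_of m2 s) D.
  move=> [t [V [FV ->]]]; have [F1op F2 _] := F_sun t; have [Vop FV1] := F2 _ FV.
  by rewrite !(outer_setD Zcpt clb)// (petal_inner s t V FV) kernel.
have Ccl := @clopen_supp Gamma A g.
have eqC s : content_of m1 s [set z | supp z g] = content_of m2 s [set z | supp z g].
  exact: (petals_determine_content Zcpt clb F_sun petalI petal_sep (c1 s) (c2 s)
    (total s) (petal s) Ccl).
have TE : T (unit_h R hA g) = lift true (indic_fun R [set z | supp z g]) -
    lift false (indic_fun R [set z | supp z g]).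
  have sE : sum_fun (unit_h R hA g) = indic_fun R [set z : Z | supp z g].
    by apply/val_inj/funext => z; exact: sum_at_unit.
  rewrite /T sE -[RHS]/(indic_fun R [set z : Z | supp z g] - 0, 0 - indic_fun R [set z : Z | supp z g]).
  by rewrite subr0 sub0r.
rewrite TE (scalar_funB l1) (scalar_funB l2).
by have := eqC true; have := eqC false; rewrite /content_of => -> ->.
Qed.

Let units_total (f g : X -> R) : scalar f -> scalar g ->
  (exists M, forall x, `|f x| <= M * `|x|) -> (exists M, forall x, `|g x| <= M * `|x|) ->
  (forall x, range (unit_h R hA) x -> f x = g x) -> f = g.
Proof.
move=> fl gl [M fM] [M' gM] fg; apply/funext => x; apply/eqP.
rewrite -subr_eq0 -normr_le0; apply/ler_addgt0Pr => eps eps0; rewrite add0r.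
have M0 : 0 < `|M| + `|M'| + 1 by rewrite ltr_wpDl// addr_ge0.
have [y [s [ys xy]]] := fin_supp_dense x (divr_gt0 eps0 M0).
have yE : y = \sum_(h <- undup s) entry y h *: unit_h R hA h.
  apply/val_inj/val_inj/funext => h; rewrite -/(entry y h) -/(entry _ h).
  have -> : entry (\sum_(h <- undup s) entry y h *: unit_h R hA h) h =
      \sum_(k <- undup s) entry y k * (h == k)%:R.
    by elim: (undup s) => [|k l IHl]; rewrite ?big_nil// !big_cons entryD IHl entryZ.
  have [hs|hs] := boolP (h \in s); last first.
    rewrite ys// big_seq big1// => k; rewrite mem_undup.
    by have [<-|] := eqVneq h k; rewrite ?mulr0// (negbTE hs).
  rewrite (bigD1_seq h)/= ?mem_undup ?undup_uniq// eqxx mulr1 big1 ?addr0// => k /negbTE kh.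
  by rewrite eq_sym kh mulr0.
have fgy : f y = g y.
  have lin_sum (h : X -> R) : scalar h -> h y = \sum_(k <- undup s) entry y k * h (unit_h R hA k).
    move=> hl; rewrite {1}yE; elim: (undup s) => [|k l IHl].
      by rewrite !big_nil (scalar_fun0 hl).
    by rewrite !big_cons (scalar_funD hl) (scalar_funZ hl) IHl.
  by rewrite (lin_sum f fl) (lin_sum g gl); apply: eq_bigr => k _; rewrite fg//; exists k.
have -> : f x - g x = f (x - y) - g (x - y).
  by rewrite (scalar_funB fl) (scalar_funB gl) fgy opprB addrA subrK.
apply: le_trans (ler_normB _ _) _.
apply: (@le_trans _ _ ((`|M| + `|M'| + 1) * `|x - y|)).
  rewrite !mulrDl mul1r -[leLHS]addr0 lerD// lerD//.
    by apply: le_trans (fM _) _; rewrite ler_wpM2r// ler_norm.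
  by apply: le_trans (gM _) _; rewrite ler_wpM2r// ler_norm.
by rewrite mulrC -ler_pdivlMr// ltW.
Qed.

Lemma Gruenhage_strictly_convex_dual : exists N : X -> R,
  equivalent_norm N /\ strictly_convex (dual N) (dual_norm N).
Proof.
have [C C0 normC] := adm_norm.
have adm_bounded (y : Y) : exists M, forall m, adm m -> m y <= M.
  have /asboolP[M1 y1M] := valP y.1; have /asboolP[M2 y2M] := valP y.2.
  exists ((`|M1| + `|M2|) * C) => m am; apply: normC => // z.
  split; [apply: le_trans (y1M z) _|apply: le_trans (y2M z) _].
    by apply: le_trans (ler_norm _) _; rewrite lerDl.
  by apply: le_trans (ler_norm _) _; rewrite lerDr.
have adm_upper (m : Y -> R) x : adm m -> m (T x) <= C * `|x|.
  move=> am; rewrite mulrC; apply: normC => // z.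
  have e2 : val (T x).2 z = - sum_at x z by [].
  by split; [exact: sum_at_le|rewrite e2 normrN; exact: sum_at_le].
have c0 : 0 < 4^-1 :> R by rewrite invr_gt0.
exact: (strictly_convex_dual_norm T_linear w_gt0 B0 BP adm_bounded C0 c0 adm_upper
  adm_lower adm_flip adm_separated units_total).
Qed.

End Gruenhage_renorming.

Theorem theorem2p5 (R : realType) (Gamma : choiceType)
    (A : set (set Gamma)) (hA : adequate A) :
  [<-> compact [set: K A] /\ Gruenhage_space (K A);
       exists N : h_space R hA -> R,
         equivalent_norm N /\ strictly_convex (dual N) (dual_norm N);
       exists rho : K A -> R,
         [/\ forall x, 0 <= rho x <= 1,
             strictly_increasing rho &
             lower_semicontinuous (EFin \o rho)];
       descriptive_space (K A)].
Proof.
tfae.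
- by case=> _; exact: Gruenhage_strictly_convex_dual.
- by move=> [N [N_equiv N_sc]]; exact: strictly_convex_increasing N_equiv N_sc.
- by move=> [rho [_ rho_inc rho_lsc]]; exact: (increasing_descriptive hA rho_inc rho_lsc).
- move=> desc; split; first exact: K_compact.
  exact: descriptive_Gruenhage (@K_clopen_base Gamma A) (@K_hausdorff Gamma A) desc.
Qed.
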